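(* Let $\mathbb{S}^3$ be the 3-sphere endowed with its standard metric, and let $(p,q)$ satisfy $p\ge2$ and $\frac2p+\frac6q=3$. Let $s<\frac1p$. Then the estimate $$\|e^{it(\Delta_x-\Delta_y)}u_0\|_{L^p([0,1];L^q(\mathbb{S}^3_x\times\mathbb{S}^3_y))}\le C\|u_0\|_{H^s(\mathbb{S}^3_x\times\mathbb{S}^3_y)}$$ fails; that is, there is no constant $C>0$ for which it holds for all $u_0\in C^\infty(\mathbb{S}^3\times\mathbb{S}^3)$.
   Context: $\Delta_x$ and $\Delta_y$ denote the Laplace-Beltrami operator of $\mathbb{S}^3$ acting on the first variable $x$ and the second variable $y$, respectively, of functions on $\mathbb{S}^3_x\times\mathbb{S}^3_y$. The product carries the product metric and its Riemannian measure, with respect to which $\Delta_x-\Delta_y$ is essentially self-adjoint on $C^\infty(\mathbb{S}^3\times\mathbb{S}^3)$; $e^{it(\Delta_x-\Delta_y)}$ is the associated unitary group on $L^2(\mathbb{S}^3\times\mathbb{S}^3)$. $H^s$ is the usual Sobolev space. Exponents lie in $[2,\infty]$, with $1/\infty=0$. *)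

(* Defs.v *)
From HB Require Import structures.
From mathcomp Require Import all_boot all_order all_algebra.
From mathcomp Require Import complex.
From mathcomp Require Import all_classical all_reals all_analysis.
From mathcomp Require Import measurable_realfun ess_sup_inf.
From mathcomp Require Import lra.

Set Implicit Arguments.
Unset Strict Implicit.
Unset Printing Implicit Defensive.

Import Order.TTheory GRing.Theory Num.Theory.
Import numFieldNormedType.Exports.

Local Open Scope classical_set_scope.
Local Open Scope ring_scope.

(* [mR4 R] is [R4 R] seen with the Borel sigma-algebra on which
   [lebesgue_measure] is defined; the two types are convertible. *)
Notation R4 R := (R * R * R * R)%type.
Notation mR4 R := (measurableTypeR R * measurableTypeR R *
  measurableTypeR R * measurableTypeR R)%type.

Definition lebesgue4 (R : realType) : {measure set (mR4 R) -> \bar R} :=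
  (@lebesgue_measure R \x @lebesgue_measure R \x @lebesgue_measure R
   \x @lebesgue_measure R)%E.

Section euclidean.
Context {R : realType}.

(* The library norm of a product is the sup norm, which gives the right
   topology and derivatives; [enorm] is the Euclidean length. *)
Definition sqnorm (x : R4 R) : R :=
  x.1.1.1 ^+ 2 + x.1.1.2 ^+ 2 + x.1.2 ^+ 2 + x.2 ^+ 2.

Definition enorm (x : R4 R) : R := Num.sqrt (sqnorm x).

Definition basis4 : seq (R4 R) :=
  [:: (1, 0, 0, 0); (0, 1, 0, 0); (0, 0, 1, 0); (0, 0, 0, 1)].

Lemma sqnorm_ge0 x : 0 <= sqnorm x.
Proof. by rewrite !addr_ge0// sqr_ge0. Qed.

Lemma sqnormZ a x : sqnorm (a *: x) = a ^+ 2 * sqnorm x.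
Proof. by rewrite /sqnorm/= /GRing.scale/= !exprMn !mulrDr. Qed.

Lemma sqnorm_eq0 x : (sqnorm x == 0) = (x == 0).
Proof.
apply/idP/eqP => [|->]; last by rewrite /sqnorm/= !expr0n/= !addr0.
case: x => [[[a b] c] d]; rewrite /sqnorm/=.
rewrite !paddr_eq0 ?addr_ge0 ?sqr_ge0// !sqrf_eq0.
by move=> /andP[/andP[/andP[/eqP-> /eqP->] /eqP->] /eqP->].
Qed.

Lemma measurable_coord1 : measurable_fun [set: mR4 R] (fun x => x.1.1.1 : R).
Proof.
apply: (measurableT_comp (@measurable_fst _ _ (measurableTypeR R) (measurableTypeR R))).
apply: (measurableT_comp (@measurable_fst _ _ _ (measurableTypeR R))).
exact: measurable_fst.
Qed.

Lemma measurable_coord2 : measurable_fun [set: mR4 R] (fun x => x.1.1.2 : R).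
Proof.
apply: (measurableT_comp (@measurable_snd _ _ (measurableTypeR R) (measurableTypeR R))).
apply: (measurableT_comp (@measurable_fst _ _ _ (measurableTypeR R))).
exact: measurable_fst.
Qed.

Lemma measurable_coord3 : measurable_fun [set: mR4 R] (fun x => x.1.2 : R).
Proof.
apply: (measurableT_comp (@measurable_snd _ _ _ (measurableTypeR R))).
exact: measurable_fst.
Qed.

Lemma measurable_coord4 : measurable_fun [set: mR4 R] (fun x => x.2 : R).
Proof. exact: measurable_snd. Qed.

Lemma measurable_sqnorm : measurable_fun [set: mR4 R] (sqnorm : mR4 R -> R).
Proof.
apply: measurable_funD; last by apply: measurable_funX; exact: measurable_coord4.
apply: measurable_funD; last by apply: measurable_funX; exact: measurable_coord3.
by apply: measurable_funD; apply: measurable_funX;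
  [exact: measurable_coord1|exact: measurable_coord2].
Qed.

Lemma measurable_enorm : measurable_fun [set: mR4 R] (enorm : mR4 R -> R).
Proof.
apply: measurableT_comp measurable_sqnorm.
apply: continuous_measurable_fun; exact: sqrt_continuous.
Qed.

Definition ball4 : set (mR4 R) := [set x | enorm x <= 1].

Lemma measurable_ball4 : measurable ball4.
Proof.
have -> : ball4 = [set: mR4 R] `&` (enorm : mR4 R -> R) @^-1` [set y | y <= 1].
  by rewrite setTI.
by rewrite -set_itvNyc; apply: measurable_enorm.
Qed.

End euclidean.

Record S3 (R : realType) := MkS3 { vecS3 :> R4 R ; _ : sqnorm vecS3 == 1 }.

HB.instance Definition _ (R : realType) := [isSub for @vecS3 R].
HB.instance Definition _ (R : realType) := [Choice of S3 R by <:].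

Lemma north_subproof (R : realType) : sqnorm ((1, 0, 0, 0) : R4 R) == 1.
Proof. by rewrite /sqnorm/= expr1n !expr0n/= !addr0. Qed.

Definition north (R : realType) : S3 R := MkS3 (north_subproof R).

HB.instance Definition _ (R : realType) := isPointed.Build (S3 R) (north R).
(* The sigma-algebra of [S3 R] is the trace of the Borel sets of R^4. *)
HB.instance Definition _ (R : realType) :=
  Measurable.copy (S3 R)
    (g_sigma_algebra_preimageType (@vecS3 R : S3 R -> mR4 R)).

Section sphere.
Context {R : realType}.

(* [x / |x|]; the value at 0 is irrelevant. *)
Definition radial (x : R4 R) : S3 R := insubd (north R) ((enorm x)^-1 *: x).

Lemma vecS3_radial x : x != 0 -> radial x = (enorm x)^-1 *: x :> R4 R.
Proof.
move=> x0; rewrite /radial -[LHS]/(val _) val_insubd ifT//.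
by rewrite sqnormZ exprVn sqr_sqrtr ?sqnorm_ge0// mulVf// sqnorm_eq0.
Qed.

Lemma radial0 : radial 0 = north R.
Proof.
apply: val_inj; rewrite /radial val_insubd ifF//.
by rewrite scaler0 (_ : sqnorm 0 = 0) ?(eq_sym 0) ?oner_eq0//;
  apply/eqP; rewrite sqnorm_eq0.
Qed.

Lemma measurable_radial : measurable_fun [set: mR4 R] (radial : mR4 R -> S3 R).
Proof.
have mV : measurable_fun [set: mR4 R] (fun x : mR4 R => (enorm x)^-1 : R).
  rewrite (_ : (fun _ => _) = (fun x => (enorm x) `^ (-1))); last first.
    by apply/funext => x; rewrite powR_inv1// sqrtr_ge0.
  exact: measurableT_comp (measurable_powR _) measurable_enorm.
have ms : measurable_fun [set: mR4 R]
    (fun x : mR4 R => (enorm x)^-1 *: (x : R4 R) : mR4 R).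
  apply/measurable_fun_pairP; split; last first.
    exact: (measurable_funM mV measurable_coord4).
  apply/measurable_fun_pairP; split; last first.
    exact: (measurable_funM mV measurable_coord3).
  apply/measurable_fun_pairP; split; last first.
    exact: (measurable_funM mV measurable_coord2).
  exact: (measurable_funM mV measurable_coord1).
have m : measurable_fun [set: mR4 R] (fun x : mR4 R => vecS3 (radial x) : mR4 R).
  rewrite (_ : (fun _ => _) = (fun x => if sqnorm x == 0 then vecS3 (north R)
      else (enorm x)^-1 *: x)); last first.
    apply/funext => x; rewrite sqnorm_eq0; case: ifPn => [/eqP->|x0].
      by rewrite radial0.
    by rewrite vecS3_radial.
  apply: measurable_fun_ifT => //.
  apply: (measurable_fun_eqr measurable_sqnorm).
  exact: measurable_cst.
move=> _ _ [B mB <-]; rewrite setTI setTI.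
by have := m measurableT _ mB; rewrite setTI.
Qed.

(* The Riemannian surface measure: in polar coordinates the part of the unit
   ball in the cone over A has volume sigma(A) * \int_0^1 r^3 dr = sigma(A) / 4. *)
Definition sphere_measure (A : set (S3 R)) : \bar R :=
  (4%:E * lebesgue4 R ((radial : mR4 R -> S3 R) @^-1` A `&` ball4))%E.

Let ball_measure : {measure set (mR4 R) -> \bar R} :=
  mscale 4%:nng (mrestr (lebesgue4 R) measurable_ball4).

Let sphere0 : sphere_measure set0 = 0%E.
Proof. by rewrite /sphere_measure preimage_set0 set0I measure0 mule0. Qed.

Let sphere_ge0 A : (0 <= sphere_measure A)%E.
Proof. by rewrite mule_ge0. Qed.

Let sphere_sigma_additive : semi_sigma_additive sphere_measure.
Proof.
move=> F mF tF mUF; rewrite /sphere_measure preimage_bigcup.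
have mP (B : set (S3 R)) : measurable B ->
    measurable ((radial : mR4 R -> S3 R) @^-1` B).
  by move=> mB; rewrite -[X in measurable X]setTI; exact: measurable_radial.
apply: (@measure_semi_sigma_additive _ _ _ ball_measure
  (fun n => (radial : mR4 R -> S3 R) @^-1` F n)).
- by move=> n; exact: mP.
- apply/trivIsetP => /= i j _ _ ij; rewrite -preimage_setI.
  by move/trivIsetP : tF => /(_ _ _ _ _ ij) ->//; rewrite preimage_set0.
- by rewrite -preimage_bigcup; exact: mP.
Qed.

HB.instance Definition _ := isMeasure.Build _ _ _
  sphere_measure sphere0 sphere_ge0 sphere_sigma_additive.

Lemma lebesgue4_ball_lty : (lebesgue4 R ball4 < +oo)%E.
Proof.
pose I : set (measurableTypeR R) := `[(-1)%R, 1%R]%classic.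
have mI : measurable I by exact: measurable_itv.
have I_le (x : R4 R) (y : R) : enorm x <= 1 -> y ^+ 2 <= sqnorm x -> I y.
  move=> x1 yx; rewrite /I/= in_itv/= -ler_norml.
  have n1 : sqnorm x <= 1 by rewrite -(sqr_sqrtr (sqnorm_ge0 x)) expr_le1 ?sqrtr_ge0.
  by rewrite -(@expr_le1 _ 2)// real_normK ?num_real// (le_trans yx).
have le : (lebesgue4 R ball4 <= lebesgue4 R (I `*` I `*` I `*` I))%E.
  apply: le_measure; rewrite ?inE.
  - exact: measurable_ball4.
  - by do 3 (apply: measurableX => //).
  - move=> -[[[a b] c] d] xle.
    have a2 := sqr_ge0 (a : R); have b2 := sqr_ge0 (b : R).
    have c2 := sqr_ge0 (c : R); have d2 := sqr_ge0 (d : R).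
    split; [split; [split|]|].
    + by apply: (I_le (a, b, c, d) a xle); rewrite /sqnorm/=; lra.
    + by apply: (I_le (a, b, c, d) b xle); rewrite /sqnorm/=; lra.
    + by apply: (I_le (a, b, c, d) c xle); rewrite /sqnorm/=; lra.
    + by apply: (I_le (a, b, c, d) d xle); rewrite /sqnorm/=; lra.
have lI : (lebesgue_measure I < +oo)%E.
  by rewrite /I lebesgue_measure_itv/=; case: ifPn; rewrite ?ltry.
have mul_lty (a b : \bar R) :
    (0 <= a -> 0 <= b -> a < +oo -> b < +oo -> a * b < +oo)%E.
  by move=> a0 b0 aoo boo; rewrite lte_mul_pinfty// ge0_fin_numE.
have mII : measurable (I `*` I) by exact: measurableX.
have mIII : measurable (I `*` I `*` I) by exact: measurableX.
apply: (le_lt_trans le); rewrite /lebesgue4/= product_measure1E//.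
apply: (@mul_lty) => //; rewrite [ltLHS]product_measure1E//.
by apply: (@mul_lty) => //; rewrite [ltLHS]product_measure1E//; exact: (@mul_lty).
Qed.

Let sphere_fin : fin_num_fun sphere_measure.
Proof.
move=> A mA; rewrite ge0_fin_numE// lte_mul_pinfty//.
apply: le_lt_trans lebesgue4_ball_lty; apply: le_measure; rewrite ?inE.
- apply: measurableI measurable_ball4.
  by rewrite -[X in measurable X]setTI; exact: measurable_radial.
- exact: measurable_ball4.
- exact: subIsetr.
Qed.

HB.instance Definition _ := Measure_isFinite.Build _ _ _
  sphere_measure sphere_fin.

End sphere.

Section smooth_functions.
Context {R : realType}.

Definition iter_derive (V : normedModType R) (vs : seq V) (F : V -> R) : V -> R :=
  foldr (fun v G => 'D_v G) F vs.

(* C^oo on the open set [D]: differentiability of all iterated directional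
   derivatives also yields their continuity. *)
Definition smooth_on (V : normedModType R) (D : set V) (F : V -> R) : Prop :=
  forall vs x, D x -> differentiable (iter_derive vs F) x.

(* Smoothness on the product of spheres, tested on the extension that is
   constant along rays in each variable. *)
Definition smooth (u : S3 R * S3 R -> R[i]) : Prop :=
  let D := [set p : R4 R * R4 R | p.1 != 0 /\ p.2 != 0] in
  smooth_on D (fun p => complex.Re (u (radial p.1, radial p.2))) /\
  smooth_on D (fun p => complex.Im (u (radial p.1, radial p.2))).

(* The Laplace-Beltrami operator of the round sphere is the Euclidean Laplacian
   of the extension that is constant along rays, restricted to the sphere. *)
Definition laplace_beltrami_re (f : S3 R -> R) (x : S3 R) : R :=
  \sum_(e <- basis4) 'D_e ('D_e (f \o radial)) (vecS3 x).

Definition laplace_beltrami (f : S3 R -> R[i]) (x : S3 R) : R[i] :=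
  Complex (laplace_beltrami_re (fun y => complex.Re (f y)) x)
          (laplace_beltrami_re (fun y => complex.Im (f y)) x).

Definition laplace_x (u : S3 R * S3 R -> R[i]) (z : S3 R * S3 R) : R[i] :=
  laplace_beltrami (fun x => u (x, z.2)) z.1.

Definition laplace_y (u : S3 R * S3 R -> R[i]) (z : S3 R * S3 R) : R[i] :=
  laplace_beltrami (fun y => u (z.1, y)) z.2.

End smooth_functions.

Section function_spaces.
Context {R : realType}.
Local Notation T := (S3 R * S3 R)%type.
Local Notation C := R[i].
Implicit Types u v phi : T -> C.

Definition sphere2_measure : {measure set T -> \bar R} :=
  (@sphere_measure R \x @sphere_measure R)%E.

Definition Lq_norm (q : \bar R) u : \bar R :=
  Lnorm sphere2_measure q (fun z => (ComplexField.Normc.normc (u z))%:E).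

Definition L2 u : Prop :=
  [/\ measurable_fun [set: T] (fun z => complex.Re (u z)),
      measurable_fun [set: T] (fun z => complex.Im (u z)) &
      (Lq_norm 2%:E u < +oo)%E].

Definition inner u v : C :=
  let w z := u z * conjc (v z) in
  Complex (\int[sphere2_measure]_z complex.Re (w z))
          (\int[sphere2_measure]_z complex.Im (w z)).

(* L^p norm over the time interval [0, 1] of the L^q norm in space. *)
Definition LpLq_norm (p q : \bar R) (w : R -> T -> C) : \bar R :=
  Lnorm (mrestr (@lebesgue_measure R) (measurable_itv `[0%R, 1%R]))
    p (fun t => Lq_norm q (w t)).

(* Smooth solutions of - Delta phi = l phi for the Laplace-Beltrami operator
   Delta = Delta_x + Delta_y of the product; by elliptic regularity this is the
   whole L^2 eigenspace. *)
Definition eigenfunction (l : R) phi : Prop :=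
  smooth phi /\ forall z, laplace_x phi z + laplace_y phi z = - (real_complex R l) * phi z.

(* Squared L^2 norm of the orthogonal projection of u on that eigenspace
   (which is 0 when l is not an eigenvalue). *)
Definition spectral_mass (l : R) u : \bar R :=
  ereal_sup [set (ComplexField.Normc.normc (inner u phi) ^+ 2)%:E | phi in
    [set phi | eigenfunction l phi /\ (Lq_norm 2%:E phi <= 1)%E]].

(* The norm of (1 - Delta)^(s/2) u in L^2; the spectrum of - Delta is discrete
   and nonnegative, so the spectral integral is a sum. *)
Definition Hs_norm (s : R) u : \bar R :=
  ((\esum_(l in [set l : R | (0 <= l)%R]) (((1 + l) `^ s)%R%:E * spectral_mass l u))
   `^ 2^-1)%E.

(* [U t] is e^{itA}: a strongly continuous one-parameter group of unitary
   operators of L^2 whose infinitesimal generator extends i A from the smooth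
   functions. When A is essentially self-adjoint on them, the generator is i
   times the closure of A, and Stone's theorem makes U unique. Elements of L^2
   are represented by functions, hence the equalities almost everywhere;
   surjectivity of [U t] follows from the group law. *)
Record unitary_group_of (A : (T -> C) -> T -> C) (U : R -> (T -> C) -> T -> C) :
    Prop := UnitaryGroupOf {
  unitary_group_L2 : forall t u, L2 u -> L2 (U t u) ;
  unitary_group_linear : forall t (a : C) u v, L2 u -> L2 v ->
    {ae sphere2_measure, forall z,
      U t (fun z => a * u z + v z) z = a * U t u z + U t v z} ;
  unitary_group_isometry : forall t u, L2 u ->
    Lq_norm 2%:E (U t u) = Lq_norm 2%:E u ;
  unitary_group_0 : forall u, L2 u ->
    {ae sphere2_measure, forall z, U 0 u z = u z} ;
  unitary_group_D : forall t t' u, L2 u ->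
    {ae sphere2_measure, forall z, U (t + t') u z = U t (U t' u) z} ;
  unitary_group_continuous : forall u, L2 u ->
    Lq_norm 2%:E (fun z => U t u z - u z) @[t --> 0] --> 0%E ;
  unitary_group_generator : forall phi, smooth phi ->
    Lq_norm 2%:E (fun z => (real_complex R t)^-1 * (U t phi z - phi z)
                           - 'i%C * A phi z) @[t --> 0^'] --> 0%E
}.

End function_spaces.

(* Main.v *)
Require Import Defs.
From HB Require Import structures.
From mathcomp Require Import all_boot all_order all_algebra.
From mathcomp Require Import complex.
From mathcomp Require Import all_classical all_reals all_analysis.
From mathcomp Require Import measurable_realfun ess_sup_inf.
From mathcomp Require Import ring lra.

Set Implicit Arguments.
Unset Strict Implicit.
Unset Printing Implicit Defensive.

Import Order.TTheory GRing.Theory Num.Theory.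
Import numFieldNormedType.Exports.

Local Open Scope classical_set_scope.
Local Open Scope ring_scope.

(* For every polynomial F, the function u(x,y) = F(x.y) satisfies
   Delta_x u = Delta_y u, so it is fixed by the evolution and the estimate would
   bound its L^q norm by its H^s norm.

   For finite p take u = w^N with w = (1 + x.y) / 2. Green's identity gives
   (n + 3) M_(n+1) = (n + 3/2) M_n for M_n = \int w^n, so M_n ~ n^(-3/2). Hence
   |u|_q >= c N^(-3/(2q)), while for 0 <= t <= 2 interpolation between L^2 and
   |(1 - Delta) u|_2 <= c N |u|_2 gives |u|_(H^t) <= c N^(t/2 - 3/4). Since
   3/4 - 3/(2q) = 1/(2p), this forces t >= 1/p.

   For p = oo we have q = 2 and s < 0. Then take F = U_N, a Chebyshev polynomial
   of the second kind: u is an eigenfunction for the eigenvalue 2N(N+2), its L^2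
   norm does not depend on N, and its H^s norm tends to 0. *)

(** Near the diagonal [w^N] behaves like [exp(- N theta^2 / 4)], with [theta] the angle between the
    points: it concentrates at distance [N^(-1/2)], in a region of volume [N^(-3/2)], and a
    Laplacian costs a factor [N]. Powers of [w] are preferred to exact harmonics because [1 - Delta]
    maps them to two-term combinations, so that every size reduces to a moment. Interpolation
    controls orders [t >= 0] only: for [s < 0] the low frequencies of [w^N] are not damped, which is
    why a single high frequency replaces it when [p = oo]. The Sobolev norm is built from suprema
    over finite sets of eigenvalues and over eigenfunctions, so it is bounded through orthogonality
    and Bessel's inequality. These rest on Green's identity. As the surface measure is defined by
    cones in the unit ball and the Laplacian by extension along rays, that identity is drawn from a
    divergence theorem in R^4, with a radial cutoff that removes the singularity at the origin and
    tends to the indicator of the ball. *)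

(** * Measurability on the sphere *)

(* [iota] is a pointwise limit of measurable maps with countably many values.
   This gives measurability of [f \o iota] when [f] is continuous only at the
   points of the image of [iota], without comparing the product and the Borel
   sigma-algebras of R^4. *)
Definition countably_approximable (T : topologicalType) d (Y : measurableType d)
    (iota : Y -> T) : Prop :=
  exists (K : countType) (code : nat -> Y -> K) (pt : nat -> K -> T),
    (forall n k, measurable (code n @^-1` [set k])) /\
    (forall y, pt n (code n y) @[n --> \oo] --> iota y).

Lemma countably_approximable_comp (T : topologicalType) d (Y : measurableType d)
    d' (Z : measurableType d') (iota : Y -> T) (h : Z -> Y) :
  measurable_fun [set: Z] h -> countably_approximable iota ->
  countably_approximable (iota \o h).
Proof.
move=> mh [K [code [pt [mc ac]]]].
exists K, (fun n => code n \o h), pt; split=> [n k|y]; last exact: ac.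
by rewrite comp_preimage -[X in measurable X]setTI; exact: mh.
Qed.

Lemma countably_approximable_pair (T T' : topologicalType)
    d (Y : measurableType d) d' (Y' : measurableType d')
    (iota : Y -> T) (iota' : Y' -> T') :
  countably_approximable iota -> countably_approximable iota' ->
  countably_approximable (fun y : Y * Y' => (iota y.1, iota' y.2)).
Proof.
move=> [K [c [p [mc ac]]]] [K' [c' [p' [mc' ac']]]].
exists (K * K')%type, (fun n y => (c n y.1, c' n y.2)),
  (fun n k => (p n k.1, p' n k.2)); split=> [n [k k']|y].
  rewrite (_ : _ @^-1` _ = (c n @^-1` [set k]) `*` (c' n @^-1` [set k'])).
    exact: measurableX.
  by apply/seteqP; split=> -[y y']/= [-> ->].
exact: cvg_pair (ac y.1) (ac' y.2).
Qed.

(** The code rounds down to a multiple of [1 / n.+1]: its fibres are half-open intervals, and the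
    error is at most [1 / n.+1]. *)
Lemma countably_approximable_real (R : realType) :
  countably_approximable (fun x : measurableTypeR R => x : R).
Proof.
have n0 (n : nat) : (0 : R) < n.+1%:R by [].
exists int, (fun n (x : measurableTypeR R) => Num.floor ((n.+1%:R : R) * x)),
  (fun n k => (k%:~R : R) / n.+1%:R); split=> [n k|x].
  rewrite (_ : _ @^-1` _ = `[k%:~R / n.+1%:R, (k + 1)%:~R / n.+1%:R[%classic).
    exact: measurable_itv.
  apply/seteqP; split=> y /=.
    move=> <-; rewrite in_itv/= ler_pdivrMr// ltr_pdivlMr// (mulrC y).
    by rewrite ge_floor/= floorD1_gt.
  rewrite in_itv/= ler_pdivrMr// ltr_pdivlMr// (mulrC y) => ky.
  exact: floor_def.
have fx n : `|(Num.floor (n.+1%:R * x))%:~R / n.+1%:R - x| <= n.+1%:R^-1.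
  rewrite -[X in _ - X](mulfK (lt0r_neq0 (n0 n))) -mulrBl normrM.
  rewrite [X in _ * X]ger0_norm ?invr_ge0// ler_piMl ?invr_ge0//.
  rewrite distrC ger0_norm ?subr_ge0 ?(mulrC x) ?ge_floor//.
  rewrite lerBlDl -[X in _ <= _ + X]/(1%:~R) -intrD ltW//.
  exact: floorD1_gt.
apply/cvgrPdist_le => e e0.
near=> n; rewrite distrC (le_trans (fx n))// ltW//.
near: n; exact: near_infty_natSinv_lt (PosNum e0).
Unshelve. all: by end_near.
Qed.

(** The approximant [f (p n (c n y))] factors through a countable code, so each preimage is a
    countable union of code fibres, however irregular [f] is at the points [p n k]. *)
Lemma measurable_fun_continuous_at (R : realType) (T : topologicalType)
    d (Y : measurableType d) (iota : Y -> T) (D : set Y) (f : T -> R) :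
  countably_approximable iota -> measurable D ->
  (forall y, D y -> {for iota y, continuous f}) ->
  measurable_fun D (f \o iota).
Proof.
move=> [K [c [p [mc ac]]]] mD fc.
apply: (@measurable_fun_cvg _ _ _ D (fun n y => f (p n (c n y)))) => [n|y Dy].
  apply: measurable_funTS => _ B mB; rewrite setTI.
  rewrite (_ : _ @^-1` _ =
     \bigcup_k (c n @^-1` (if f (p n k) \in B then [set k] else set0))).
    apply: countable_bigcupT_measurable => [|k]; first exact: countableP.
    case: ifPn => _; first exact: mc.
    by rewrite preimage_set0.
  apply/seteqP; split=> y /=.
    by move=> By; exists (c n y) => //=; rewrite ifT// inE.
  by move=> [k _]/=; case: ifPn => //; rewrite inE => ? ->.
exact: cvg_comp (ac y) (fc y Dy).
Qed.

Section sphere_maps.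
Context {R : realType}.
Notation R4 := (R4 R).
Notation mR4 := (mR4 R).

Lemma countably_approximable_R4 : countably_approximable (fun x : mR4 => x : R4).
Proof.
have cR := @countably_approximable_real R.
have c2 := countably_approximable_pair cR cR.
have c3 := countably_approximable_pair c2 cR.
have := countably_approximable_pair c3 cR; congr (countably_approximable _).
by apply/funext => -[[[a b] c] d].
Qed.

Lemma measurable_vecS3 : measurable_fun [set: S3 R] (@vecS3 R : S3 R -> mR4).
Proof. by move=> _ B mB; rewrite setTI; exists B => //; rewrite setTI. Qed.

Lemma countably_approximable_S3 : countably_approximable (@vecS3 R).
Proof.
exact: countably_approximable_comp measurable_vecS3 countably_approximable_R4.
Qed.

Definition vecS3_pair (z : S3 R * S3 R) : R4 * R4 := (vecS3 z.1, vecS3 z.2).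

Lemma countably_approximable_S3_pair : countably_approximable vecS3_pair.
Proof.
exact: countably_approximable_pair countably_approximable_S3
  countably_approximable_S3.
Qed.

Lemma vecS3_neq0 (x : S3 R) : vecS3 x != 0.
Proof.
case: x => x /= /eqP x1; apply/eqP => x0; move: x1 => /eqP.
by rewrite x0 (_ : sqnorm 0 = 0) ?(eq_sym 0) ?oner_eq0//; apply/eqP; rewrite sqnorm_eq0.
Qed.

Lemma sqnorm_vecS3 (x : S3 R) : sqnorm (vecS3 x) = 1.
Proof. by case: x => x /= /eqP. Qed.

Lemma enorm_vecS3 (x : S3 R) : enorm (vecS3 x) = 1.
Proof. by rewrite /enorm sqnorm_vecS3 sqrtr1. Qed.

Lemma radial_vecS3 (x : S3 R) : radial (vecS3 x) = x.
Proof.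
by apply: val_inj; rewrite /= vecS3_radial ?vecS3_neq0// enorm_vecS3 invr1 scale1r.
Qed.

Lemma continuous_sqnorm : continuous (@sqnorm R).
Proof.
move=> [[[a b] c] d]; rewrite /sqnorm.
have X (f : R4 -> R) x : {for x, continuous f} ->
    {for x, continuous (fun y => f y ^+ 2)}.
  by move=> fx; apply: (@continuous_comp _ _ _ f (fun t => t ^+ 2)) => //;
    exact: exprn_continuous.
have F1 (x : R4) : {for x, continuous (fun y : R4 => y.1)} by exact: cvg_fst.
have F2 (x : R4) : {for x, continuous (fun y : R4 => y.1.1)}.
  by apply: (@continuous_comp _ _ _ (fun y : R4 => y.1) fst); [exact: F1|exact: cvg_fst].
apply: cvgD; last by apply: X; exact: cvg_snd.
apply: cvgD; last first.
  by apply: X; apply: (@continuous_comp _ _ _ (fun y : R4 => y.1) snd);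
    [exact: F1|exact: cvg_snd].
apply: cvgD; apply: X.
- by apply: (@continuous_comp _ _ _ (fun y : R4 => y.1.1) fst); [exact: F2|exact: cvg_fst].
- by apply: (@continuous_comp _ _ _ (fun y : R4 => y.1.1) snd); [exact: F2|exact: cvg_snd].
Qed.

(** A product of segments is compact and has finite measure by the product structure alone, and it
    contains the Euclidean ball of radius [r]. *)
Definition box4 (r : R) : set R4 :=
  `[- r, r] `*` `[- r, r] `*` `[- r, r] `*` `[- r, r].

Lemma compact_box4 r : compact (box4 r).
Proof. by repeat apply: compact_setX; exact: segment_compact. Qed.

Lemma sqnorm_box4 r x : 0 <= r -> sqnorm x <= r ^+ 2 -> box4 r x.
Proof.
move=> r0; case: x => [[[a b] c] d]; rewrite /sqnorm/= => xr.
have h y : y ^+ 2 <= r ^+ 2 -> y \in `[- r, r].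
  by move=> yr; rewrite in_itv/= -ler_norml -(@ler_pXn2r R 2) ?nnegrE// real_normK ?num_real.
have a2 := sqr_ge0 a; have b2 := sqr_ge0 b.
have c2 := sqr_ge0 c; have d2 := sqr_ge0 d.
by split; [split; [split|]|] => /=; apply: h; lra.
Qed.

Definition sphere4 : set R4 := [set x | sqnorm x = 1].

Lemma compact_sphere4 : compact sphere4.
Proof.
apply: (subclosed_compact _ (@compact_box4 1)).
  rewrite (_ : sphere4 = sqnorm @^-1` [set 1]); last by [].
  apply: closed_comp; last exact: closed_eq.
  by move=> x _; exact: continuous_sqnorm.
by move=> x x1; apply: sqnorm_box4; rewrite // x1 expr1n.
Qed.

Lemma bounded_on_compact (T : topologicalType) (A : set T) (f : T -> R) :
  compact A -> (forall x, A x -> {for x, continuous f}) ->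
  exists B : R, forall x, A x -> `|f x| <= B.
Proof.
move=> cA fc; have [->|A0] := eqVneq A set0; first by exists 0.
have fcA : {within A, continuous (fun x => `|f x|)}.
  apply: continuous_in_subspaceT => x; rewrite inE => Ax.
  by apply: (@continuous_comp _ _ _ f Num.norm); [exact: fc|exact: norm_continuous].
have [c _ fle] := compact_EVT_max (proj1 (set0P _) A0) cA fcA.
by exists `|f c| => x Ax; apply: fle; rewrite inE.
Qed.

End sphere_maps.

(** * The divergence theorem in R^4 *)

Lemma integrable_bounded_support (R : realType) d (T : measurableType d)
    (mu : {measure set T -> \bar R}) (K : set T) (f : T -> R) (B : R) :
  measurable K -> (mu K < +oo)%E -> measurable_fun [set: T] f ->
  (forall x, ~ K x -> f x = 0) -> (forall x, K x -> `|f x| <= B) ->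
  mu.-integrable [set: T] (EFin \o f).
Proof.
move=> mK muK mf f0 fB.
apply: (@le_integrable _ _ _ mu setT _ _ (fun x => (B%:E * (\1_K x)%:E)%E)) => //.
- exact/measurable_EFinP.
- move=> x _; rewrite /= indicE; have [xK|xK] := boolP (x \in K).
    rewrite /= mulr1 lee_fin (le_trans (fB _ _)) ?ler_norm//.
    by move: xK; rewrite inE.
  rewrite f0 ?normr0 ?mulr0//; first by rewrite normr0.
  by move: xK; rewrite notin_setE.
- apply: integrableZl => //; apply/integrableP; split; first exact/measurable_EFinP.
  under eq_integral do rewrite gee0_abs ?lee_fin//.
  by rewrite integral_indic// setIT.
Qed.

(** * Iterated integrals *)

Section product_sigma_finite.
Context d1 d2 (T1 : measurableType d1) (T2 : measurableType d2) (R : realType).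
Variable m1 : {sigma_finite_measure set T1 -> \bar R}.
Variable m2 : {sigma_finite_measure set T2 -> \bar R}.

Let prod := (m1 \x m2)%E.

HB.instance Definition _ := Measure.on prod.

Let prod_sigma_finite : sigma_finite setT prod.
Proof.
have /sigma_finiteP[F [TF ndF Foo]] := sigma_finiteT m1.
have /sigma_finiteP[G [TG ndG Goo]] := sigma_finiteT m2.
exists (fun n => F n `*` G n).
  rewrite -setXTT TF TG; apply/seteqP; split=> -[x y].
    (* The exhaustions are monotone, so the two indices can be replaced by their maximum. *)
    move=> [/= [n _ Fnx] [k _ Gky]]; exists (maxn n k) => //; split.
    - by move: x Fnx; exact/subsetPset/ndF/leq_maxl.
    - by move: y Gky; exact/subsetPset/ndG/leq_maxr.
  by move=> [n _ []/= ? ?]; split; exists n.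
move=> k; have [mF Fk] := Foo k; have [mG Gk] := Goo k.
split; first exact: measurableX.
by rewrite /prod product_measure1E// lte_mul_pinfty// ge0_fin_numE.
Qed.

HB.instance Definition _ :=
  Measure_isSigmaFinite.Build _ _ _ prod prod_sigma_finite.

(** The product measure with its sigma-finite structure, so that it can be a factor of another
    product; Fubini on R^4 peels off one coordinate at a time. *)
Definition product_sigma_finite :
  {sigma_finite_measure set (T1 * T2)%type -> \bar R} := prod.

End product_sigma_finite.

Section iterated.
Context {R : realType} d1 d2 (T1 : measurableType d1) (T2 : measurableType d2)
  (m1 : {sigma_finite_measure set T1 -> \bar R})
  (m2 : {sigma_finite_measure set T2 -> \bar R}).
Variable f : T1 * T2 -> R.
Hypothesis intf : (m1 \x m2)%E.-integrable [set: T1 * T2] (EFin \o f).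

(** Fubini with the second coordinate innermost; [integral_eq0_sections2] has the first one
    innermost. Alternating the two makes any chosen coordinate of R^4 the innermost one. *)
Lemma integral_eq0_sections1 :
  (forall x, \int[m2]_y (f (x, y))%:E = 0)%E ->
  (\int[m1 \x m2]_z (f z)%:E = 0)%E.
Proof.
move=> f0; rewrite -(integral12_prod_meas1 intf).
by rewrite integral0_eq// => x _; exact: f0.
Qed.

Lemma integral_eq0_sections2 :
  (forall y, \int[m1]_x (f (x, y))%:E = 0)%E ->
  (\int[m1 \x m2]_z (f z)%:E = 0)%E.
Proof.
move=> f0; rewrite -(integral21_prod_meas1 intf).
by rewrite integral0_eq// => x _; exact: f0.
Qed.

End iterated.

(** The fundamental theorem of calculus on [[- r, r]], where [W] vanishes at both ends. *)
Lemma integral_derive_eq0 (R : realType) (W h : R -> R) (r : R) : 0 < r ->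
  continuous h -> (forall t : R, is_derive t (1 : R) W (h t)) ->
  (forall t, r <= `|t| -> W t = 0 /\ h t = 0) ->
  (\int[@lebesgue_measure R]_t (h t)%:E = 0)%E.
Proof.
move=> r0 ch dW W0.
have rr : - r < r by lra.
have -> : (\int[@lebesgue_measure R]_t (h t)%:E =
    \int[@lebesgue_measure R]_(t in `[(- r)%R, r]) (h t)%:E)%E.
  rewrite [RHS]integral_mkcond; apply: eq_integral => t _.
  rewrite patchE; case: ifPn => //; rewrite notin_setE/= in_itv/= => /negP.
  rewrite -ler_norml -ltNge => /ltW rt; by rewrite (W0 _ rt).2.
have Wr : W r = 0 by apply: (W0 _ _).1; rewrite ler_norm.
have WNr : W (- r) = 0 by apply: (W0 _ _).1; rewrite normrN ler_norm.
rewrite (@continuous_FTC2 _ h W)//.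
- by rewrite Wr WNr subee.
- exact: continuous_subspaceT.
- have cW : continuous W.
    by move=> t; apply: differentiable_continuous; apply/derivable1_diffP; case: (dW t).
  split; first by move=> t _; case: (dW t).
  + exact: cvg_at_right_filter (cW _).
  + exact: cvg_at_left_filter (cW _).
- by move=> t _; rewrite derive1E; case: (dW t).
Qed.

Section line_derivatives.
Context {R : realType} {V V' : normedModType R} (f : V' -> R) (phi : V -> V')
  (x u : V) (v : V').
Hypothesis phiE : forall h : R, phi (h *: u + x) = h *: v + phi x.

Let quotientE : (fun h : R => h^-1 *: ((f \o phi) (h *: u + x) - (f \o phi) x)) =
  (fun h : R => h^-1 *: (f (h *: v + phi x) - f (phi x))).
Proof. by apply/funext => h /=; rewrite phiE. Qed.

(** The two difference quotients are the same function of [h], so derivability of [f] in the single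
    direction [v] is enough. *)
Lemma derivable_line : derivable f (phi x) v -> derivable (f \o phi) x u.
Proof.
by rewrite /derivable; move: quotientE; rewrite /shift/=/comp/= => ->.
Qed.

Lemma derive_line : 'D_u (f \o phi) x = 'D_v f (phi x).
Proof.
by rewrite /derive; move: quotientE; rewrite /shift/=/comp/= => ->.
Qed.

Lemma is_derive_line df : is_derive (phi x) v f df -> is_derive x u (f \o phi) df.
Proof.
move=> [fd <-]; split; first exact: derivable_line.
exact: derive_line.
Qed.

End line_derivatives.

Section R4_divergence.
Context {R : realType}.
Notation R4 := (R4 R).
Notation mR4 := (mR4 R).
Notation mR := (measurableTypeR R).
Notation lambda := (@lebesgue_measure R).
Notation lambda2 := (product_sigma_finite lambda lambda).
Notation lambda3 := (product_sigma_finite lambda2 lambda).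

Lemma lebesgue4E : lebesgue4 R = (lambda3 \x lambda)%E :> measure _ R.
Proof. by []. Qed.

Lemma measurable_continuous_R4 (H : R4 -> R) : continuous H ->
  measurable_fun [set: mR4] (H : mR4 -> R).
Proof.
move=> cH; have := measurable_fun_continuous_at (@countably_approximable_R4 R)
  measurableT (f := H) (fun y _ => cH y).
exact.
Qed.

Lemma sqr_coord_le_sqnorm (x : R4) :
  [/\ x.1.1.1 ^+ 2 <= sqnorm x, x.1.1.2 ^+ 2 <= sqnorm x,
      x.1.2 ^+ 2 <= sqnorm x & x.2 ^+ 2 <= sqnorm x].
Proof.
case: x => [[[a b] c] d]; rewrite /sqnorm/=.
have := sqr_ge0 a; have := sqr_ge0 b; have := sqr_ge0 c; have := sqr_ge0 d.
by split; lra.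
Qed.

Let box1 (r : R) : set mR := `[- r, r]%classic.

Let mbox1 r : measurable (box1 r). Proof. exact: measurable_itv. Qed.

Let box1_lty r : (lambda (box1 r) < +oo)%E.
Proof. by rewrite /box1 lebesgue_measure_itv/=; case: ifPn; rewrite ?ltry. Qed.

Let mulE_lty (a b : \bar R) :
  (0 <= a -> 0 <= b -> a < +oo -> b < +oo -> a * b < +oo)%E.
Proof. by move=> a0 b0 aoo boo; rewrite lte_mul_pinfty// ge0_fin_numE. Qed.

Let box2_lty r : ((lambda \x lambda) (box1 r `*` box1 r) < +oo)%E.
Proof. by rewrite product_measure1E//; apply: mulE_lty => //; exact: box1_lty. Qed.

Let box3_lty r :
  ((lambda2 \x lambda) (box1 r `*` box1 r `*` box1 r) < +oo)%E.
Proof.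
have m2 : measurable (box1 r `*` box1 r) by exact: measurableX.
rewrite product_measure1E//; apply: mulE_lty => //; last exact: box1_lty.
by rewrite [ltLHS]product_measure1E//; apply: mulE_lty => //; exact: box1_lty.
Qed.

Lemma lebesgue4_box4_lty r : (lebesgue4 R (box4 r) < +oo)%E.
Proof.
have m2 : measurable (box1 r `*` box1 r) by exact: measurableX.
have m3 : measurable (box1 r `*` box1 r `*` box1 r) by exact: measurableX.
rewrite /lebesgue4/= product_measure1E//; apply: mulE_lty => //; last exact: box1_lty.
rewrite [ltLHS]product_measure1E//; apply: mulE_lty => //; last exact: box1_lty.
by rewrite [ltLHS]product_measure1E//; apply: mulE_lty => //; exact: box1_lty.
Qed.

Lemma measurable_box4 r : measurable (box4 r : set mR4).
Proof. by repeat apply: measurableX. Qed.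

Let coord_ge (r y : R) x : 0 < r -> r <= `|y| -> y ^+ 2 <= sqnorm x ->
  r ^+ 2 <= @sqnorm R x.
Proof.
move=> r0 ry; apply: le_trans; rewrite -[leRHS]real_normK ?num_real//.
by rewrite ler_pXn2r ?nnegrE// ltW.
Qed.

Variables (H : R4 -> R) (r : R).
Hypotheses (r_gt0 : 0 < r) (cH : continuous H)
  (H0 : forall x, r ^+ 2 <= sqnorm x -> H x = 0).

Let sup : exists B : R, forall x, `|H x| <= B.
Proof.
have [B HB] := bounded_on_compact (@compact_box4 R r) (fun x _ => @cH x).
exists (Num.max 0 B) => x; rewrite le_max.
have [xr|/ltW xr] := leP (sqnorm x) (r ^+ 2).
  by rewrite HB ?orbT//; apply: sqnorm_box4 => //; exact: ltW.
by rewrite H0// normr0 lexx.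
Qed.

Let out1 a b c d : ~ box1 r a -> H (a, b, c, d) = 0.
Proof.
rewrite /box1/= in_itv/= -ler_norml => /negP; rewrite -ltNge => /ltW ra.
apply: H0; apply: coord_ge ra _ => //; rewrite /sqnorm/=.
by have := sqr_ge0 b; have := sqr_ge0 c; have := sqr_ge0 d; lra.
Qed.

Let out2 a b c d : ~ box1 r b -> H (a, b, c, d) = 0.
Proof.
rewrite /box1/= in_itv/= -ler_norml => /negP; rewrite -ltNge => /ltW ra.
apply: H0; apply: coord_ge ra _ => //; rewrite /sqnorm/=.
by have := sqr_ge0 a; have := sqr_ge0 c; have := sqr_ge0 d; lra.
Qed.

Let out3 a b c d : ~ box1 r c -> H (a, b, c, d) = 0.
Proof.
rewrite /box1/= in_itv/= -ler_norml => /negP; rewrite -ltNge => /ltW ra.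
apply: H0; apply: coord_ge ra _ => //; rewrite /sqnorm/=.
by have := sqr_ge0 b; have := sqr_ge0 a; have := sqr_ge0 d; lra.
Qed.

Let out4 a b c d : ~ box1 r d -> H (a, b, c, d) = 0.
Proof.
rewrite /box1/= in_itv/= -ler_norml => /negP; rewrite -ltNge => /ltW ra.
apply: H0; apply: coord_ge ra _ => //; rewrite /sqnorm/=.
by have := sqr_ge0 b; have := sqr_ge0 c; have := sqr_ge0 a; lra.
Qed.

Lemma integrable_R4_compact_support :
  (lebesgue4 R).-integrable [set: mR4] (EFin \o (H : mR4 -> R)).
Proof.
have [B HB] := sup.
apply: (integrable_bounded_support (measurable_box4 r) (lebesgue4_box4_lty r)
  (measurable_continuous_R4 cH) (B := B)) => // -[[[a b] c] d] nK.
apply: contrapT => n0; apply: nK.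
by split; [split; [split|]|] => /=; apply: contrapT => nb; apply: n0;
  [exact: out1|exact: out2|exact: out3|exact: out4].
Qed.

Let integrable3 d : (lambda2 \x lambda)%E.-integrable [set: mR * mR * mR]
  (EFin \o (fun x => H (x, d))).
Proof.
have [B HB] := sup.
apply: (@integrable_bounded_support _ _ _ _ (box1 r `*` box1 r `*` box1 r) _ B) => //.
- by repeat apply: measurableX.
- exact: box3_lty.
- exact: measurableT_comp (measurable_continuous_R4 cH) (measurable_pair2 d).
move=> -[[a b] c] nK.
apply: contrapT => n0; apply: nK.
by split; [split|] => /=; apply: contrapT => nb; apply: n0;
  [exact: out1|exact: out2|exact: out3].
Qed.

Let integrable2 c d : (lambda \x lambda)%E.-integrable [set: mR * mR]
  (EFin \o (fun x => H (x, c, d))).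
Proof.
have [B HB] := sup.
apply: (@integrable_bounded_support _ _ _ _ (box1 r `*` box1 r) _ B) => //.
- by repeat apply: measurableX.
- exact: box2_lty.
- have m1 := measurableT_comp (measurable_continuous_R4 cH) (measurable_pair2 d).
  exact: (measurableT_comp m1 (measurable_pair2 c)).
move=> -[a b] nK.
apply: contrapT => n0; apply: nK.
by split => /=; apply: contrapT => nb; apply: n0; [exact: out1|exact: out2].
Qed.

Let sqr_norm_le (t y : R) : t ^+ 2 <= y -> r <= `|t| -> r ^+ 2 <= y.
Proof.
move=> ty rt; apply: le_trans ty; rewrite -[leRHS]real_normK ?num_real//.
by rewrite ler_pXn2r ?nnegrE// ltW.
Qed.

(** Fubini with the coordinate of [e] innermost: the inner integral is that of the derivative of a
    compactly supported function of one variable. *)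
Lemma integral_R4_derive_eq0 (e : R4) (W : R4 -> R) : e \in @basis4 R ->
  (forall x, is_derive x e W (H x)) ->
  (forall x, r ^+ 2 <= sqnorm x -> W x = 0) ->
  (\int[lebesgue4 R]_x (H x)%:E = 0)%E.
Proof.
move=> eb dW W0.
have I4 := integrable_R4_compact_support; rewrite lebesgue4E in I4 *.
(* [phi] runs along a line of direction [e]; the bound on [t ^+ 2] turns the vanishing of [H] and
   [W] far from the origin into vanishing for large [t]. *)
have line (phi : R -> R4) : continuous phi ->
    (forall t h : R, phi (h *: (1 : R) + t) = h *: e + phi t) ->
    (forall t : R, t ^+ 2 <= sqnorm (phi t)) ->
    (\int[lambda]_t (H (phi t))%:E = 0)%E.
  move=> cphi phiE phit.
  apply: (integral_derive_eq0 (W := W \o phi) (h := H \o phi) r_gt0).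
  - by move=> t; apply: continuous_comp; [exact: cphi|exact: cH].
  - by move=> t; apply: is_derive_line (dW _) => h; exact: phiE.
  - move=> t rt; have rx := sqr_norm_le (phit t) rt.
    by split; [exact: W0|exact: H0].
have cst_id (T : topologicalType) (a : T) : continuous (fun _ : R => a).
  by move=> t; exact: cvg_cst.
have id_ : continuous (fun t : R => t) by move=> t; exact: cvg_id.
have pairc (T T' : topologicalType) (f : R -> T) (g : R -> T') :
    continuous f -> continuous g -> continuous (fun t => (f t, g t)).
  by move=> cf cg t; apply: cvg_pair; [exact: cf|exact: cg].
have pairE (x y : R4) : x.1.1.1 = y.1.1.1 -> x.1.1.2 = y.1.1.2 ->
    x.1.2 = y.1.2 -> x.2 = y.2 -> x = y.
  by case: x => [[[? ?] ?] ?]; case: y => [[[? ?] ?] ?]/= -> -> -> ->.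
move: eb; rewrite /basis4 !inE => /or4P[] /eqP eE; rewrite eE in line.
- apply: (integral_eq0_sections2 I4) => d.
  apply: (integral_eq0_sections2 (integrable3 d)) => c.
  apply: (integral_eq0_sections2 (integrable2 c d)) => b.
  apply: (line (fun a => (a, b, c, d))).
  + by apply: (@pairc); [apply: (@pairc); [apply: (@pairc)|]|];
      (exact: (@id_) || exact: (@cst_id)).
  + move=> t h; apply: pairE; rewrite /= ?scaler0 ?mulr0 ?add0r; reflexivity.
  + by move=> t; case: (sqr_coord_le_sqnorm (t, b, c, d)).
- apply: (integral_eq0_sections2 I4) => d.
  apply: (integral_eq0_sections2 (integrable3 d)) => c.
  apply: (integral_eq0_sections1 (integrable2 c d)) => a.
  apply: (line (fun b => (a, b, c, d))).
  + by apply: (@pairc); [apply: (@pairc); [apply: (@pairc)|]|];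
      (exact: (@id_) || exact: (@cst_id)).
  + move=> t h; apply: pairE; rewrite /= ?scaler0 ?mulr0 ?add0r; reflexivity.
  + by move=> t; case: (sqr_coord_le_sqnorm (a, t, c, d)).
- apply: (integral_eq0_sections2 I4) => d.
  apply: (integral_eq0_sections1 (integrable3 d)) => -[a b].
  apply: (line (fun c => (a, b, c, d))).
  + by apply: (@pairc); [apply: (@pairc); [apply: (@pairc)|]|];
      (exact: (@id_) || exact: (@cst_id)).
  + move=> t h; apply: pairE; rewrite /= ?scaler0 ?mulr0 ?add0r; reflexivity.
  + by move=> t; case: (sqr_coord_le_sqnorm (a, b, t, d)).
- apply: (integral_eq0_sections1 I4) => -[[a b] c].
  apply: (line (fun d => (a, b, c, d))).
  + by apply: (@pairc); [apply: (@pairc); [apply: (@pairc)|]|];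
      (exact: (@id_) || exact: (@cst_id)).
  + move=> t h; apply: pairE; rewrite /= ?scaler0 ?mulr0 ?add0r; reflexivity.
  + by move=> t; case: (sqr_coord_le_sqnorm (a, b, c, t)).
Qed.

End R4_divergence.

(** * Surface integrals in polar coordinates *)

Section sphere_integral.
Context {R : realType}.
Notation mR4 := (mR4 R).
Notation sigma := (@sphere_measure R).

Lemma ge0_integral_mrestr d (T : measurableType d) (mu : {measure set T -> \bar R})
    (D : set T) (mD : measurable D) (f : T -> \bar R) :
  measurable_fun [set: T] f -> (forall x, 0 <= f x)%E ->
  (\int[mrestr mu mD]_x f x = \int[mu]_(x in D) f x)%E.
Proof.
move=> mf f0.
rewrite (@ge0_negligible_integral _ _ _ _ setT (~` D))//; last 2 first.
- exact: measurableC.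
- by rewrite /= /mrestr setICl measure0.
rewrite setDE setTI setCK.
by apply: eq_measure_integral => A mA AD; rewrite /= /mrestr setIidl.
Qed.

(** The surface measure is the pushforward under [radial] of 4 times Lebesgue measure on the
    ball. *)
Lemma ge0_integral_sphere (h : S3 R -> \bar R) :
  measurable_fun [set: S3 R] h -> (forall x, 0 <= h x)%E ->
  (\int[sigma]_x h x = 4%:E * \int[lebesgue4 R]_(x in ball4) h (radial x))%E.
Proof.
move=> mh h0.
have mhr : measurable_fun [set: mR4] (h \o (radial : mR4 -> S3 R)).
  exact: measurableT_comp mh measurable_radial.
rewrite -(ge0_integral_mrestr _ measurable_ball4 mhr); last by move=> x; exact: h0.
rewrite -(ge0_integral_mscale _ measurableT 4%:nng mhr); last by move=> x _; exact: h0.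
have := @ge0_integral_pushforward _ _ _ _ R _ (@measurable_radial R)
  (mscale 4%:nng (mrestr (lebesgue4 R) measurable_ball4)) setT h measurableT mh
  (fun x _ => h0 x).
rewrite preimage_setT => <-.
apply: eq_measure_integral => [|A mA _ //].
exact: (@measurable_radial R).
Qed.

(** The positive and negative parts are transferred separately; integrability makes both finite, so
    the factor 4 can be taken out of their difference. *)
Lemma integral_sphere_eq0 (h : S3 R -> \bar R) :
  measurable_fun [set: S3 R] h ->
  (lebesgue4 R).-integrable ball4 (h \o (radial : mR4 -> S3 R)) ->
  (\int[lebesgue4 R]_(x in ball4) h (radial x) = 0)%E ->
  (\int[sigma]_x h x = 0)%E.
Proof.
move=> mh ih; rewrite (integralE _ _ (h \o _)) => h0.
have finp := integrable_pos_fin_num measurable_ball4 ih.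
have finn := integrable_neg_fin_num measurable_ball4 ih.
rewrite integralE !ge0_integral_sphere//.
- have pe : (\int[lebesgue4 R]_(x in ball4) h^\+ (radial x) =
    \int[lebesgue4 R]_(x in ball4) (h \o (radial : mR4 -> S3 R))^\+ x)%E.
    by apply: eq_integral => x _; rewrite !funeposE.
  have ne : (\int[lebesgue4 R]_(x in ball4) h^\- (radial x) =
    \int[lebesgue4 R]_(x in ball4) (h \o (radial : mR4 -> S3 R))^\- x)%E.
    by apply: eq_integral => x _; rewrite !funenegE.
  rewrite pe ne -muleBr ?fin_num_adde_defr ?h0 ?mule0//.
- exact: measurable_funeneg.
- exact: measurable_funepos.
Qed.

End sphere_integral.

(** * Green's identity on the sphere *)

Section dot_product.
Context {R : realType}.
Notation R4 := (R4 R).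

Definition dot (x y : R4) : R :=
  x.1.1.1 * y.1.1.1 + x.1.1.2 * y.1.1.2 + x.1.2 * y.1.2 + x.2 * y.2.

Lemma R4_eqP (x y : R4) : x.1.1.1 = y.1.1.1 -> x.1.1.2 = y.1.1.2 ->
  x.1.2 = y.1.2 -> x.2 = y.2 -> x = y.
Proof. by case: x => [[[? ?] ?] ?]; case: y => [[[? ?] ?] ?]/= -> -> -> ->. Qed.

Lemma dotC x y : dot x y = dot y x.
Proof. by rewrite /dot; ring. Qed.

Lemma dotDr x y z : dot x (y + z) = dot x y + dot x z.
Proof. by rewrite /dot /=; ring. Qed.

Lemma dotZr x a y : dot x (a *: y) = a * dot x y.
Proof. by rewrite /dot /= /GRing.scale/=; ring. Qed.

Lemma dotDl x y z : dot (y + z) x = dot y x + dot z x.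
Proof. by rewrite !(dotC _ x) dotDr. Qed.

Lemma dotZl x a y : dot (a *: y) x = a * dot y x.
Proof. by rewrite !(dotC _ x) dotZr. Qed.

Lemma dotxx x : dot x x = sqnorm x.
Proof. by rewrite /dot /sqnorm !expr2. Qed.

Lemma sum_basis4 (f : R4 -> R) : \sum_(e <- @basis4 R) f e =
  f (1, 0, 0, 0) + f (0, 1, 0, 0) + f (0, 0, 1, 0) + f (0, 0, 0, 1).
Proof. by rewrite /basis4 !big_cons big_nil addr0 !addrA. Qed.

Lemma basis4_decomposition x : x = dot x (1, 0, 0, 0) *: (1, 0, 0, 0)
  + dot x (0, 1, 0, 0) *: (0, 1, 0, 0) + dot x (0, 0, 1, 0) *: (0, 0, 1, 0)
  + dot x (0, 0, 0, 1) *: (0, 0, 0, 1).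
Proof.
by apply: R4_eqP; rewrite /dot/= /GRing.scale/= ?mulr0 ?mulr1 ?addr0 ?add0r.
Qed.

Lemma sum_basis4_sqr x y :
  \sum_(e <- @basis4 R) dot x e * dot y e = dot x y.
Proof. by rewrite sum_basis4 /dot/=; ring. Qed.

Lemma sum_basis4_1 : \sum_(e <- @basis4 R) sqnorm e = 4.
Proof. by rewrite sum_basis4 /sqnorm/=; ring. Qed.

Lemma is_derive_dot (x v y : R4) : is_derive x v (dot y) (dot y v).
Proof.
have dE (h : R) : h != 0 ->
    h^-1 *: ((dot y \o shift x) (h *: v) - dot y x) = dot y v.
  move=> h0; rewrite /= dotDr dotZr addrK /GRing.scale/= mulKf//.
have cv : h^-1 *: ((dot y \o shift x) (h *: v) - dot y x) @[h --> (0:R)^'] --> dot y v.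
  apply: cvg_trans; last exact: (@cvg_cst _ (dot y v) _ (0:R)^').
  apply: near_eq_cvg; near=> h; rewrite dE//.
  by near: h; exact: nbhs_dnbhs_neq.
split; last by apply/cvg_lim.
by apply/cvg_ex; exists (dot y v).
Unshelve. all: by end_near.
Qed.

Lemma sqnormD x (h : R) v :
  sqnorm (h *: v + x) = sqnorm x + h * (2 * dot x v) + h ^+ 2 * sqnorm v.
Proof. by rewrite -!dotxx !(dotDl,dotDr,dotZl,dotZr) (dotC v x); ring. Qed.

Lemma is_derive_sqnorm (x v : R4) : is_derive x v (@sqnorm R) (2 * dot x v).
Proof.
have -> : @sqnorm R = dot (1, 0, 0, 0) ^+ 2 + dot (0, 1, 0, 0) ^+ 2 +
    dot (0, 0, 1, 0) ^+ 2 + dot (0, 0, 0, 1) ^+ 2.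
  by apply/funext => y; rewrite /sqnorm -[RHS]/(_ ^+ 2 + _ ^+ 2 + _ ^+ 2 + _ ^+ 2)
    /dot/= !mul0r !mul1r ?addr0 ?add0r.
have dX e : is_derive x v (dot e ^+ 2) (2 * dot e x * dot e v).
  have de := is_derive_dot x v e; apply: is_derive_eq.
  by rewrite /GRing.scale/= expr1 mulr_natl.
apply: (is_derive_eq (is_deriveD (is_deriveD (is_deriveD (dX _) (dX _)) (dX _)) (dX _))).
by rewrite /dot/=; ring.
Qed.

End dot_product.

Section smooth_open.
Context {R : realType}.

Lemma smooth_on_differentiable (V : normedModType R) (D : set V) (F : V -> R) x :
  smooth_on D F -> D x -> differentiable F x.
Proof. by move=> sF; exact: (sF [::]). Qed.

Lemma smooth_on_derive (V : normedModType R) (D : set V) (F : V -> R) v :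
  smooth_on D F -> smooth_on D ('D_v F).
Proof.
move=> sF vs x Dx; have := sF (rcons vs v) x Dx.
by rewrite /iter_derive -cats1 foldr_cat.
Qed.

Lemma near_neq0 (x : R4 R) : x != 0 -> \forall y \near x, y != 0.
Proof.
rewrite -sqnorm_eq0 => x0.
have h := cvgr_neq0 (sqnorm x) (@continuous_sqnorm R x) x0.
near=> y; rewrite -sqnorm_eq0; near: y; exact: h.
Unshelve. all: by end_near.
Qed.

End smooth_open.

(** * Functions constant along rays *)

Section degree0.
Context {R : realType}.
Notation R4 := (R4 R).
Variable F : R4 -> R.
Hypotheses (Fs : smooth_on [set x : R4 | x != 0] F)
  (Fh : forall (a : R) x, 0 < a -> F (a *: x) = F x).

(** Euler's relation in degree 0: the sum is the derivative of the constant function [t |-> F (t x)]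
    at [t = 1]. *)
Lemma degree0_euler x : x != 0 -> \sum_(e <- @basis4 R) dot x e * 'D_e F x = 0.
Proof.
move=> x0; have dF := smooth_on_differentiable Fs x0.
have E : 'D_x F x = 0.
  have line : 'D_(1 : R) (F \o (fun t : R => t *: x)) (1 : R) = 'D_x F (1 *: x).
    by apply: derive_line => h; rewrite scalerDl scale1r -[h *: 1]/(h * 1) mulr1.
  rewrite scale1r in line; rewrite -line.
  rewrite -(derive_cst (F x) (1 : R) (1 : R)); apply: near_eq_derive.
  near=> t; rewrite /= Fh//.
  by near: t; apply: (cvgr_gt (1 : R)); [exact: cvg_id|exact: ltr01].
rewrite -[RHS]E.
have -> : 'D_x F x = 'd F x (dot x (1, 0, 0, 0) *: (1, 0, 0, 0)
    + dot x (0, 1, 0, 0) *: (0, 1, 0, 0) + dot x (0, 0, 1, 0) *: (0, 0, 1, 0)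
    + dot x (0, 0, 0, 1) *: (0, 0, 0, 1)).
  by rewrite -basis4_decomposition deriveE.
by rewrite linearD linearD linearD !linearZ sum_basis4 !(deriveE _ dF).
Unshelve. all: by end_near.
Qed.

(** Differentiating the identity [F (a x) = F x] brings out a factor [a]: first derivatives have
    degree -1, and by the same argument second ones have degree -2. *)
Lemma derive_degree0_scale (a : R) e x : 0 < a -> x != 0 ->
  'D_e F (a *: x) = a^-1 * 'D_e F x.
Proof.
move=> a0 x0; have ax0 : a *: x != 0 by rewrite scaler_eq0 negb_or gt_eqF.
have line : 'D_e (F \o *:%R a) x = 'D_(a *: e) F (a *: x).
  by apply: derive_line => h; rewrite scalerDr !scalerA mulrC.
rewrite (_ : F \o _ = F) in line; last by apply/funext => y /=; rewrite Fh.
have dF := smooth_on_differentiable Fs ax0.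
by rewrite line !(deriveE _ dF) linearZ /= -[RHS]/(_ * (a * _)) mulKf ?gt_eqF.
Qed.

Lemma derive2_degree0_scale (a : R) e x : 0 < a -> x != 0 ->
  'D_e ('D_e F) (a *: x) = a ^- 2 * 'D_e ('D_e F) x.
Proof.
move=> a0 x0; have ax0 : a *: x != 0 by rewrite scaler_eq0 negb_or gt_eqF.
have dG y : y != 0 -> differentiable ('D_e F) y.
  by move=> y0; exact: (smooth_on_differentiable (smooth_on_derive e Fs)).
have line : 'D_e ('D_e F \o *:%R a) x = 'D_(a *: e) ('D_e F) (a *: x).
  by apply: derive_line => h; rewrite scalerDr !scalerA mulrC.
have line2 : 'D_e ('D_e F \o *:%R a) x = a^-1 * 'D_e ('D_e F) x.
  rewrite (@near_eq_derive _ _ _ _ (a^-1 *: 'D_e F)); last first.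
    by apply: filterS (near_neq0 x0) => y y0; rewrite /= derive_degree0_scale.
  rewrite deriveZ; last exact/diff_derivable/dG.
  by [].
move: line; rewrite line2 [in RHS]deriveE; last exact: dG.
rewrite linearZ/= -deriveE; last exact: dG.
rewrite -[RHS]/(a * _).
move: ('D_e ('D_e F) (a *: x)) ('D_e ('D_e F) x) => A B AB.
by rewrite -exprVn expr2 -mulrA AB mulKf ?gt_eqF.
Qed.

End degree0.

Section real_composition.
Context {R : realType}.

Lemma line_is_derive (V V' : normedModType R) (f : V' -> R) (phi : V -> V')
    (x u : V) (v : V') df :
  (forall h : R, phi (h *: u + x) = h *: v + phi x) ->
  is_derive x u (f \o phi) df -> is_derive (phi x) v f df.
Proof.
move=> phiE [fd fE].
have E : (fun h : R => h^-1 *: ((f \o phi) (h *: u + x) - (f \o phi) x)) =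
    (fun h : R => h^-1 *: (f (h *: v + phi x) - f (phi x))).
  by apply/funext => h /=; rewrite phiE.
split.
  by move: fd; rewrite /derivable; move: E; rewrite /shift/=/comp/= => ->.
by rewrite -fE /derive; move: E; rewrite /shift/=/comp/= => ->.
Qed.

(** Restricting [g] to the line [t |-> t v + x] reduces this to the chain rule in one variable, so
    [g] need only have a derivative along [v]. *)
Lemma is_derive_real_comp (V : normedModType R) (g : V -> R) (k : R -> R)
    (x v : V) (dg dk : R) :
  is_derive x v g dg -> is_derive (g x) (1 : R) k dk ->
  is_derive x v (k \o g) (dk * dg).
Proof.
move=> gd kd; pose phi (t : R) : V := t *: v + x.
have phi0 : phi 0 = x by rewrite /phi scale0r add0r.
have phiE (h : R) : phi (h *: (1 : R) + 0) = h *: v + phi 0.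
  by rewrite phi0 /phi addr0 -[h *: 1]/(h * 1) mulr1.
rewrite -phi0; apply: (line_is_derive phiE).
rewrite -[_ \o phi]/(k \o (g \o phi)).
apply: is_derive1_comp; first by rewrite /= phi0.
by apply: is_derive_line => //; rewrite phi0.
Qed.

Lemma is_derive_continuous (f : R -> R) (x df : R) :
  is_derive x (1 : R) f df -> {for x, continuous f}.
Proof.
by case=> fd _; apply: differentiable_continuous; exact/derivable1_diffP.
Qed.

End real_composition.

(** * Radial cutoff functions *)

Section cutoff.
Context {R : realType}.

Definition sqpos (s : R) : R := Num.max 0 s ^+ 2.

Lemma sqpos_ge0 s : 0 <= sqpos s. Proof. exact: sqr_ge0. Qed.

Lemma sqpos_eq0 s : s <= 0 -> sqpos s = 0.
Proof. by move=> s0; rewrite /sqpos max_l// expr0n. Qed.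

Lemma is_derive_sqpos (s : R) : is_derive s (1 : R) sqpos (2 * Num.max 0 s).
Proof.
have [s0|s0|->] := ltgtP s 0.
- rewrite mulr0.
  apply: (@near_eq_is_derive _ _ _ (cst 0)).
  near=> t; rewrite /= sqpos_eq0// ltW//; near: t.
  by apply: (cvgr_lt s) => //; exact: cvg_id.
- apply: (@near_eq_is_derive _ _ _ (fun t : R => t ^+ 2)).
    near=> t; rewrite /sqpos max_r// ltW//; near: t.
    by apply: (cvgr_gt s) => //; exact: cvg_id.
  have -> : (fun t : R => t ^+ 2) = (@id R) ^+ 2 by [].
  apply: is_derive_eq.
  by rewrite /GRing.scale/= expr1 mulr1 mulr_natl.
- rewrite mulr0.
  (* At the junction point the difference quotient is at most [|h|]. *)
  have cv : h^-1 *: ((sqpos \o shift 0) (h *: (1 : R)) - sqpos 0) @[h --> (0 : R)^'] --> (0 : R).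
    apply/cvgrPdist_le => e e0; near=> h.
    have h0 : h != 0 by near: h; exact: nbhs_dnbhs_neq.
    rewrite sub0r normrN /= addr0 -[h *: 1]/(h * 1) mulr1 [sqpos 0]sqpos_eq0// subr0.
    rewrite -[_ *: _]/(h^-1 * _) normrM normfV ler_pdivrMl ?normr_gt0//.
    rewrite (@le_trans _ _ (`|h| ^+ 2))//.
      rewrite ger0_norm ?sqpos_ge0// /sqpos.
      have [h1|h1] := leP 0 h; first by rewrite ger0_norm.
      by rewrite expr0n/= sqr_ge0.
    rewrite expr2 ler_pM//.
    near: h; apply: dnbhs0_le => //.
  split; last exact/cvg_lim.
  by apply/cvg_ex; exists 0.
Unshelve. all: by end_near.
Qed.

(** A function of class C^1 that vanishes for [s <= 0], stays below 1 and tends to 1 at infinity.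
    One continuous derivative is what the divergence theorem asks of the cutoff. *)
Definition ramp (s : R) : R := 1 - (1 + sqpos s)^-1.

Let sqpos1_neq0 s : 1 + sqpos s != 0.
Proof. by rewrite gt_eqF// ltr_wpDr// sqpos_ge0. Qed.

Lemma ramp_eq0 s : s <= 0 -> ramp s = 0.
Proof. by move=> s0; rewrite /ramp sqpos_eq0// addr0 invr1 subrr. Qed.

Lemma ramp_ge0 s : 0 <= ramp s.
Proof. by rewrite subr_ge0 invf_le1 ?lerDl ?sqpos_ge0// ltr_wpDr// sqpos_ge0. Qed.

Lemma ramp_le1 s : ramp s <= 1.
Proof. by rewrite /ramp gerDl oppr_le0 invr_ge0 addr_ge0// sqpos_ge0. Qed.

Lemma ramp_near1 s : 0 < s -> 1 - ramp s <= s^-1.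
Proof.
move=> s0; rewrite opprB addrC subrK lef_pV2 ?posrE//; last first.
  by rewrite ltr_wpDr// sqpos_ge0.
rewrite /sqpos max_r ?(ltW s0)//.
by have := sqr_ge0 (s - 1); nra.
Qed.

Definition dramp (s : R) : R := (1 + sqpos s) ^- 2 * (2 * Num.max 0 s).

Lemma is_derive_ramp (s : R) : is_derive s (1 : R) ramp (dramp s).
Proof.
have := is_derive_sqpos s => ds.
have d1 : is_derive s (1 : R) (cst 1 + sqpos) (2 * Num.max 0 s).
  by apply: is_derive_eq; rewrite add0r.
have d2 : is_derive s (1 : R) (fun t => ((cst 1 + sqpos) t)^-1)
    (- (1 + sqpos s) ^- 2 * (2 * Num.max 0 s)).
  have [dd dE] := d1; split; first by apply: derivableV; rewrite ?sqpos1_neq0.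
  by rewrite deriveV ?sqpos1_neq0// dE.
have -> : ramp = cst 1 - (fun t => ((cst 1 + sqpos) t)^-1) by [].
apply: is_derive_eq.
by rewrite sub0r /dramp mulNr opprK.
Qed.

Lemma continuous_dramp : continuous dramp.
Proof.
move=> s; apply: (@continuousM _ _ (fun s => (1 + sqpos s) ^- 2)).
  apply: continuousV; first by rewrite expf_neq0// sqpos1_neq0.
  apply: (@continuous_comp _ _ _ (fun s => 1 + sqpos s) (fun t => t ^+ 2)).
    apply: continuousD; first exact: cvg_cst.
    exact: is_derive_continuous (is_derive_sqpos s).
  exact: exprn_continuous.
apply: continuousM; first exact: cvg_cst.
by apply: continuous_max; [exact: cvg_cst|exact: cvg_id].
Qed.

(* The argument of [ramp] is positive exactly for [1 / k < rho < 1 + 1 / k]. *)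
Definition annulus (k rho : R) : R := (k * rho - 1) * (k + 1 - k * rho).

(** The argument [rho] is [|x|^2]. As a factor it compensates the degree -2 of the Laplacians, which
    leaves [ramp] times a function constant along rays. *)
Definition cutoff (k rho : R) : R := rho * ramp (annulus k rho).

Definition dcutoff (k rho : R) : R := ramp (annulus k rho) +
  rho * (dramp (annulus k rho) * (k * (k + 1 - k * rho) - k * (k * rho - 1))).

Lemma is_derive_annulus (k rho : R) :
  is_derive rho (1 : R) (annulus k) (k * (k + 1 - k * rho) - k * (k * rho - 1)).
Proof.
have -> : annulus k = (k *: (@id R) - cst 1) * (cst (k + 1) - k *: (@id R)) by [].
apply: is_derive_eq.
rewrite -[LHS]/((k * rho - 1) * (0 - k * 1) + (k + 1 - k * rho) * (k * 1 - 0)).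
by ring.
Qed.

Lemma is_derive_cutoff (k rho : R) : is_derive rho (1 : R) (cutoff k) (dcutoff k rho).
Proof.
have db := is_derive1_comp (is_derive_ramp _) (is_derive_annulus k rho).
have -> : cutoff k = (@id R) * (ramp \o annulus k) by [].
apply: is_derive_eq.
by rewrite /dcutoff /GRing.scale/= mulr1 addrC.
Qed.

Lemma continuous_dcutoff k : continuous (dcutoff k).
Proof.
move=> rho; have ca : {for rho, continuous (annulus k)}.
  exact: is_derive_continuous (is_derive_annulus k rho).
have cl : {for rho, continuous (fun t => k * t)}.
  by apply: continuousM; [exact: cvg_cst|exact: cvg_id].
rewrite /dcutoff; apply: cvgD.
  apply: (@continuous_comp _ _ _ (annulus k) ramp) => //.
  exact: is_derive_continuous (is_derive_ramp _).
apply: cvgM; first exact: cvg_id.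
apply: cvgM.
  by apply: (@continuous_comp _ _ _ (annulus k) dramp) => //; exact: continuous_dramp.
apply: cvgB; (apply: cvgM; first exact: cvg_cst).
  by apply: cvgB => //; exact: cvg_cst.
by apply: cvgB => //; exact: cvg_cst.
Qed.

Lemma annulus_le0 (k rho : R) : 1 <= k -> rho <= k^-1 \/ 2 <= rho ->
  annulus k rho <= 0.
Proof.
move=> k1 h; have k0 : 0 < k by lra.
rewrite /annulus; case: h => [|r2].
  rewrite -[k^-1]mul1r ler_pdivlMr// mulrC => h.
  by apply: mulr_le0_ge0; lra.
have kr : k * 2 <= k * rho by rewrite ler_pM2l.
by apply: mulr_ge0_le0; lra.
Qed.

Lemma cutoff_eq0 k rho : 1 <= k -> rho <= k^-1 \/ 2 <= rho -> cutoff k rho = 0.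
Proof. by move=> k1 h; rewrite /cutoff ramp_eq0 ?mulr0// annulus_le0. Qed.

Lemma dcutoff_eq0 k rho : 1 <= k -> rho <= k^-1 \/ 2 <= rho -> dcutoff k rho = 0.
Proof.
move=> k1 h; have a0 := annulus_le0 k1 h.
by rewrite /dcutoff /dramp ramp_eq0// max_l// !(mulr0,mul0r) addr0.
Qed.

(** For [rho <= 1] the second factor of [annulus] is at least 1 and the first tends to infinity; for
    [rho > 1] the second is eventually negative. The margin [1 / k] puts the unit sphere itself on
    the side of the limit 1. *)
Lemma cvg_ramp_annulus (rho : R) : 0 < rho ->
  ramp (annulus n.+1%:R rho) @[n --> \oo] --> ((rho <= 1)%R%:R : R).
Proof.
move=> r0; have [r1|r1] := leP rho 1; apply/cvgrPdist_le => e e0; near=> n.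
  (* This makes [annulus] at least [e^-1], and [ramp_near1] then gives the error [e]. *)
  have ln : (1 + e^-1) / rho <= n%:R by near: n; exact: nbhs_infty_ger.
  have kr : e^-1 <= n.+1%:R * rho - 1.
    rewrite lerBrDl -ler_pdivrMr// (le_trans ln)// ler_nat//.
  have ei : 0 < e^-1 by rewrite invr_gt0.
  have k0 : (0 : R) < n.+1%:R by [].
  have ae : e^-1 <= annulus n.+1%:R rho.
    have kr1 : n.+1%:R * rho <= n.+1%:R by rewrite ler_piMr// ltW.
    by apply: (le_trans kr); rewrite /annulus ler_peMr//; lra.
  rewrite ger0_norm ?subr_ge0 ?ramp_le1//.
  rewrite (le_trans (ramp_near1 (lt_le_trans ei ae)))//.
  by rewrite -[leRHS]invrK lef_pV2 ?posrE// (lt_le_trans ei).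
have ln : (rho - 1)^-1 <= n%:R by near: n; exact: nbhs_infty_ger.
rewrite ramp_eq0 ?subrr ?normr0 ?(ltW e0)//.
have k1 : n.+1%:R = n%:R + 1 :> R by rewrite -natr1.
have : 1 <= n%:R * (rho - 1).
  by rewrite -ler_pdivrMr ?subr_gt0// div1r.
have n0 : (0 : R) <= n%:R by [].
rewrite mulrBr mulr1 => h.
have kr : (n%:R + 1) * rho = n%:R * rho + rho by ring.
rewrite /annulus k1 kr.
by apply: mulr_ge0_le0; lra.
Unshelve. all: by end_near.
Qed.

End cutoff.

Lemma integral_sum4_eq0 (R : realType) d (T : measurableType d)
    (mu : {measure set T -> \bar R}) (h1 h2 h3 h4 : T -> R) :
  mu.-integrable [set: T] (EFin \o h1) -> mu.-integrable [set: T] (EFin \o h2) ->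
  mu.-integrable [set: T] (EFin \o h3) -> mu.-integrable [set: T] (EFin \o h4) ->
  (\int[mu]_x (h1 x)%:E = 0)%E -> (\int[mu]_x (h2 x)%:E = 0)%E ->
  (\int[mu]_x (h3 x)%:E = 0)%E -> (\int[mu]_x (h4 x)%:E = 0)%E ->
  (\int[mu]_x (h1 x + h2 x + h3 x + h4 x)%:E = 0)%E.
Proof.
move=> I1 I2 I3 I4 z1 z2 z3 z4; under eq_integral do rewrite !EFinD.
have I12 := integrableD measurableT I1 I2.
have I123 := integrableD measurableT I12 I3.
rewrite (integralD measurableT I123 I4) (integralD measurableT I12 I3).
by rewrite (integralD measurableT I1 I2) /= z1 z2 z3 z4 !adde0.
Qed.

Section sphere_green.
Context {R : realType}.
Notation R4 := (R4 R).
Notation mR4 := (mR4 R).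

Let set1_R4E (a b c d : R) :
  [set (a, b, c, d)] = [set a] `*` [set b] `*` [set c] `*` [set d].
Proof. by apply/seteqP; split => -[[[a' b'] c'] d']/=; [case=> -> -> -> ->|case=> -[[-> ->] ->] ->]. Qed.

Lemma measurable_set1_R4 (x : mR4) : measurable [set x].
Proof. by case: x => [[[a b] c] d]; rewrite set1_R4E; do 3 apply: measurableX => //. Qed.

Lemma lebesgue4_set1 (x : mR4) : lebesgue4 R [set x] = 0%E.
Proof.
case: x => [[[a b] c] d]; rewrite set1_R4E /lebesgue4/= product_measure1E//.
  by rewrite [X in (_ * X)%E]lebesgue_measure_set1 mule0.
by do 2 apply: measurableX => //.
Qed.

Lemma continuous_dot (y : R4) : continuous (dot y).
Proof.
move=> x; rewrite /dot.
have F1 (z : R4) : {for z, continuous (fun z : R4 => z.1)} by exact: cvg_fst.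
have F2 (z : R4) : {for z, continuous (fun z : R4 => z.1.1)}.
  by apply: (@continuous_comp _ _ _ (fun y : R4 => y.1) fst); [exact: F1|exact: cvg_fst].
apply: cvgD; last by apply: cvgM; [exact: cvg_cst|exact: cvg_snd].
apply: cvgD; last first.
  apply: cvgM; first exact: cvg_cst.
  by apply: (@continuous_comp _ _ _ (fun y : R4 => y.1) snd); [exact: F1|exact: cvg_snd].
apply: cvgD; (apply: cvgM; first exact: cvg_cst).
- by apply: (@continuous_comp _ _ _ (fun y : R4 => y.1.1) fst); [exact: F2|exact: cvg_fst].
- by apply: (@continuous_comp _ _ _ (fun y : R4 => y.1.1) snd); [exact: F2|exact: cvg_snd].
Qed.

Definition smooth1 (f : S3 R -> R) : Prop :=
  smooth_on [set x : R4 | x != 0] (f \o radial).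

Lemma radialZ (a : R) (x : R4) : 0 < a -> radial (a *: x) = radial x.
Proof.
move=> a0; have [->|x0] := eqVneq x 0; first by rewrite scaler0.
apply: val_inj; rewrite /= !vecS3_radial ?scaler_eq0 ?negb_or ?x0 ?gt_eqF//.
rewrite /enorm sqnormZ sqrtrM ?sqr_ge0// sqrtr_sqr gtr0_norm// invfM scalerA.
by rewrite mulrAC mulVf ?gt_eqF// mul1r.
Qed.

Lemma enorm_gt0 (x : R4) : x != 0 -> 0 < enorm x.
Proof.
by move=> x0; rewrite sqrtr_gt0 lt_neqAle sqnorm_ge0 eq_sym sqnorm_eq0 x0.
Qed.

Lemma enorm_radial (x : R4) : x != 0 -> x = enorm x *: vecS3 (radial x).
Proof.
move=> x0; rewrite vecS3_radial// scalerA divff ?scale1r// gt_eqF//.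
exact: enorm_gt0.
Qed.

Lemma sphere4_neq0 (x : R4) : sphere4 x -> x != 0.
Proof. by rewrite /sphere4/= => x1; rewrite -sqnorm_eq0 x1 oner_eq0. Qed.

Definition laplacian (F : R4 -> R) (x : R4) : R :=
  \sum_(e <- @basis4 R) 'D_e ('D_e F) x.

Lemma smooth_continuous (F : R4 -> R) x :
  smooth_on [set x | x != 0] F -> x != 0 -> {for x, continuous F}.
Proof.
by move=> sF x0; apply: differentiable_continuous; exact: smooth_on_differentiable sF x0.
Qed.

Lemma continuous_laplacian (F : R4 -> R) x :
  smooth_on [set x | x != 0] F -> x != 0 -> {for x, continuous (laplacian F)}.
Proof.
move=> sF x0.
have c e : {for x, continuous ('D_e ('D_e F))}.
  by apply: smooth_continuous => //; do 2 apply: smooth_on_derive.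
have -> : laplacian F = (fun x => 'D_(1, 0, 0, 0) ('D_(1, 0, 0, 0) F) x +
    'D_(0, 1, 0, 0) ('D_(0, 1, 0, 0) F) x + 'D_(0, 0, 1, 0) ('D_(0, 0, 1, 0) F) x +
    'D_(0, 0, 0, 1) ('D_(0, 0, 0, 1) F) x).
  by apply/funext => y; rewrite /laplacian sum_basis4.
by apply: cvgD; last exact: c; apply: cvgD; last exact: c; apply: cvgD; exact: c.
Qed.

Lemma laplacian_degree0_scale (F : R4 -> R) (a : R) x :
  smooth_on [set x | x != 0] F ->
  (forall (b : R) y, 0 < b -> F (b *: y) = F y) -> 0 < a -> x != 0 ->
  laplacian F (a *: x) = a ^- 2 * laplacian F x.
Proof.
move=> sF hF a0 x0; rewrite /laplacian mulr_sumr; apply: eq_bigr => e _.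
exact: derive2_degree0_scale.
Qed.

Section green.
Variables f g : S3 R -> R.
Hypotheses (sf : smooth1 f) (sg : smooth1 g).

Local Notation F := (f \o radial : R4 -> R).
Local Notation G := (g \o radial : R4 -> R).

Let Fh (a : R) x : 0 < a -> F (a *: x) = F x.
Proof. by move=> a0; rewrite /= radialZ. Qed.

Let Gh (a : R) x : 0 < a -> G (a *: x) = G x.
Proof. by move=> a0; rewrite /= radialZ. Qed.

Let wronskian x : R := G x * laplacian F x - F x * laplacian G x.

Let wronskian_continuous x : x != 0 -> {for x, continuous wronskian}.
Proof.
move=> x0; apply: cvgB; apply: cvgM.
- exact: smooth_continuous sg x0.
- exact: continuous_laplacian sf x0.
- exact: smooth_continuous sf x0.
- exact: continuous_laplacian sg x0.
Qed.

Let h (x : S3 R) : R := wronskian (vecS3 x).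

(** Both products in [wronskian] have degree -2 along rays, because [F] and [G] have degree 0. *)
Let wronskianE x : x != 0 -> sqnorm x * wronskian x = h (radial x).
Proof.
move=> x0; have a0 := enorm_gt0 x0; have y0 := vecS3_neq0 (radial x).
rewrite /h /wronskian {2 3 4 5}(enorm_radial x0) !Fh// !Gh//.
rewrite !laplacian_degree0_scale//.
have -> : sqnorm x = enorm x ^+ 2 by rewrite sqr_sqrtr ?sqnorm_ge0.
have n0 : enorm x != 0 by rewrite gt_eqF.
move: (laplacian F _) (laplacian G _) (F _) (G _) => a b c d.
by field.
Qed.

Let cf (k : nat) (x : R4) : R := cutoff k.+1%:R (sqnorm x).
Let dcf (k : nat) (x : R4) : R := dcutoff k.+1%:R (sqnorm x).

Let A e x : R := G x * 'D_e F x - F x * 'D_e G x.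
Let B e x : R := G x * 'D_e ('D_e F) x - F x * 'D_e ('D_e G) x.

(* [H k e] is the directional derivative of the component [W k e] of the field
   [cutoff(|x|^2) (G grad F - F grad G)]. Since F and G are constant along rays,
   [x . grad F = x . grad G = 0], so differentiating the cutoff contributes
   nothing to the divergence [T k]; as k tends to infinity, [T k] tends to
   [h (radial x)] on the ball and to 0 outside. *)
Let W k e x : R := cf k x * A e x.
Let H k e x : R := dcf k x * (2 * dot x e) * A e x + cf k x * B e x.

Let k1 (k : nat) : (1 : R) <= k.+1%:R. Proof. by rewrite ler1n. Qed.

Let cf0 k x : 2 ^+ 2 <= sqnorm x -> cf k x = 0.
Proof. by move=> x2; rewrite /cf cutoff_eq0//; right; lra. Qed.

Let dcf0 k x : 2 ^+ 2 <= sqnorm x -> dcf k x = 0.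
Proof. by move=> x2; rewrite /dcf dcutoff_eq0//; right; lra. Qed.

(** Extensions that are constant along rays are singular at the origin; the cutoff replaces the
    field by 0 on a neighbourhood of it. *)
Let near0 k : \forall x \near (0 : R4), cf k x = 0 /\ dcf k x = 0.
Proof.
have s0 : sqnorm (0 : R4) = 0 by apply/eqP; rewrite sqnorm_eq0.
have k0 : (0 : R) < k.+1%:R^-1 by rewrite invr_gt0.
near=> x; have xk : sqnorm x <= k.+1%:R^-1.
  apply: ltW; near: x; apply: (cvgr_lt (sqnorm (0 : R4))).
    exact: continuous_sqnorm.
  by rewrite s0.
by split; rewrite /cf /dcf ?cutoff_eq0 ?dcutoff_eq0//; left.
Unshelve. all: by end_near.
Qed.

Let H0 k e : H k e 0 = 0.
Proof.
by have [c0 d0] := nbhs_singleton (near0 k); rewrite /H c0 d0 !mul0r addr0.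
Qed.

Let is_derive_A e x : x != 0 -> is_derive x e (A e) (B e x).
Proof.
move=> x0.
have d1 (f' : S3 R -> R) : smooth1 f' ->
    is_derive x e (f' \o radial) ('D_e (f' \o radial) x).
  move=> s'; apply/derivableP/diff_derivable.
  exact: smooth_on_differentiable s' x0.
have d2 (f' : S3 R -> R) : smooth1 f' ->
    is_derive x e ('D_e (f' \o radial)) ('D_e ('D_e (f' \o radial)) x).
  move=> s'; apply/derivableP/diff_derivable.
  exact: smooth_on_differentiable (smooth_on_derive e s') x0.
have D := is_deriveB (is_deriveM (d1 _ sg) (d2 _ sf)) (is_deriveM (d1 _ sf) (d2 _ sg)).
apply: (is_derive_eq D); rewrite /B /GRing.scale/=.
move: (f _) (g _) ('D_e F x) ('D_e G x) ('D_e ('D_e F) x) ('D_e ('D_e G) x).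
by move=> a b c d c' d'; ring.
Qed.

Let is_derive_W k e x : is_derive x e (W k e) (H k e x).
Proof.
have [->|x0] := eqVneq x 0.
  rewrite H0; apply: (@near_eq_is_derive _ _ _ (cst 0)).
  near=> y; rewrite /W.
  have [-> _] : cf k y = 0 /\ dcf k y = 0 by near: y; exact: near0.
  by rewrite mul0r.
have dA := is_derive_A e x0.
have dc := is_derive_real_comp (is_derive_sqnorm x e)
  (is_derive_cutoff k.+1%:R (sqnorm x)).
have D := is_deriveM dc dA.
apply: (is_derive_eq D); rewrite /H /GRing.scale/= /dcf /cf addrC.
by congr (_ + _); rewrite mulrC.
Unshelve. all: by end_near.
Qed.

Let cH k e : continuous (H k e).
Proof.
move=> x; have [->|x0] := eqVneq x 0.
  rewrite /continuous_at H0; apply: cvg_trans; last exact: (@cvg_cst _ (0 : R) _ (nbhs (0 : R4))).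
  apply: near_eq_cvg; near=> y.
  have [c0 d0] : cf k y = 0 /\ dcf k y = 0 by near: y; exact: near0.
  by rewrite /H c0 d0 !mul0r addr0.
have cs := @continuous_sqnorm R x.
have c0 f' : smooth1 f' -> {for x, continuous (f' \o radial)}.
  by move=> s'; exact: smooth_continuous s' x0.
have c1 f' : smooth1 f' -> {for x, continuous ('D_e (f' \o radial))}.
  by move=> s'; exact: smooth_continuous (smooth_on_derive e s') x0.
have c2 f' : smooth1 f' -> {for x, continuous ('D_e ('D_e (f' \o radial)))}.
  by move=> s'; exact: smooth_continuous (smooth_on_derive e (smooth_on_derive e s')) x0.
have ce : {for x, continuous (fun y => dot y e)}.
  have -> : (fun y => dot y e) = dot e by apply/funext => y; rewrite dotC.
  exact: continuous_dot.
rewrite /H; apply: cvgD; apply: cvgM.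
- apply: cvgM.
    apply: (@continuous_comp _ _ _ (@sqnorm R) (dcutoff k.+1%:R)) => //.
    exact: continuous_dcutoff.
  by apply: cvgM; [exact: cvg_cst|exact: ce].
- by apply: cvgB; apply: cvgM; [exact: c0|exact: c1|exact: c0|exact: c1].
- apply: (@continuous_comp _ _ _ (@sqnorm R) (cutoff k.+1%:R)) => //.
  exact: is_derive_continuous (is_derive_cutoff _ _).
- by apply: cvgB; apply: cvgM; [exact: c0|exact: c2|exact: c0|exact: c2].
Unshelve. all: by end_near.
Qed.

Let T k x : R := ramp (annulus k.+1%:R (sqnorm x)) * h (radial x).

Let TE k x : T k x = H k (1, 0, 0, 0) x + H k (0, 1, 0, 0) x +
  H k (0, 0, 1, 0) x + H k (0, 0, 0, 1) x.
Proof.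
have s0 : sqnorm (0 : R4) = 0 by apply/eqP; rewrite sqnorm_eq0.
have [->|x0] := eqVneq x 0.
  rewrite !H0 !addr0 /T s0 ramp_eq0; first by rewrite mul0r.
  by apply: annulus_le0; [exact: k1|left; rewrite invr_ge0 ler0n].
have -> : T k x = cf k x * wronskian x.
  by rewrite /T -(wronskianE x0) mulrA (mulrC (ramp _)).
rewrite -(sum_basis4 (fun e => H k e x)) big_split/=.
have -> : \sum_(e <- @basis4 R) cf k x * B e x = cf k x * wronskian x.
  rewrite -mulr_sumr; congr (_ * _).
  by rewrite /B /wronskian /laplacian !mulr_sumr -sumrB.
apply/esym; rewrite -[RHS]add0r; congr (_ + _).
transitivity (dcf k x * 2 * (G x * (\sum_(e <- @basis4 R) dot x e * 'D_e F x) -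
    F x * (\sum_(e <- @basis4 R) dot x e * 'D_e G x))).
  rewrite !mulr_sumr -sumrB mulr_sumr; apply: eq_bigr => e _.
  by rewrite /A; ring.
by rewrite !degree0_euler// !mulr0 subrr mulr0.
Qed.

Let intH k e : (lebesgue4 R).-integrable [set: mR4] (EFin \o (H k e : mR4 -> R)).
Proof.
apply: (@integrable_R4_compact_support _ _ 2) => // x x2.
by rewrite /H cf0// dcf0// !mul0r addr0.
Qed.

Let integralT k : (\int[lebesgue4 R]_x (T k x)%:E = 0)%E.
Proof.
have i0 e : e \in @basis4 R -> (\int[lebesgue4 R]_x (H k e x)%:E = 0)%E.
  move=> eb; apply: (@integral_R4_derive_eq0 _ _ 2 _ _ _ e (W k e)) => //.
  - by move=> x x2; rewrite /H cf0// dcf0// !mul0r addr0.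
  - by move=> x x2; rewrite /W cf0// mul0r.
under eq_integral do rewrite TE.
apply: integral_sum4_eq0; try exact: intH;
  by apply: i0; rewrite /basis4 !inE eqxx ?orbT.
Qed.

Let mh : measurable_fun [set: S3 R] h.
Proof.
exact: (measurable_fun_continuous_at (@countably_approximable_S3 R) measurableT
  (f := wronskian) (fun y _ => wronskian_continuous (vecS3_neq0 y))).
Qed.

Let sup : exists b : R, forall x, `|h x| <= b.
Proof.
have [b hb] := bounded_on_compact (@compact_sphere4 R)
  (fun x (x1 : sphere4 x) => wronskian_continuous (sphere4_neq0 x1)).
by exists b => x; apply: hb; exact: sqnorm_vecS3.
Qed.

Let mhr : measurable_fun [set: mR4] (h \o (radial : mR4 -> S3 R)).
Proof. exact: measurableT_comp mh (@measurable_radial R). Qed.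

Let mT n : measurable_fun [set: mR4] (T n : mR4 -> R).
Proof.
apply: measurable_funM; last exact: mhr.
apply: (measurable_continuous_R4 (H := fun x => ramp (annulus n.+1%:R (sqnorm x)))).
move=> x; apply: (@continuous_comp _ _ _ (@sqnorm R) (ramp \o annulus n.+1%:R)).
  exact: continuous_sqnorm.
exact: is_derive_continuous (is_derive1_comp (is_derive_ramp _) (is_derive_annulus _ _)).
Qed.

Let integral_ball : (\int[lebesgue4 R]_(x in ball4) (h (radial x))%:E = 0)%E.
Proof.
have [b hb] := sup.
pose fl (x : mR4) : R := h (radial x) * \1_(@ball4 R) x.
have mfl : measurable_fun [set: mR4] fl.
  apply: measurable_funM; first exact: mhr.
  exact: measurable_indic (@measurable_ball4 R).
(* Every [T n] vanishes where [|x|^2 >= 2], so one fixed box carries a bound for the whole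
   sequence. *)
pose bd (x : mR4) : R := b * \1_(box4 2 : set mR4) x.
have mbd : measurable_fun [set: mR4] bd.
  by apply: measurable_funM => //; exact: measurable_indic (@measurable_box4 R 2).
have Ib : (lebesgue4 R).-integrable [set: mR4] (EFin \o bd).
  apply: (integrable_bounded_support (@measurable_box4 R 2)
    (@lebesgue4_box4_lty R 2) mbd (B := `|b|)) => x nx; rewrite /bd indicE.
  - by rewrite memNset// mulr0.
  - by rewrite mem_set// mulr1.
have [] := @dominated_convergence _ _ _ (lebesgue4 R) setT measurableT
  (fun n => EFin \o (T n : mR4 -> R)) (EFin \o fl) _ _ _ _ Ib _.
- by move=> n; apply/measurable_EFinP; exact: mT.
- exact/measurable_EFinP.
(* The origin is exceptional: every [T n] is 0 there, whereas [fl] takes the default value of [h] at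
   [north]. *)
- exists [set 0]; split.
  + exact: measurable_set1_R4.
  + exact: lebesgue4_set1.
  + move=> x /=; apply: contra_notP => x0 _.
    have {}x0 : x != 0 by apply/eqP.
    have s0 : 0 < sqnorm x by rewrite lt_neqAle sqnorm_ge0 eq_sym sqnorm_eq0 x0.
    have TL : T n x @[n --> \oo] --> fl x.
      rewrite /fl mulrC indicE (_ : (x \in ball4) = (sqnorm x <= 1)).
        exact: cvgM (cvg_ramp_annulus s0) (cvg_cst (h (radial x))).
      apply/idP/idP => [|x1]; first rewrite inE.
        by rewrite -(sqr_sqrtr (sqnorm_ge0 x)) expr_le1 ?sqrtr_ge0.
      by rewrite inE /ball4/= -(expr_le1 (n := 2))// ?sqrtr_ge0// sqr_sqrtr ?sqnorm_ge0.
    by apply: cvg_EFin; [near=> n|exact: TL].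
- apply: aeW => x n _.
  rewrite /= lee_fin /T normrM /bd indicE.
  have [x2|x2] := leP (sqnorm x) (2 ^+ 2).
    rewrite mem_set; last exact: sqnorm_box4 (ler0n _ _) x2.
    rewrite mulr1 (le_trans _ (hb (radial x)))// ler_piMl//.
    by rewrite ger0_norm ?ramp_ge0 ?ramp_le1.
  rewrite ramp_eq0 ?normr0 ?mul0r; last by apply: annulus_le0 => //; right; lra.
  by rewrite mulr_ge0// (le_trans _ (hb (north R))).
move=> _ _.
under eq_fun do rewrite integralT.
move=> /cvg_lim; rewrite lim_cst// => /(_ (@ereal_hausdorff R)) L.
rewrite [LHS]integral_mkcond [RHS]L; apply: eq_integral => x _.
by rewrite patchE /= /fl indicE; case: ifPn => _; rewrite ?mulr1 ?mulr0.
Unshelve. all: by end_near.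
Qed.

(** On the sphere the integrand is [h]. The integral of [h \o radial] over the ball is a limit of
    integrals of divergences of compactly supported fields, all of them 0. *)
Lemma green_sphere : (\int[@sphere_measure R]_x
  (g x * laplace_beltrami_re f x - f x * laplace_beltrami_re g x)%:E = 0)%E.
Proof.
have -> : (fun x => (g x * laplace_beltrami_re f x - f x * laplace_beltrami_re g x)%:E)
    = EFin \o h.
  by apply/funext => x; rewrite /h /wronskian /= radial_vecS3.
have [b hb] := sup.
apply: integral_sphere_eq0.
- by apply/measurable_EFinP; exact: mh.
- apply: (measurable_bounded_integrable (@measurable_ball4 R) (@lebesgue4_ball_lty R)
    (measurable_funTS mhr)).
  exists b; split; first exact: num_real.
  by move=> y by_ x _; rewrite /= (le_trans (hb _))// ltW.
- exact: integral_ball.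
Qed.

End green.
End sphere_green.

(** * The product of two spheres *)

Section smooth_closure.
Context {R : realType}.

Lemma iter_derive_line (V V' : normedModType R) (f : V' -> R) (phi : V -> V')
    (dphi : V -> V') (vs : seq V) :
  (forall x u (h : R), phi (h *: u + x) = h *: dphi u + phi x) ->
  iter_derive vs (f \o phi) = iter_derive (map dphi vs) f \o phi.
Proof.
move=> phiE; elim: vs => [//|v vs IH] /=.
by rewrite IH; apply/funext => x; apply: derive_line => h; exact: phiE.
Qed.

Lemma smooth_on_line (V V' : normedModType R) (D : set V) (D' : set V')
    (f : V' -> R) (phi : V -> V') (dphi : V -> V') :
  (forall x u (h : R), phi (h *: u + x) = h *: dphi u + phi x) ->
  (forall x, differentiable phi x) -> (forall x, D x -> D' (phi x)) ->
  smooth_on D' f -> smooth_on D (f \o phi).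
Proof.
move=> phiE dp DD' sf vs x Dx; rewrite (iter_derive_line _ _ phiE).
by apply: differentiable_comp => //; apply: sf; exact: DD'.
Qed.

Lemma near_eq_differentiable (V : normedModType R) (f g : V -> R) x :
  (\near x, f x = g x) -> differentiable g x -> differentiable f x.
Proof.
move=> fg dg; have fgx := nbhs_singleton fg.
have [gc /eqaddoP gE] := (diff_locallyP x g).1 dg.
have fE : f \o shift x = cst (f x) + 'd g x +o_ 0 id.
  have fg0 := (nbhs0P (fun y => f y = g y) x).1 fg.
  apply/eqaddoP => e e0; have ge := gE e e0; near=> h.
  have fh : f (x + h) = g (x + h) by near: h; exact: fg0.
  have gh : `|(g \o shift x - (cst (g x) + 'd g x)) h| <= e * `|id h|.
    by near: h; exact: ge.
  by move: gh; rewrite !fctE /= (addrC h x) fh fgx.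
by apply/diff_locallyP; rewrite (diff_unique gc fE).
Unshelve. all: by end_near.
Qed.

Section linear_combination.
Variables (V : normedModType R) (D : set V).
Hypothesis oD : forall x, D x -> \forall y \near x, D y.
Variables (F G : V -> R) (a b : R).
Hypotheses (sF : smooth_on D F) (sG : smooth_on D G).

(** The identity is stated on a neighbourhood because the induction differentiates it once more. *)
Lemma iter_derive_linear vs x : D x ->
  \forall y \near x, iter_derive vs (a *: F + b *: G) y =
    (a *: iter_derive vs F + b *: iter_derive vs G) y.
Proof.
elim: vs x => [|v vs IH] x Dx; first by near=> y.
near=> y; have Dy : D y by near: y; exact: oD.
rewrite /= (near_eq_derive v (IH _ Dy)).
have dF : derivable (iter_derive vs F) y v by apply/diff_derivable/sF.
have dG : derivable (iter_derive vs G) y v by apply/diff_derivable/sG.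
rewrite deriveD; [|exact: derivableZ|exact: derivableZ].
by rewrite deriveZ// deriveZ.
Unshelve. all: by end_near.
Qed.

Lemma smooth_on_linear : smooth_on D (a *: F + b *: G).
Proof.
move=> vs x Dx; apply: near_eq_differentiable (iter_derive_linear vs Dx) _.
by apply: differentiableD; apply: differentiableZ; [exact: sF|exact: sG].
Qed.

End linear_combination.

Lemma smooth_on_cst (V : normedModType R) (D : set V) (c : R) :
  smooth_on D (cst c : V -> R).
Proof.
move=> vs x _.
suff [c' ->] : exists c', iter_derive vs (cst c : V -> R) = cst c'.
  exact: differentiable_cst.
elim: vs => [|v vs [c' /= ->]]; first by exists c.
by exists 0; apply/funext => y; rewrite derive_cst.
Qed.

End smooth_closure.

Section smooth_on_product.
Context {R : realType}.
Notation R4 := (R4 R).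
Notation S3 := (S3 R).

Definition punctured2 : set (R4 * R4) := [set p | p.1 != 0 /\ p.2 != 0].

Definition extend2 (a : S3 * S3 -> R) (p : R4 * R4) : R := a (radial p.1, radial p.2).

Definition smooth2 (a : S3 * S3 -> R) : Prop := smooth_on punctured2 (extend2 a).

Lemma near_punctured2 p : punctured2 p -> \forall q \near p, punctured2 q.
Proof.
case: p => x y [/= x0 y0].
have c1 : {for (x, y), continuous (@fst R4 R4)} by exact: cvg_fst.
have c2 : {for (x, y), continuous (@snd R4 R4)} by exact: cvg_snd.
have hx : \forall q \near (x, y), q.1 != 0 := c1 _ (near_neq0 x0).
have hy : \forall q \near (x, y), q.2 != 0 := c2 _ (near_neq0 y0).
near=> q; split; near: q; [exact: hx|exact: hy].
Unshelve. all: by end_near.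
Qed.

Lemma punctured2_vecS3 z : punctured2 (@vecS3_pair R z).
Proof. by split; exact: vecS3_neq0. Qed.

Lemma extend2_vecS3 (a : S3 * S3 -> R) z : extend2 a (vecS3_pair z) = a z.
Proof. by case: z => x y; rewrite /extend2 /= !radial_vecS3. Qed.

Definition inl4 (v : R4) : R4 * R4 := (v, 0).
Definition inr4 (v : R4) : R4 * R4 := (0, v).

Let slice1E (y0 : R4) (x u : R4) (h : R) :
  (h *: u + x, y0) = h *: inl4 u + (x, y0) :> R4 * R4.
Proof. by congr pair; rewrite /= scaler0 add0r. Qed.

Let slice2E (x0 : R4) (x u : R4) (h : R) :
  (x0, h *: u + x) = h *: inr4 u + (x0, x) :> R4 * R4.
Proof. by congr pair; rewrite /= scaler0 add0r. Qed.

Let slice1 (a : S3 * S3 -> R) y :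
  (fun x => a (x, y)) \o radial = extend2 a \o (fun x => (x, vecS3 y)).
Proof. by apply/funext => x; rewrite /extend2 /= radial_vecS3. Qed.

Let slice2 (a : S3 * S3 -> R) x :
  (fun y => a (x, y)) \o radial = extend2 a \o (fun y => (vecS3 x, y)).
Proof. by apply/funext => y; rewrite /extend2 /= radial_vecS3. Qed.

Lemma smooth1_slice1 a y : smooth2 a -> smooth1 (fun x => a (x, y)).
Proof.
move=> sa; rewrite /smooth1 slice1.
apply: (smooth_on_line (slice1E (vecS3 y)) _ _ sa) => [x|x x0].
  by apply: differentiable_pair.
by split => //; exact: vecS3_neq0.
Qed.

Lemma smooth1_slice2 a x : smooth2 a -> smooth1 (fun y => a (x, y)).
Proof.
move=> sa; rewrite /smooth1 slice2.
apply: (smooth_on_line (slice2E (vecS3 x)) _ _ sa) => [y|y y0].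
  by apply: differentiable_pair.
by split => //; exact: vecS3_neq0.
Qed.

Definition lap_x (a : S3 * S3 -> R) (z : S3 * S3) : R :=
  laplace_beltrami_re (fun x => a (x, z.2)) z.1.

Definition lap_y (a : S3 * S3 -> R) (z : S3 * S3) : R :=
  laplace_beltrami_re (fun y => a (z.1, y)) z.2.

(** The derivatives of a slice become derivatives of the extension to R^4 x R^4. These are
    continuous in both points together, whence linearity, boundedness and joint measurability. *)
Let lap_xE a z : lap_x a z =
  \sum_(e <- @basis4 R) iter_derive [:: inl4 e; inl4 e] (extend2 a) (vecS3_pair z).
Proof.
rewrite /lap_x /laplace_beltrami_re; apply: eq_bigr => e _.
rewrite -[LHS]/(iter_derive [:: e; e] _ _) slice1.
by rewrite (iter_derive_line _ _ (slice1E (vecS3 z.2))).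
Qed.

Let lap_yE a z : lap_y a z =
  \sum_(e <- @basis4 R) iter_derive [:: inr4 e; inr4 e] (extend2 a) (vecS3_pair z).
Proof.
rewrite /lap_y /laplace_beltrami_re; apply: eq_bigr => e _.
rewrite -[LHS]/(iter_derive [:: e; e] _ _) slice2.
by rewrite (iter_derive_line _ _ (slice2E (vecS3 z.1))).
Qed.

Let lap_linear (inj4 : R4 -> R4 * R4) a b (s t : R) z e : smooth2 a -> smooth2 b ->
  iter_derive [:: inj4 e; inj4 e] (extend2 (fun z => s * a z + t * b z)) (vecS3_pair z) =
  s * iter_derive [:: inj4 e; inj4 e] (extend2 a) (vecS3_pair z) +
  t * iter_derive [:: inj4 e; inj4 e] (extend2 b) (vecS3_pair z).
Proof.
move=> sa sb.
exact: nbhs_singleton (iter_derive_linear near_punctured2 s t sa sb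
  [:: inj4 e; inj4 e] (punctured2_vecS3 z)).
Qed.

Lemma smooth2_linear a b (s t : R) : smooth2 a -> smooth2 b ->
  smooth2 (fun z => s * a z + t * b z).
Proof. by move=> sa sb; exact: (smooth_on_linear near_punctured2 s t sa sb). Qed.

Lemma smooth2_cst (c : R) : smooth2 (fun=> c).
Proof. exact: smooth_on_cst. Qed.

Lemma lap_x_linear a b (s t : R) z : smooth2 a -> smooth2 b ->
  lap_x (fun z => s * a z + t * b z) z = s * lap_x a z + t * lap_x b z.
Proof.
move=> sa sb; rewrite !lap_xE !mulr_sumr -big_split.
by apply: eq_bigr => e _; exact: (lap_linear inl4 _ _ _ e sa sb).
Qed.

Lemma lap_y_linear a b (s t : R) z : smooth2 a -> smooth2 b ->
  lap_y (fun z => s * a z + t * b z) z = s * lap_y a z + t * lap_y b z.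
Proof.
move=> sa sb; rewrite !lap_yE !mulr_sumr -big_split.
by apply: eq_bigr => e _; exact: (lap_linear inr4 _ _ _ e sa sb).
Qed.

Lemma lap_x_cst0 z : lap_x (fun=> 0 : R) z = 0.
Proof.
have e : (fun _ : S3 * S3 => 0 * 0 + 0 * 0 : R) = (fun=> 0).
  by apply/funext => ?; rewrite mul0r addr0.
by have := lap_x_linear 0 0 z (smooth2_cst 0) (smooth2_cst 0); rewrite e !mul0r addr0.
Qed.

Lemma lap_y_cst0 z : lap_y (fun=> 0 : R) z = 0.
Proof.
have e : (fun _ : S3 * S3 => 0 * 0 + 0 * 0 : R) = (fun=> 0).
  by apply/funext => ?; rewrite mul0r addr0.
by have := lap_y_linear 0 0 z (smooth2_cst 0) (smooth2_cst 0); rewrite e !mul0r addr0.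
Qed.

(** A class stable under sums and products that contains smooth functions and their Laplacians; over
    a finite measure it settles the integrability conditions below. *)
Definition bounded_measurable d (T : measurableType d) (f : T -> R) : Prop :=
  measurable_fun [set: T] f /\ exists B : R, forall x, `|f x| <= B.

Lemma compact_sphere4X : compact (@sphere4 R `*` @sphere4 R).
Proof. by apply: compact_setX; exact: compact_sphere4. Qed.

Let bounded_measurable_extension (f : R4 * R4 -> R) :
  (forall p, punctured2 p -> {for p, continuous f}) ->
  bounded_measurable (f \o @vecS3_pair R).
Proof.
move=> fc; split.
  apply: measurable_fun_continuous_at measurableT _.
    exact: countably_approximable_S3_pair.
  by move=> z _; apply: fc; exact: punctured2_vecS3.
have [|B fB] := bounded_on_compact compact_sphere4X (f := f).
  by move=> p [p1 p2]; apply: fc; split; exact: sphere4_neq0.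
by exists B => z; apply: fB; split; exact: sqnorm_vecS3.
Qed.

Lemma smooth2_bounded_measurable a : smooth2 a -> bounded_measurable a.
Proof.
move=> sa.
have -> : a = extend2 a \o @vecS3_pair R.
  by apply/funext => z; rewrite /= extend2_vecS3.
apply: bounded_measurable_extension => p Dp.
by apply: differentiable_continuous; exact: (sa [::]).
Qed.

Let sum_bounded_measurable (inj4 : R4 -> R4 * R4) a : smooth2 a ->
  bounded_measurable (fun z =>
    \sum_(e <- @basis4 R) iter_derive [:: inj4 e; inj4 e] (extend2 a) (vecS3_pair z)).
Proof.
move=> sa.
pose f (e : R4) := iter_derive [:: inj4 e; inj4 e] (extend2 a).
have c e p : punctured2 p -> {for p, continuous (f e)}.
  by move=> Dp; apply: differentiable_continuous; exact: sa.
have := @bounded_measurable_extension (fun p => f (1, 0, 0, 0) p + f (0, 1, 0, 0) p +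
    f (0, 0, 1, 0) p + f (0, 0, 0, 1) p).
rewrite (_ : _ \o _ = fun z => \sum_(e <- @basis4 R) f e (vecS3_pair z)).
  apply=> p Dp.
  by apply: cvgD; last exact: c; apply: cvgD; last exact: c; apply: cvgD; exact: c.
by apply/funext => z; rewrite sum_basis4.
Qed.

Lemma lap_x_bounded_measurable a : smooth2 a -> bounded_measurable (lap_x a).
Proof. by rewrite (funext (lap_xE a)); exact: (sum_bounded_measurable inl4). Qed.

Lemma lap_y_bounded_measurable a : smooth2 a -> bounded_measurable (lap_y a).
Proof. by rewrite (funext (lap_yE a)); exact: (sum_bounded_measurable inr4). Qed.

End smooth_on_product.

Section bounded_measurable.
Context {R : realType} d (T : measurableType d).
Implicit Types f g : T -> R.

Lemma bounded_measurable_cst (c : R) : bounded_measurable (fun _ : T => c).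
Proof. by split; [exact: measurable_cst|exists `|c|]. Qed.

Lemma bounded_measurableD f g : bounded_measurable f -> bounded_measurable g ->
  bounded_measurable (fun x => f x + g x).
Proof.
move=> [mf [B fB]] [mg [C gC]]; split; first exact: measurable_funD.
by exists (B + C) => x; rewrite (le_trans (ler_normD _ _))// lerD.
Qed.

Lemma bounded_measurableM f g : bounded_measurable f -> bounded_measurable g ->
  bounded_measurable (fun x => f x * g x).
Proof.
move=> [mf [B fB]] [mg [C gC]]; split; first exact: measurable_funM.
by exists (B * C) => x; rewrite normrM ler_pM.
Qed.

Lemma bounded_measurableZ (c : R) f : bounded_measurable f ->
  bounded_measurable (fun x => c * f x).
Proof. by move=> bf; apply: bounded_measurableM => //; exact: bounded_measurable_cst. Qed.

Lemma bounded_measurableB f g : bounded_measurable f -> bounded_measurable g ->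
  bounded_measurable (fun x => f x - g x).
Proof.
move=> bf bg; rewrite (_ : (fun _ => _) = (fun x => f x + -1 * g x)).
  by apply: bounded_measurableD => //; exact: bounded_measurableZ.
by apply/funext => x; rewrite mulN1r.
Qed.

Lemma bounded_measurable_sum (I : eqType) (s : seq I) (h : I -> T -> R) :
  (forall i, i \in s -> bounded_measurable (h i)) ->
  bounded_measurable (fun x => \sum_(i <- s) h i x).
Proof.
elim: s => [|i s IH] hs.
  rewrite (_ : (fun _ => _) = fun=> 0); first exact: bounded_measurable_cst.
  by apply/funext => x; rewrite big_nil.
rewrite (_ : (fun _ => _) = fun x => h i x + \sum_(i <- s) h i x).
  apply: bounded_measurableD; first by apply: hs; rewrite mem_head.
  by apply: IH => j js; apply: hs; rewrite inE js orbT.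
by apply/funext => x; rewrite big_cons.
Qed.

Lemma bounded_measurable_integrable (mu : {measure set T -> \bar R}) f :
  (mu [set: T] < +oo)%E -> bounded_measurable f ->
  mu.-integrable [set: T] (EFin \o f).
Proof.
move=> muT [mf [B fB]]; apply: measurable_bounded_integrable => //.
exists B; split; first exact: num_real.
by move=> y By x _; rewrite /= (le_trans (fB x))// ltW.
Qed.

End bounded_measurable.

(** * Green's identity, orthogonality and Bessel's inequality on the product *)

Section product_sphere.
Context {R : realType}.
Notation S3 := (S3 R).
Notation sigma := (@sphere_measure R).
Notation mu := (@sphere2_measure R).
Implicit Types a b : S3 * S3 -> R.

Lemma sphere2_measure_lty : (mu [set: S3 * S3] < +oo)%E.
Proof.
rewrite -setXTT [ltLHS]product_measure1E//.
have s : (sigma [set: S3] < +oo)%E by rewrite -ge0_fin_numE// fin_num_measure.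
by rewrite lte_mul_pinfty// ge0_fin_numE.
Qed.

Lemma bounded_measurable_integrable2 a : bounded_measurable a ->
  mu.-integrable [set: S3 * S3] (EFin \o a).
Proof. exact: bounded_measurable_integrable sphere2_measure_lty. Qed.

Definition ip a b : R := \int[mu]_z (a z * b z).

Lemma ipC a b : ip a b = ip b a.
Proof. by apply: eq_Rintegral => z _; rewrite mulrC. Qed.

Lemma ipDl a b c : bounded_measurable a -> bounded_measurable b ->
  bounded_measurable c -> ip (fun z => a z + b z) c = ip a c + ip b c.
Proof.
move=> ba bb bc; rewrite /ip; under eq_Rintegral do rewrite mulrDl.
by rewrite RintegralD//; apply: bounded_measurable_integrable2;
  exact: bounded_measurableM.
Qed.

Lemma ipZl k a b : bounded_measurable a -> bounded_measurable b ->
  ip (fun z => k * a z) b = k * ip a b.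
Proof.
move=> ba bb; rewrite /ip; under eq_Rintegral do rewrite -mulrA.
by rewrite RintegralZl//; apply: bounded_measurable_integrable2;
  exact: bounded_measurableM.
Qed.

Lemma ipBl a b c : bounded_measurable a -> bounded_measurable b ->
  bounded_measurable c -> ip (fun z => a z - b z) c = ip a c - ip b c.
Proof.
move=> ba bb bc; rewrite (_ : (fun _ => _) = (fun z => a z + -1 * b z)).
  by rewrite ipDl ?ipZl ?mulN1r//; exact: bounded_measurableZ.
by apply/funext => z; rewrite mulN1r.
Qed.

Lemma ip_suml (I : eqType) (s : seq I) (k : I -> R) (h : I -> S3 * S3 -> R) b :
  (forall i, i \in s -> bounded_measurable (h i)) -> bounded_measurable b ->
  ip (fun z => \sum_(i <- s) k i * h i z) b = \sum_(i <- s) k i * ip (h i) b.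
Proof.
move=> hs bb; elim: s hs => [|i s IH] hs.
  rewrite big_nil /ip; under eq_Rintegral do rewrite big_nil mul0r.
  by rewrite /Rintegral integral0.
have bi : bounded_measurable (h i) by apply: hs; rewrite mem_head.
have bs j : j \in s -> bounded_measurable (h j).
  by move=> js; apply: hs; rewrite inE js orbT.
rewrite big_cons -IH// -ipZl//.
rewrite -ipDl//; [|exact: bounded_measurableZ|]; last first.
  by apply: bounded_measurable_sum => j /bs; exact: bounded_measurableZ.
by congr ip; apply/funext => z; rewrite big_cons.
Qed.

Lemma ip_ge0 a : 0 <= ip a a.
Proof. by apply: Rintegral_ge0 => z _; rewrite -expr2 sqr_ge0. Qed.

Let green0 a b : bounded_measurable a -> bounded_measurable b ->
  (\int[mu]_z (a z - b z)%:E = 0)%E -> \int[mu]_z a z = \int[mu]_z b z.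
Proof.
move=> ba bb ab0; apply/eqP; rewrite -subr_eq0; apply/eqP.
rewrite -RintegralB//; try exact: bounded_measurable_integrable2.
by rewrite /Rintegral ab0.
Qed.

(** Green's identity makes the difference integrate to 0 on every slice with [y] fixed, and Fubini
    assembles the slices. *)
Lemma ip_lap_x a b : smooth2 a -> smooth2 b -> ip b (lap_x a) = ip a (lap_x b).
Proof.
move=> sa sb.
have ba := smooth2_bounded_measurable sa; have bb := smooth2_bounded_measurable sb.
have la := lap_x_bounded_measurable sa; have lb := lap_x_bounded_measurable sb.
have bla := bounded_measurableM bb la; have alb := bounded_measurableM ba lb.
apply: green0 => //.
apply: (integral_eq0_sections2 (m1 := sigma) (m2 := sigma)
  (bounded_measurable_integrable2 (bounded_measurableB bla alb))) => y.
exact: green_sphere (smooth1_slice1 y sa) (smooth1_slice1 y sb).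
Qed.

Lemma ip_lap_y a b : smooth2 a -> smooth2 b -> ip b (lap_y a) = ip a (lap_y b).
Proof.
move=> sa sb.
have ba := smooth2_bounded_measurable sa; have bb := smooth2_bounded_measurable sb.
have la := lap_y_bounded_measurable sa; have lb := lap_y_bounded_measurable sb.
have bla := bounded_measurableM bb la; have alb := bounded_measurableM ba lb.
apply: green0 => //.
apply: (integral_eq0_sections1 (m1 := sigma) (m2 := sigma)
  (bounded_measurable_integrable2 (bounded_measurableB bla alb))) => x.
exact: green_sphere (smooth1_slice2 x sa) (smooth1_slice2 x sb).
Qed.

Definition eigen (l : R) (psi : S3 * S3 -> R) : Prop :=
  smooth2 psi /\ forall z, lap_x psi z + lap_y psi z = - l * psi z.

Lemma ip_laplacian_eigen l a psi : smooth2 a -> eigen l psi ->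
  ip (fun z => lap_x a z + lap_y a z) psi = - l * ip a psi.
Proof.
move=> sa [sp ep].
have ba := smooth2_bounded_measurable sa; have bp := smooth2_bounded_measurable sp.
have lax := lap_x_bounded_measurable sa; have lay := lap_y_bounded_measurable sa.
have lpx := lap_x_bounded_measurable sp; have lpy := lap_y_bounded_measurable sp.
have hx := ip_lap_x sa sp; have hy := ip_lap_y sa sp.
have {}ep : (fun z => lap_x psi z + lap_y psi z) = (fun z => - l * psi z).
  exact/funext.
move: hx hy lax lay lpx lpy ep.
move: (lap_x a) (lap_y a) (lap_x psi) (lap_y psi) => ax ay px py.
move=> hx hy bax bay bpx bpy ep.
by rewrite ipDl// (ipC ax) (ipC ay) hx hy ![ip a _]ipC -ipDl// ep ipZl.
Qed.

(** The Laplacian is symmetric, so [l] and [m] multiply the same inner product to equal values. *)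
Lemma eigen_orthogonal l m psi phi : l != m -> eigen l psi -> eigen m phi ->
  ip psi phi = 0.
Proof.
move=> lm epsi ephi; have [sp ep] := epsi.
have bp := smooth2_bounded_measurable sp.
have bphi := smooth2_bounded_measurable ephi.1.
have := ip_laplacian_eigen sp ephi.
rewrite (_ : (fun z => _) = (fun z => - l * psi z)); last exact/funext.
rewrite ipZl// => /eqP; rewrite -subr_eq0 -mulrBl mulf_eq0 opprK addrC subr_eq0.
by rewrite eq_sym (negbTE lm) => /eqP.
Qed.

(** The [psi l] are orthogonal but only of norm at most 1, as in [spectral_mass]. Their combination
    [S] then satisfies [|S|^2 <= (S, a)], and expanding [|a - S|^2 >= 0] concludes. *)
Lemma bessel (s : seq R) (psi : R -> S3 * S3 -> R) a :
  bounded_measurable a -> uniq s ->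
  (forall l, l \in s -> eigen l (psi l) /\ ip (psi l) (psi l) <= 1) ->
  \sum_(l <- s) ip a (psi l) ^+ 2 <= ip a a.
Proof.
move=> ba us es; pose c l := ip a (psi l).
have bp l : l \in s -> bounded_measurable (psi l).
  by move=> /es[[sp _] _]; exact: smooth2_bounded_measurable.
pose S z := \sum_(l <- s) c l * psi l z.
have bS : bounded_measurable S.
  by apply: bounded_measurable_sum => l /bp; exact: bounded_measurableZ.
have Sa : ip S a = \sum_(l <- s) c l ^+ 2.
  rewrite ip_suml//; apply: eq_bigr => l _.
  by rewrite ipC -/(c l) expr2.
have Spsi l : l \in s -> ip S (psi l) = c l * ip (psi l) (psi l).
  move=> ls; rewrite ip_suml//; last exact: bp.
  rewrite (bigD1_seq l)//= big_seq_cond big1 ?addr0// => m /andP[ms ml].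
  by rewrite (eigen_orthogonal ml) ?mulr0//; [exact: (es m ms).1|exact: (es l ls).1].
have SS : ip S S <= \sum_(l <- s) c l ^+ 2.
  rewrite [leLHS]ip_suml// big_seq_cond [leRHS]big_seq_cond.
  apply: ler_sum => l /andP[ls _].
  rewrite ipC Spsi// mulrA -expr2 ler_piMr ?sqr_ge0//.
  exact: (es l ls).2.
have := ip_ge0 (fun z => a z - S z).
have baS := bounded_measurableB ba bS.
rewrite ipBl// (ipC a) (ipC S) !ipBl// Sa (ipC a S) Sa => h.
by rewrite -/(c _); lra.
Qed.

End product_sphere.

(** * Sobolev norms and spectral projections *)

Section sobolev.
Context {R : realType}.
Notation S3 := (S3 R).
Notation mu := (@sphere2_measure R).
Notation normc := ComplexField.Normc.normc.
Implicit Types a b : S3 * S3 -> R.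

Definition of_real (a : S3 * S3 -> R) (z : S3 * S3) : R[i] := Complex (a z) 0.

Lemma smooth_of_real a : smooth2 a -> smooth (of_real a).
Proof. by move=> sa; split; [exact: sa|exact: smooth2_cst]. Qed.

Lemma normc_of_real a z : normc (of_real a z) = `|a z|.
Proof. by rewrite /= expr0n/= addr0 sqrtr_sqr. Qed.

Lemma Lq_norm2E (u : S3 * S3 -> R[i]) : Lq_norm 2%:E u =
  ((\int[mu]_z (complex.Re (u z) ^+ 2 + complex.Im (u z) ^+ 2)%:E) `^ 2^-1)%E.
Proof.
rewrite /Lq_norm unlock; congr (_ `^ _)%E; apply: eq_integral => z _.
rewrite poweR_EFin; congr EFin; rewrite powR_mulrn ?normr_ge0//.
case: (u z) => x y /=; rewrite ger0_norm ?sqrtr_ge0// sqr_sqrtr//.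
by rewrite addr_ge0 ?sqr_ge0.
Qed.

Lemma integral_bounded_measurable a : bounded_measurable a ->
  (\int[mu]_z (a z)%:E = (\int[mu]_z a z)%:E)%E.
Proof.
move=> ba; rewrite /Rintegral fineK//.
exact: integrable_fin_num (bounded_measurable_integrable2 ba).
Qed.

Lemma Lq_norm2_of_real a : bounded_measurable a ->
  Lq_norm 2%:E (of_real a) = (ip a a `^ 2^-1)%:E.
Proof.
move=> ba; rewrite Lq_norm2E -poweR_EFin; congr (_ `^ _)%E.
rewrite -integral_bounded_measurable; last exact: bounded_measurableM.
by apply: eq_integral => z _; rewrite /= expr0n addr0 expr2.
Qed.

Lemma le_Rintegral_bounded a b : bounded_measurable a -> bounded_measurable b ->
  (forall z, a z <= b z) -> \int[mu]_z a z <= \int[mu]_z b z.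
Proof.
by move=> ba bb ab; apply: le_Rintegral => //; exact: bounded_measurable_integrable2.
Qed.

(* Rotating the phase of [phi] makes [inner u phi] real, and then only the real
   part of [phi] matters. *)
Lemma eigenfunction_real a l phi : bounded_measurable a ->
  eigenfunction l phi -> (Lq_norm 2%:E phi <= 1)%E ->
  exists psi, [/\ eigen l psi, ip psi psi <= 1 &
    normc (inner (of_real a) phi) ^+ 2 = ip a psi ^+ 2].
Proof.
move=> ba [[sr si] ephi] phi1.
pose r z := complex.Re (phi z); pose i z := complex.Im (phi z).
have {}sr : smooth2 r by exact: sr.
have {}si : smooth2 i by exact: si.
have er : eigen l r.
  split=> // z; have := ephi z => /(congr1 (@complex.Re R)).
  by rewrite /r; case: (phi z) => x y /= ->; ring.
have ei : eigen l i.
  split=> // z; have := ephi z => /(congr1 (@complex.Im R)).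
  by rewrite /i; case: (phi z) => x y /= ->; ring.
have br := smooth2_bounded_measurable sr; have bi := smooth2_bounded_measurable si.
have brr := bounded_measurableM br br; have bii := bounded_measurableM bi bi.
pose al := ip a r; pose be := ip a i.
have normE : normc (inner (of_real a) phi) ^+ 2 = al ^+ 2 + be ^+ 2.
  rewrite /inner /= sqr_sqrtr ?addr_ge0 ?sqr_ge0//; congr (_ + _).
    congr (_ ^+ 2); apply: eq_Rintegral => z _.
    by rewrite /of_real /r; case: (phi z) => x y /=; ring.
  rewrite -sqrrN; congr (_ ^+ 2); rewrite -mulN1r -RintegralZl//; last first.
    apply: bounded_measurable_integrable2.
    rewrite (_ : (fun _ => _) = (fun z => -1 * (a z * i z))).
      by apply: bounded_measurableZ; exact: bounded_measurableM.
    by apply/funext => z; rewrite /of_real /i; case: (phi z) => x y /=; ring.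
  apply: eq_Rintegral => z _.
  by rewrite /of_real /i; case: (phi z) => x y /=; ring.
have sum1 : ip r r + ip i i <= 1.
  rewrite -RintegralD//; try exact: bounded_measurable_integrable2.
  move: phi1; rewrite Lq_norm2E.
  under eq_integral do rewrite !expr2.
  rewrite (integral_bounded_measurable (bounded_measurableD brr bii)) poweR_EFin lee_fin.
  have I0 : 0 <= \int[mu]_z (r z * r z + i z * i z).
    by apply: Rintegral_ge0 => z _; rewrite addr_ge0// -expr2 sqr_ge0.
  by rewrite powR12_sqrt// => h; rewrite -(sqr_sqrtr I0) expr_le1 ?sqrtr_ge0.
(* When the inner product vanishes there is no phase to rotate, and the real part itself serves. *)
have [m0|m0] := eqVneq (al ^+ 2 + be ^+ 2) 0.
  exists r; split => //.
    by have := ip_ge0 i; lra.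
  rewrite normE m0 -/al; apply/esym/eqP.
  by move/eqP: m0; rewrite paddr_eq0 ?sqr_ge0// => /andP[].
have mp : 0 < al ^+ 2 + be ^+ 2 by rewrite lt_neqAle eq_sym m0 addr_ge0 ?sqr_ge0.
pose m := Num.sqrt (al ^+ 2 + be ^+ 2).
have m2 : m ^+ 2 = al ^+ 2 + be ^+ 2 by rewrite sqr_sqrtr// ltW.
have mn0 : m != 0 by rewrite gt_eqF// sqrtr_gt0.
(* The cosine and sine of the phase. *)
pose s := al / m; pose t := be / m.
have st : s ^+ 2 + t ^+ 2 = 1 by rewrite !expr_div_n -mulrDl -m2 divff// expf_neq0.
have bs := bounded_measurableZ s br; have bt := bounded_measurableZ t bi.
have bst := bounded_measurableD bs bt.
exists (fun z => s * r z + t * i z); split.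
- split; first exact: smooth2_linear.
  move=> z; rewrite lap_x_linear// lap_y_linear//.
  have := er.2 z; have := ei.2 z.
  move: (lap_x r z) (lap_y r z) (lap_x i z) (lap_y i z) (r z) (i z).
  move=> rx ry ix iy x y h2 h1.
  transitivity (s * (rx + ry) + t * (ix + iy)); first by ring.
  by rewrite h1 h2; ring.
- apply: le_trans sum1; rewrite -RintegralD//; try exact: bounded_measurable_integrable2.
  apply: le_Rintegral_bounded; [exact: bounded_measurableM|exact: bounded_measurableD|] => z.
  move: (r z) (i z) => x y.
  (* Cauchy-Schwarz in the plane: the two sides differ by [(s y - t x)^2]. *)
  have -> : x * x + y * y = (s ^+ 2 + t ^+ 2) * (x * x + y * y) by rewrite st mul1r.
  by rewrite -subr_ge0; have := sqr_ge0 (s * y - t * x); congr (_ <= _); ring.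
- rewrite normE -m2 ipC ipDl// !ipZl// (ipC r) (ipC i) -/al -/be.
  congr (_ ^+ 2); rewrite /s /t -[LHS]mulr1 -[X in _ * X](divff mn0) mulrA.
  by rewrite -expr2 m2; field.
Qed.

(* Each supremum in the finite sum is approached by its own element [c l]. *)
Lemma sum_ereal_sup_le (X : seq R) (w : R -> R) (S : R -> set (\bar R)) (B : R) :
  uniq X -> (forall l, l \in X -> 0 < w l) ->
  (forall l e, S l e -> (0 <= e)%E /\ e \is a fin_num) ->
  (forall l, S l !=set0) ->
  (forall c : R -> R, (forall l, l \in X -> S l (c l)%:E) ->
    \sum_(l <- X) w l * c l <= B) ->
  (\sum_(l <- X) (w l)%:E * ereal_sup (S l) <= B%:E)%E.
Proof.
move=> uX w0 Sfin Sne; elim: X B uX w0 => [|l0 X IH] B.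
  move=> _ _ /(_ (fun=> 0)); rewrite !big_nil lee_fin; exact.
rewrite cons_uniq => /andP[l0X uX] w0 HB.
have wX l : l \in X -> 0 < w l by move=> lX; apply: w0; rewrite inE lX orbT.
have sup0 l : (0 <= ereal_sup (S l))%E.
  have [e Se] := Sne l; exact: le_trans (Sfin _ _ Se).1 (ereal_sup_ubound Se).
set Sg := (\sum_(l <- X) (w l)%:E * ereal_sup (S l))%E in IH *.
have Sg0 : (0 <= Sg)%E.
  rewrite /Sg big_seq_cond; apply: sume_ge0 => l /andP[lX _].
  by rewrite mule_ge0// lee_fin ltW// wX.
(* With the element chosen for [l0] frozen, the induction hypothesis bounds the remaining sum by
   what is left of [B]; the supremum over [e] is taken afterwards. *)
have key e : S l0 e -> (Sg <= (B - w l0 * fine e)%:E)%E.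
  move=> Se; apply: IH => // c Sc.
  pose c' l := if l == l0 then fine e else c l.
  have cl0 : c' l0 = fine e by rewrite /c' eqxx.
  have cX l : l \in X -> c' l = c l.
    by move=> lX; rewrite /c'; case: eqVneq => // ll0; rewrite -ll0 lX in l0X.
  have := HB c'; rewrite big_cons cl0.
  rewrite (_ : \sum_(l <- X) w l * c' l = \sum_(l <- X) w l * c l); last first.
    by apply: eq_big_seq => l lX; rewrite cX.
  rewrite lerBrDl; apply => l; rewrite inE => /predU1P[->|lX].
    by rewrite cl0 fineK//; exact: (Sfin _ _ Se).2.
  by rewrite cX//; exact: Sc.
have Sgfin : Sg \is a fin_num.
  have [e Se] := Sne l0; rewrite ge0_fin_numE//.
  exact: le_lt_trans (key _ Se) (ltry _).
have wl0 : 0 < w l0 by apply: w0; rewrite mem_head.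
have sle : (ereal_sup (S l0) <= ((B - fine Sg) / w l0)%:E)%E.
  apply: ge_ereal_sup => e Se; have := key e Se.
  have [_ /fineK eE] := Sfin _ _ Se.
  rewrite -eE -{1}(fineK Sgfin) !lee_fin ler_pdivlMr//; lra.
rewrite big_cons -/Sg -(fineK Sgfin).
have -> : B%:E = ((w l0)%:E * ((B - fine Sg) / w l0)%:E + (fine Sg)%:E)%E.
  by rewrite -EFinM -EFinD mulrC divfK ?subrK// gt_eqF.
by rewrite leeD2r// lee_pmul2l// ?lte_fin.
Qed.

(** The zero function satisfies the eigenvalue equation for every [l], so the supremum in
    [spectral_mass] is never over the empty set. *)
Lemma spectral_set_ne0 a l :
  [set (normc (inner (of_real a) phi) ^+ 2)%:E | phi in
    [set phi | eigenfunction l phi /\ (Lq_norm 2%:E phi <= 1)%E]] !=set0.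
Proof.
pose z0 : S3 * S3 -> R[i] := fun=> 0.
exists (normc (inner (of_real a) z0) ^+ 2)%:E; exists z0 => //; split.
  split; first by split; exact: smooth2_cst.
  move=> z.
  rewrite -[laplace_x _ _]/(Complex (lap_x (fun=> 0) z) (lap_x (fun=> 0) z)).
  rewrite -[laplace_y _ _]/(Complex (lap_y (fun=> 0) z) (lap_y (fun=> 0) z)).
  by rewrite lap_x_cst0 lap_y_cst0 mulr0 addr0.
have -> : z0 = of_real (fun=> 0) by [].
rewrite Lq_norm2_of_real; last exact: bounded_measurable_cst.
rewrite /ip; under eq_Rintegral do rewrite mul0r.
by rewrite /Rintegral integral0 powR0 ?lee_fin// invr_neq0.
Qed.

(** The infinite sum is a supremum over finite sets and each spectral mass is a supremum too, so a
    uniform bound over finite families of real eigenfunctions is enough. *)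
Lemma Hs_norm_le a (s B : R) : bounded_measurable a -> 0 <= B ->
  (forall (X : seq R) (psi : R -> S3 * S3 -> R), uniq X ->
    (forall l, l \in X -> [/\ 0 <= l, eigen l (psi l) & ip (psi l) (psi l) <= 1]) ->
    \sum_(l <- X) (1 + l) `^ s * ip a (psi l) ^+ 2 <= B) ->
  (Hs_norm s (of_real a) <= (B `^ 2^-1)%:E)%E.
Proof.
move=> ba B0 HB; rewrite /Hs_norm -poweR_EFin; apply: gt0_ler_poweR.
- by rewrite invr_ge0.
- rewrite in_itv/= leey andbT.
  apply: esum_ge0 => l _; rewrite mule_ge0 ?lee_fin ?powR_ge0//.
  have [e Se] := spectral_set_ne0 a l.
  by apply: le_trans (ereal_sup_ubound Se); case: Se => phi _ <-; rewrite lee_fin sqr_ge0.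
- by rewrite in_itv/= leey lee_fin B0.
apply: ge_ereal_sup => _ [A [fA AS] <-].
rewrite fsbig_finite//=.
have uX := finmap.fset_uniq (fset_set A).
have XA l : l \in finmap.enum_fset (fset_set A) -> 0 <= l.
  move=> lX; apply: AS; rewrite -in_setE.
  by have := in_fset_set fA l; rewrite lX.
move: (finmap.enum_fset _) uX XA => X uX XA.
apply: sum_ereal_sup_le => //.
- by move=> l /XA l0; rewrite powR_gt0// ltr_pwDl.
- by move=> l _ [phi _ <-]; rewrite lee_fin sqr_ge0.
- by move=> l; exact: spectral_set_ne0.
move=> c Sc.
have ch l : exists psi, l \in X ->
    [/\ 0 <= l, eigen l psi, ip psi psi <= 1 & c l = ip a psi ^+ 2].
  have [lX|lX] := boolP (l \in X); last by exists (fun=> 0).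
  have [phi [ephi phi1] [cE]] := Sc _ lX.
  have [psi [ep p1 pE]] := eigenfunction_real ba ephi phi1.
  by exists psi => _; split => //; [exact: XA|rewrite -cE].
have {ch}[psi Hpsi] := choice ch.
rewrite (eq_big_seq (fun l => (1 + l) `^ s * ip a (psi l) ^+ 2)); last first.
  by move=> l lX; have [_ _ _ ->] := Hpsi _ lX.
by apply: HB => // l lX; have [l0 ep p1 _] := Hpsi _ lX.
Qed.

End sobolev.

(** * Zonal functions *)

Section chebyshev.
Context {R : realType}.

(* The pair [(U_n, U_(n-1))] of Chebyshev polynomials of the second kind. *)
Fixpoint cheb (n : nat) : {poly R} * {poly R} :=
  if n is m.+1 then ('X *+ 2 * (cheb m).1 - (cheb m).2, (cheb m).1) else (1, 0).

(** The two relations go together: the step for one polynomial uses the derivatives of both members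
    of the previous pair. *)
Lemma cheb_deriv n :
  (1 - 'X ^+ 2) * ((cheb n).1)^`() = (n.+1)%:R * (cheb n).2 - n%:R * 'X * (cheb n).1 /\
  (1 - 'X ^+ 2) * ((cheb n).2)^`() = (n.+1)%:R * 'X * (cheb n).2 - n%:R * (cheb n).1.
Proof.
elim: n => [|n [IH1 IH2]] /=.
  by rewrite -polyC1 derivC deriv0 !mulr0 !mul0r subrr.
split; last first.
  by rewrite IH1 -!natr1; ring.
rewrite derivB derivM derivMn derivX mulrBr IH2.
have -> : (1 - 'X ^+ 2) * (1 *+ 2 * (cheb n).1 + 'X *+ 2 * ((cheb n).1)^`()) =
  (1 - 'X ^+ 2) * (1 *+ 2 * (cheb n).1) + 'X *+ 2 * ((1 - 'X ^+ 2) * ((cheb n).1)^`()) :> {poly R}.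
  by ring.
by rewrite IH1 -!natr1; ring.
Qed.

(** Differentiating the first relation of [cheb_deriv] and substituting both gives the equation
    multiplied by [1 - X^2], a nonzero factor in an integral domain. *)
Lemma cheb_ode n : (1 - 'X ^+ 2) * ((cheb n).1)^`()^`() - 3%:R * 'X * ((cheb n).1)^`() =
  - (n * n.+2)%:R * (cheb n).1.
Proof.
have [h1 h2] := cheb_deriv n.
have n0 : (1 - 'X ^+ 2 : {poly R}) != 0.
  by rewrite -oppr_eq0 opprB -size_poly_eq0 -polyC1 size_XnsubC.
apply: (mulfI n0).
have := congr1 deriv h1; rewrite derivM derivB derivXn -polyC1 derivC polyC1.
rewrite derivB !derivM -!polyC_natr !derivC derivX !mul0r !add0r mulr1 => h3.
move: h1 h2 h3; rewrite !polyC_natr.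
move: (cheb n).1 (cheb n).2 (((cheb n).1)^`()) (((cheb n).2)^`()) (((cheb n).1)^`()^`()).
move=> U V U' V' U'' h1 h2; rewrite /= expr1 => h3.
transitivity ((1 - 'X ^+ 2) * ('X *- 2 * U' + (1 - 'X ^+ 2) * U'') -
    'X * ((1 - 'X ^+ 2) * U')); first by ring.
rewrite h3.
transitivity (n.+1%:R * ((1 - 'X ^+ 2) * V') - (1 - 'X ^+ 2) * n%:R * U -
    (n%:R + 1) * 'X * ((1 - 'X ^+ 2) * U')); first by ring.
by rewrite h1 h2 natrM -!natr1; ring.
Qed.

End chebyshev.

(** * Stability of smoothness under products and polynomials *)

Section smooth_algebra.
Context {R : realType} (V : normedModType R) (D : set V).
Hypothesis oD : forall x, D x -> \forall y \near x, D y.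
Implicit Types F G : V -> R.

(** Bounding the order allows an induction for products: a derivative of [F * G] again involves
    products, with one order less available. *)
Definition smooth_upto (n : nat) F : Prop :=
  forall vs, (size vs <= n)%N -> forall x, D x -> differentiable (iter_derive vs F) x.

Lemma smooth_onE F : smooth_on D F <-> forall n, smooth_upto n F.
Proof.
by split=> [sF n vs _ x|sF vs x]; [exact: sF|exact: (sF (size vs) vs)].
Qed.

(** The derivative taken first is the last element of the list, so it is the one split off. *)
Lemma smooth_uptoS n F : smooth_upto n.+1 F <->
  (forall x, D x -> differentiable F x) /\ forall v, smooth_upto n ('D_v F).
Proof.
split=> [sF|[dF sF] vs].
  split=> [x Dx|v vs sz x Dx]; first exact: (sF [::]).
  have := sF (rcons vs v); rewrite size_rcons => /(_ sz x Dx).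
  by rewrite /iter_derive -cats1 foldr_cat.
case/lastP: vs => [_ //|vs v]; rewrite size_rcons => sz x Dx.
by rewrite /iter_derive -cats1 foldr_cat; exact: (sF v vs sz x Dx).
Qed.

Lemma smooth_upto_leq m n F : (m <= n)%N -> smooth_upto n F -> smooth_upto m F.
Proof. by move=> mn sF vs sz; apply: sF; exact: leq_trans sz mn. Qed.

Let near_eq F G x : (forall y, D y -> F y = G y) -> D x -> \near x, F x = G x.
Proof.
move=> FG Dx; near=> y; apply: FG; near: y; exact: oD.
Unshelve. all: by end_near.
Qed.

Lemma eq_smooth_upto n F G : (forall x, D x -> F x = G x) ->
  smooth_upto n F -> smooth_upto n G.
Proof.
elim: n F G => [|n IH] F G FG.
  move=> sF [|//] _ x Dx /=; apply: near_eq_differentiable (sF [::] isT x Dx).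
  by apply: near_eq Dx => y Dy; exact/esym/FG.
move=> /smooth_uptoS[dF sF]; apply/smooth_uptoS; split=> [x Dx|v].
  apply: near_eq_differentiable (dF x Dx).
  by apply: near_eq Dx => y Dy; exact/esym/FG.
by apply: IH (sF v) => x Dx; apply: near_eq_derive; exact: near_eq FG Dx.
Qed.

Lemma smooth_uptoD n F G : smooth_upto n F -> smooth_upto n G -> smooth_upto n (F + G).
Proof.
elim: n F G => [|n IH] F G.
  by move=> sF sG [|//] _ x Dx; apply: differentiableD; [exact: (sF [::])|exact: (sG [::])].
move=> /smooth_uptoS[dF sF] /smooth_uptoS[dG sG]; apply/smooth_uptoS.
split=> [x Dx|v]; first by apply: differentiableD; [exact: dF|exact: dG].
apply: eq_smooth_upto (IH _ _ (sF v) (sG v)) => x Dx.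
by rewrite deriveD//; apply: diff_derivable; [exact: dF|exact: dG].
Qed.

Lemma smooth_uptoM n F G : smooth_upto n F -> smooth_upto n G -> smooth_upto n (F * G).
Proof.
elim: n F G => [|n IH] F G.
  by move=> sF sG [|//] _ x Dx; apply: differentiableM; [exact: (sF [::])|exact: (sG [::])].
move=> sF0 sG0; have := sF0; have := sG0.
move=> /smooth_uptoS[dG sG] /smooth_uptoS[dF sF]; apply/smooth_uptoS.
split=> [x Dx|v]; first by apply: differentiableM; [exact: dF|exact: dG].
apply: eq_smooth_upto (smooth_uptoD (IH _ _ (smooth_upto_leq (leqnSn n) sF0) (sG v))
  (IH _ _ (smooth_upto_leq (leqnSn n) sG0) (sF v))) => x Dx.
by rewrite deriveM//; apply: diff_derivable; [exact: dF|exact: dG].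
Qed.

Lemma eq_smooth_on F G : (forall x, D x -> F x = G x) ->
  smooth_on D F -> smooth_on D G.
Proof.
move=> FG /smooth_onE sF; apply/smooth_onE => n.
exact: eq_smooth_upto FG (sF n).
Qed.

Lemma smooth_onD F G : smooth_on D F -> smooth_on D G -> smooth_on D (F + G).
Proof.
by move=> /smooth_onE sF /smooth_onE sG; apply/smooth_onE => n; exact: smooth_uptoD.
Qed.

Lemma smooth_onM F G : smooth_on D F -> smooth_on D G -> smooth_on D (F * G).
Proof.
by move=> /smooth_onE sF /smooth_onE sG; apply/smooth_onE => n; exact: smooth_uptoM.
Qed.

Lemma smooth_on_horner (p : {poly R}) F : smooth_on D F ->
  smooth_on D (fun x => p.[F x]).
Proof.
move=> sF; elim/poly_ind: p => [|p c IH].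
  rewrite (_ : (fun _ => _) = cst 0); first exact: smooth_on_cst.
  by apply/funext => x; rewrite horner0.
rewrite (_ : (fun _ => _) = (fun x => p.[F x]) * F + cst c).
  by apply: smooth_onD; [exact: smooth_onM|exact: smooth_on_cst].
by apply/funext => x; rewrite hornerD hornerMX hornerC.
Qed.

End smooth_algebra.

Lemma differentiable_fst (R : realType) (V W : normedModType R) (x : V * W) :
  differentiable (@fst V W) x.
Proof. by apply: (@linear_differentiable _ _ _ fst) => y; exact: cvg_fst. Qed.

Lemma differentiable_snd (R : realType) (V W : normedModType R) (x : V * W) :
  differentiable (@snd V W) x.
Proof. by apply: (@linear_differentiable _ _ _ snd) => y; exact: cvg_snd. Qed.

Section inverse_norm.
Context {R : realType}.
Notation R4 := (R4 R).
Notation nonzero := [set x : R4 | x != 0].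

Definition inorm (x : R4) : R := (enorm x)^-1.

Lemma near_nonzero (x : R4) : nonzero x -> \forall y \near x, nonzero y.
Proof. exact: near_neq0. Qed.

Lemma differentiable_dot (y x : R4) : differentiable (dot y) x.
Proof.
have d1 (z : R4) := differentiable_fst z.
have d2 (z : R4) := differentiable_snd z.
have d11 (z : R * R * R) := differentiable_fst z.
have d12 (z : R * R * R) := differentiable_snd z.
have d111 (z : R * R) := differentiable_fst z.
have d112 (z : R * R) := differentiable_snd z.
have -> : dot y = y.1.1.1 *: (fst \o fst \o fst : R4 -> R) +
    y.1.1.2 *: (snd \o fst \o fst : R4 -> R) + y.1.2 *: (snd \o fst : R4 -> R) +
    y.2 *: (snd : R4 -> R) by [].
apply: differentiableD; last exact: differentiableZ.
apply: differentiableD; last by apply: differentiableZ; apply: differentiable_comp.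
apply: differentiableD; apply: differentiableZ; apply: differentiable_comp => //;
  exact: differentiable_comp.
Qed.

Lemma differentiable_sqnorm (x : R4) : differentiable (@sqnorm R) x.
Proof.
have -> : @sqnorm R = dot (1, 0, 0, 0) ^+ 2 + dot (0, 1, 0, 0) ^+ 2 +
    dot (0, 0, 1, 0) ^+ 2 + dot (0, 0, 0, 1) ^+ 2.
  by apply/funext => y; rewrite /sqnorm -[RHS]/(_ ^+ 2 + _ ^+ 2 + _ ^+ 2 + _ ^+ 2)
    /dot/= !mul0r !mul1r ?addr0 ?add0r.
by apply: differentiableD; last (apply: differentiableX; exact: differentiable_dot);
  apply: differentiableD; last (apply: differentiableX; exact: differentiable_dot);
  apply: differentiableD; apply: differentiableX; exact: differentiable_dot.
Qed.

Lemma is_derive_invsqrt (t : R) : 0 < t ->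
  is_derive t (1 : R) (fun t => (Num.sqrt t)^-1) (- (2^-1 * (Num.sqrt t)^-1 ^+ 3)).
Proof.
move=> t0; have st : Num.sqrt t != 0 by rewrite gt_eqF// sqrtr_gt0.
have ds := is_derive1_sqrt t0.
have [sd sE] := ds; split; first exact: derivableV.
rewrite deriveV// sE /GRing.scale/=.
by field.
Qed.

Lemma is_derive_inorm (x v : R4) : x != 0 ->
  is_derive x v inorm (- (dot x v * inorm x ^+ 3)).
Proof.
move=> x0; have s0 : 0 < sqnorm x by rewrite lt_neqAle sqnorm_ge0 eq_sym sqnorm_eq0 x0.
have D := is_derive_real_comp (is_derive_sqnorm x v) (is_derive_invsqrt s0).
by apply: (is_derive_eq D); rewrite /inorm /enorm; field; rewrite gt_eqF ?sqrtr_gt0.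
Qed.

Lemma differentiable_inorm (x : R4) : x != 0 -> differentiable inorm x.
Proof.
move=> x0; have s0 : 0 < sqnorm x by rewrite lt_neqAle sqnorm_ge0 eq_sym sqnorm_eq0 x0.
apply: (@differentiable_comp _ _ _ _ (@sqnorm R) (fun t => (Num.sqrt t)^-1)).
  exact: differentiable_sqnorm.
by apply/derivable1_diffP; case: (is_derive_invsqrt s0).
Qed.

Lemma smooth_on_dot (D : set R4) y : smooth_on D (dot y).
Proof.
have h v vs : iter_derive vs ('D_v (dot y)) = iter_derive vs (cst (dot y v)).
  by congr iter_derive; apply/funext => x; have [_ ->] := is_derive_dot x v y.
move=> vs x Dx; case/lastP: vs => [|vs v]; first exact: differentiable_dot.
rewrite /iter_derive -cats1 foldr_cat -/(iter_derive vs _) h.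
exact: (@smooth_on_cst R _ D).
Qed.

(** The derivative of [1 / |x|] is minus a linear form times [1 / |x|^3], hence a polynomial in
    functions already smooth to the preceding order. *)
Lemma smooth_on_inorm : smooth_on nonzero inorm.
Proof.
apply/smooth_onE; elim=> [|n IH].
  by move=> [|//] _ x x0; exact: differentiable_inorm.
apply/smooth_uptoS; split; first exact: differentiable_inorm.
move=> v.
have sd : smooth_upto nonzero n (- dot v).
  have -> : - dot v = dot (- v) by apply/funext => x; rewrite -[in RHS]scaleN1r dotZl mulN1r.
  by have /smooth_onE := @smooth_on_dot nonzero (- v); apply.
have oD := @near_nonzero.
have sn := smooth_uptoM oD (smooth_uptoM oD (smooth_uptoM oD sd IH) IH) IH.
apply: (eq_smooth_upto oD _ sn).
move=> x x0; have [_ ->] := is_derive_inorm v x0.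
rewrite -[LHS]/((- dot v x) * inorm x * inorm x * inorm x) (dotC v).
by move: (dot x v) (inorm x) => a b; ring.
Qed.

End inverse_norm.

(** * The Laplacian of zonal functions *)

Section zonal.
Context {R : realType}.
Notation R4 := (R4 R).
Notation S3 := (S3 R).

Definition cosine (z : S3 * S3) : R := dot (vecS3 z.1) (vecS3 z.2).

Definition zonal (p : {poly R}) (z : S3 * S3) : R := p.[cosine z].

Let vecS3_radialE (x : R4) : x != 0 -> vecS3 (radial x) = inorm x *: x.
Proof. exact: vecS3_radial. Qed.

Lemma smooth2_zonal p : smooth2 (zonal p).
Proof.
have oD := @near_punctured2 R.
have s1 y : smooth_on (@punctured2 R) (dot y \o fst).
  apply: (smooth_on_line (D' := [set: R4]) (dphi := fst)) => //.
    by move=> x; exact: differentiable_fst.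
  exact: smooth_on_dot.
have s2 y : smooth_on (@punctured2 R) (dot y \o snd).
  apply: (smooth_on_line (D' := [set: R4]) (dphi := snd)) => //.
    by move=> x; exact: differentiable_snd.
  exact: smooth_on_dot.
have i1 : smooth_on (@punctured2 R) (inorm \o fst).
  apply: (smooth_on_line (dphi := fst)) (smooth_on_inorm) => //.
    by move=> x; exact: differentiable_fst.
  by move=> x [].
have i2 : smooth_on (@punctured2 R) (inorm \o snd).
  apply: (smooth_on_line (dphi := snd)) (smooth_on_inorm) => //.
    by move=> x; exact: differentiable_snd.
  by move=> x [].
have sM := smooth_onM oD; have sD := smooth_onD oD.
(* The extension of the cosine, [x.y / (|x| |y|)], written with functions whose smoothness is
   known. *)
pose g := ((dot (1, 0, 0, 0) \o fst) * (dot (1, 0, 0, 0) \o snd) +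
  (dot (0, 1, 0, 0) \o fst) * (dot (0, 1, 0, 0) \o snd) +
  (dot (0, 0, 1, 0) \o fst) * (dot (0, 0, 1, 0) \o snd) +
  (dot (0, 0, 0, 1) \o fst) * (dot (0, 0, 0, 1) \o snd)) *
  ((inorm \o fst) * (inorm \o snd)) : R4 * R4 -> R.
have sg : smooth_on (@punctured2 R) g.
  apply: (sM); last exact: (sM).
  by apply: (sD); last (by apply: (sM)); apply: (sD); last (by apply: (sM));
    apply: (sD); apply: (sM).
apply: (eq_smooth_on oD _ (smooth_on_horner oD p sg)) => -[x y] [x0 y0].
rewrite /extend2 /zonal /cosine /= !vecS3_radialE// dotZl dotZr; congr (p.[_]).
rewrite -[LHS]/((dot (1, 0, 0, 0) x * dot (1, 0, 0, 0) y +
  dot (0, 1, 0, 0) x * dot (0, 1, 0, 0) y + dot (0, 0, 1, 0) x * dot (0, 0, 1, 0) y +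
  dot (0, 0, 0, 1) x * dot (0, 0, 0, 1) y) * (inorm x * inorm y)).
by rewrite /dot/= !mul0r !mul1r !add0r !addr0; ring.
Qed.

Section laplacian_zonal.
Variables (p : {poly R}) (y : R4).
Hypothesis y1 : sqnorm y = 1.

Let c (x : R4) : R := dot y x * inorm x.

Let dc (e x : R4) : R := dot y e * inorm x - dot y x * dot x e * inorm x ^+ 3.

Let ddc (e x : R4) : R := - 2 * (dot y e * dot x e * inorm x ^+ 3)
  - dot y x * sqnorm e * inorm x ^+ 3 + 3 * (dot y x * dot x e ^+ 2 * inorm x ^+ 5).

Let is_derive_c e x : x != 0 -> is_derive x e c (dc e x).
Proof.
move=> x0; have D := is_deriveM (is_derive_dot x e y) (is_derive_inorm e x0).
apply: (is_derive_eq D); rewrite /dc /GRing.scale/=.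
by move: (dot y x) (dot x e) (inorm x) (dot y e) => a b n d; ring.
Qed.

Let is_derive_dc e x : x != 0 -> is_derive x e (dc e) (ddc e x).
Proof.
move=> x0; have di := is_derive_inorm e x0; have dy := is_derive_dot x e y.
have de : is_derive x e (fun x => dot x e) (sqnorm e).
  have -> : (fun x => dot x e) = dot e by apply/funext => z; rewrite dotC.
  by rewrite -dotxx; exact: is_derive_dot.
have i3 := is_deriveM di (is_deriveM di di).
have D := is_deriveB (is_deriveM (is_derive_cst (dot y e) x e) di)
  (is_deriveM (is_deriveM dy de) i3).
have -> : dc e = cst (dot y e) * inorm -
    (dot y * (fun x => dot x e)) * (inorm * (inorm * inorm)).
  apply/funext => z; rewrite /dc -[RHS]/(dot y e * inorm z -
    dot y z * dot z e * (inorm z * (inorm z * inorm z))).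
  by rewrite !exprS expr0 mulr1.
apply: (is_derive_eq D).
rewrite -[LHS]/(dot y e * (- (dot x e * inorm x ^+ 3)) + inorm x * 0 -
  ((dot y x * dot x e) * (inorm x * (inorm x * (- (dot x e * inorm x ^+ 3)) +
     inorm x * (- (dot x e * inorm x ^+ 3))) +
     (inorm x * inorm x) * (- (dot x e * inorm x ^+ 3))) +
   (inorm x * (inorm x * inorm x)) * (dot y x * sqnorm e + dot x e * dot y e))).
rewrite /ddc; move: (dot y x) (dot x e) (inorm x) (dot y e) (sqnorm e) => a b n d s.
by ring.
Qed.

Let f (x : R4) : R := p.[c x].

Let derive_f e x : x != 0 -> 'D_e f x = p^`().[c x] * dc e x.
Proof.
move=> x0; have D := is_derive_real_comp (is_derive_c e x0) (is_derive_poly p (c x)).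
by have [_ <-] := D.
Qed.

Let derive2_f e x : x != 0 ->
  'D_e ('D_e f) x = p^`()^`().[c x] * dc e x ^+ 2 + p^`().[c x] * ddc e x.
Proof.
move=> x0; rewrite (@near_eq_derive _ _ _ _ ((horner p^`() \o c) * dc e)); last first.
  near=> z; apply: derive_f; near: z; exact: near_neq0.
have D := is_derive_real_comp (is_derive_c e x0) (is_derive_poly p^`() (c x)).
have [_ ->] := is_deriveM D (is_derive_dc e x0).
rewrite -[LHS]/(p^`().[c x] * ddc e x + dc e x * (p^`()^`().[c x] * dc e x)).
by ring.
Unshelve. all: by end_near.
Qed.

(** The chain rule gives [p''(c) |grad c|^2 + p'(c) Delta c], and at unit vectors
    [|grad c|^2 = 1 - c^2] and [Delta c = - 3 c]. *)
Lemma laplacian_zonal x : sqnorm x = 1 ->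
  laplacian f x = ((1 - 'X ^+ 2) * p^`()^`() - 3%:P * 'X * p^`()).[dot x y].
Proof.
move=> x1; have x0 : x != 0 by exact: sphere4_neq0.
have n1 : inorm x = 1 by rewrite /inorm /enorm x1 sqrtr1 invr1.
have cE : c x = dot x y by rewrite /c n1 mulr1 dotC.
rewrite /laplacian (eq_bigr _ (fun e _ => derive2_f e x0)) big_split/=.
rewrite -!mulr_sumr cE.
have -> : \sum_(e <- @basis4 R) dc e x ^+ 2 = 1 - dot x y ^+ 2.
  rewrite (eq_bigr (fun e => dot y e * dot y e - (2 * dot x y) * (dot x e * dot y e) +
      dot x y ^+ 2 * (dot x e * dot x e))); last first.
    move=> e _; rewrite /dc n1 (dotC y x).
    by move: (dot x y) (dot y e) (dot x e) => u v w; ring.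
  rewrite big_split sumrB/= -!mulr_sumr !sum_basis4_sqr !dotxx x1 y1.
  by move: (dot x y) => u; ring.
have -> : \sum_(e <- @basis4 R) ddc e x = - 3 * dot x y.
  rewrite (eq_bigr (fun e => - 2 * (dot x e * dot y e) - dot x y * sqnorm e +
      3 * dot x y * (dot x e * dot x e))); last first.
    move=> e _; rewrite /ddc n1 (dotC y x).
    by move: (dot x y) (dot y e) (dot x e) => u v w; ring.
  rewrite big_split sumrB/= -!mulr_sumr !sum_basis4_sqr sum_basis4_1 !dotxx x1.
  by move: (dot x y) => u; ring.
rewrite hornerD hornerN !hornerM hornerC hornerX hornerD hornerN hornerXn.
rewrite -polyC1 hornerC.
by move: (dot x y) (p^`()^`().[_]) (p^`().[_]) => u v w; ring.
Qed.

End laplacian_zonal.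

Definition zonal_laplacian (p : {poly R}) : {poly R} :=
  (1 - 'X ^+ 2) * p^`()^`() - 3%:P * 'X * p^`().

Let lap_zonal (p : {poly R}) (x y : S3) :
  laplace_beltrami_re (fun x' => p.[dot (vecS3 x') (vecS3 y)]) x =
  (zonal_laplacian p).[dot (vecS3 x) (vecS3 y)].
Proof.
rewrite -(laplacian_zonal p (sqnorm_vecS3 y) (sqnorm_vecS3 x)).
rewrite /laplace_beltrami_re /laplacian; apply: eq_bigr => e _.
have near_eq (x' : R4) : x' != 0 -> \forall z \near x',
    ((fun x' => p.[dot (vecS3 x') (vecS3 y)]) \o radial) z =
    p.[dot (vecS3 y) z * inorm z].
  move=> x0; near=> z; have z0 : z != 0 by near: z; exact: near_neq0.
  by rewrite /= vecS3_radialE// dotZl dotC mulrC.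
(* For second derivatives the two expressions must agree around every nearby point, hence two nested
   neighbourhoods. *)
apply: near_eq_derive; near=> z.
apply: near_eq_derive; apply: near_eq; near: z; apply: near_neq0; exact: vecS3_neq0.
Unshelve. all: by end_near.
Qed.

Lemma lap_x_zonal p z : lap_x (zonal p) z = zonal (zonal_laplacian p) z.
Proof. exact: lap_zonal. Qed.

(** Exchanging the points does not change the cosine, so the computation for the first variable
    applies. *)
Lemma lap_y_zonal p z : lap_y (zonal p) z = zonal (zonal_laplacian p) z.
Proof.
have E : (fun y => zonal p (z.1, y)) = (fun y => p.[dot (vecS3 y) (vecS3 z.1)]).
  by apply/funext => y; rewrite /zonal /cosine (dotC (vecS3 y)).
by rewrite /lap_y E lap_zonal /zonal /cosine (dotC (vecS3 z.1)).
Qed.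

End zonal.

(** * Test functions *)

Section moments.
Context {R : realType}.
Notation S3 := (S3 R).
Notation mu := (@sphere2_measure R).

Lemma cosine_bound (z : S3 * S3) : -1 <= cosine z <= 1.
Proof.
case: z => x y; rewrite /cosine /=.
have h (a : R) := sqnorm_ge0 (a *: vecS3 x + vecS3 y).
have := h 1; have := h (-1); rewrite !sqnormD !sqnorm_vecS3 dotC.
by move: (dot _ _) => d h1 h2; apply/andP; split; lra.
Qed.

Definition half_poly : {poly R} := (2^-1)%:P * (1 + 'X).

(* [cos^2 (theta / 2)], where [theta] is the angle between the two points. *)
Definition cos2half (z : S3 * S3) : R := 2^-1 * (1 + cosine z).

Lemma half_bound z : 0 <= cos2half z <= 1.
Proof. by have /andP[? ?] := cosine_bound z; rewrite /cos2half; apply/andP; split; lra. Qed.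

Lemma zonal_half n : zonal (half_poly ^+ n) = (fun z => cos2half z ^+ n).
Proof.
apply/funext => z; rewrite /zonal horner_exp /half_poly hornerM hornerC hornerD.
by rewrite hornerX -polyC1 hornerC.
Qed.

Lemma smooth2_half n : smooth2 (fun z => cos2half z ^+ n).
Proof. by rewrite -zonal_half; exact: smooth2_zonal. Qed.

Let bm n : bounded_measurable (fun z => cos2half z ^+ n).
Proof. exact: smooth2_bounded_measurable (smooth2_half n). Qed.

(** In either variable [w = cos2half] satisfies [|grad w|^2 = w - w^2] and [Delta w = 3/2 - 3 w], so
    only two consecutive powers appear. *)
Lemma zonal_laplacian_half n : zonal (zonal_laplacian (half_poly ^+ n.+1)) =
  (fun z => (n%:R + 1) * (n%:R + 3 / 2) * cos2half z ^+ n -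
            (n%:R + 1) * (n%:R + 3) * cos2half z ^+ n.+1).
Proof.
have dh : half_poly^`() = (2^-1)%:P.
  rewrite /half_poly derivM derivC mul0r add0r derivD derivX -polyC1 derivC add0r.
  by rewrite polyC1 mulr1.
apply/funext => z; rewrite /zonal /zonal_laplacian deriv_exp dh derivMn derivM.
rewrite derivC mul0r add0r deriv_exp dh /cos2half; move: (cosine z) => t.
have wE m : (half_poly ^+ m).[t] = (2^-1 * (1 + t)) ^+ m.
  by rewrite horner_exp /half_poly hornerM hornerC hornerD hornerX -polyC1 hornerC.
rewrite hornerD hornerN !hornerM !hornerMn !hornerM hornerMn hornerM !hornerC.
rewrite hornerX hornerD hornerN hornerXn -polyC1 hornerC !wE.
(* The second derivative carries the truncated exponent [n.-1]; at [n = 0] its coefficient is 0. *)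
case: n => [|n] /=; first by rewrite !expr1 !expr0 mulr0n; field.
rewrite !exprS; move: ((2^-1 * (1 + t)) ^+ n) => w.
by field.
Qed.

Definition moment n : R := \int[mu]_z cos2half z ^+ n.

Lemma ip_half m n : ip (fun z => cos2half z ^+ m) (fun z => cos2half z ^+ n) = moment (m + n).
Proof. by apply: eq_Rintegral => z _; rewrite exprD. Qed.

Lemma moment0 : moment 0 = fine (mu [set: S3 * S3]).
Proof. by rewrite /moment Rintegral_cst// mul1r. Qed.

Lemma sphere_measure_gt0 : (0 < @sphere_measure R [set: S3])%E.
Proof.
rewrite /sphere_measure preimage_setT setTI mule_gt0//.
(* A cube of side 1/2 lies in the unit ball, since [4 * (1/2)^2 = 1]. *)
pose I : set (measurableTypeR R) := `[0, 2^-1]%classic.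
have mI : measurable I by exact: measurable_itv.
have lI : (0 < @lebesgue_measure R I)%E.
  by rewrite /I lebesgue_measure_itv/= lte_fin invr_gt0 ltr0n -EFinD subr0 lte_fin invr_gt0.
have m2 : measurable (I `*` I) by exact: measurableX.
have m3 : measurable (I `*` I `*` I) by exact: measurableX.
have m4 : measurable (I `*` I `*` I `*` I) by exact: measurableX.
apply: (@lt_le_trans _ _ (lebesgue4 R (I `*` I `*` I `*` I))).
  rewrite /lebesgue4/= product_measure1E//; apply: mule_gt0; last exact: lI.
  rewrite [ltRHS]product_measure1E//; apply: mule_gt0; last exact: lI.
  by rewrite [ltRHS]product_measure1E//; apply: mule_gt0; exact: lI.
apply: le_measure; rewrite ?inE//; first exact: measurable_ball4.
move=> [[[a b] c] d] [[[/=]]].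
rewrite /I/= !in_itv/= => /andP[a0 a1] /andP[b0 b1] /andP[c0 c1] /andP[d0 d1].
have sq (t : R) : 0 <= t -> t <= 2^-1 -> t ^+ 2 <= 4^-1.
  by move=> t0 t1; nra.
rewrite /ball4/= -(expr_le1 (n := 2))// ?sqrtr_ge0// sqr_sqrtr ?sqnorm_ge0//.
have := sq _ a0 a1; have := sq _ b0 b1; have := sq _ c0 c1; have := sq _ d0 d1.
by rewrite /sqnorm/=; lra.
Qed.

Lemma moment0_gt0 : 0 < moment 0.
Proof.
rewrite moment0; apply: fine_gt0; rewrite sphere2_measure_lty andbT.
rewrite -setXTT [ltRHS]product_measure1E//.
by rewrite mule_gt0//; exact: sphere_measure_gt0.
Qed.

(** Green's identity against the constant 1: the Laplacian of [cos2half ^+ n.+1] has integral 0, and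
    the common factor [n + 1] cancels. *)
Lemma moment_rec n : (n%:R + 3) * moment n.+1 = (n%:R + 3 / 2) * moment n.
Proof.
have sa := @smooth2_zonal R (half_poly ^+ n.+1).
have s1 := @smooth2_zonal R 1.
have one : zonal 1 = (fun=> 1 : R).
  by apply/funext => z; rewrite /zonal -polyC1 hornerC.
have l1 : lap_x (zonal 1) = (fun=> 0 : R).
  apply/funext => z; rewrite lap_x_zonal /zonal_laplacian -polyC1 derivC deriv0.
  by rewrite !mulr0 subr0 /zonal horner0.
have := ip_lap_x sa s1; rewrite l1 one.
have -> : lap_x (zonal (half_poly ^+ n.+1)) =
    (fun z => (n%:R + 1) * (n%:R + 3 / 2) * cos2half z ^+ n -
              (n%:R + 1) * (n%:R + 3) * cos2half z ^+ n.+1).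
  by apply/funext => z; rewrite lap_x_zonal zonal_laplacian_half.
have b0 : bounded_measurable (fun _ : S3 * S3 => 1 : R) by exact: bounded_measurable_cst.
have b00 : bounded_measurable (fun _ : S3 * S3 => 0 : R) by exact: bounded_measurable_cst.
have ba := smooth2_bounded_measurable sa.
have bmZ (k : R) m := bounded_measurableZ k (bm m).
rewrite ipC ipBl// !ipZl// [X in _ = X -> _]ipC.
rewrite [X in _ = X -> _](_ : _ = 0); last first.
  by rewrite /ip; under eq_Rintegral do rewrite mul0r; rewrite /Rintegral integral0.
have ip1 m : ip (fun z => cos2half z ^+ m) (fun=> 1) = moment m.
  by apply: eq_Rintegral => z _; rewrite mulr1.
rewrite !ip1 -!mulrA -mulrBr => /eqP; rewrite mulf_eq0 natr1 pnatr_eq0/= subr_eq0.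
by move/eqP => ->.
Qed.

Let n0 n : (0 : R) <= n%:R. Proof. exact: ler0n. Qed.

Lemma moment_gt0 n : 0 < moment n.
Proof.
elim: n => [|n IH]; first exact: moment0_gt0.
have n3 : (0 : R) < n%:R + 3 by have := n0 n; lra.
by rewrite -(pmulr_rgt0 _ n3) moment_rec mulr_gt0.
Qed.

(** Squaring keeps the exponents integral. By the recurrence [M_n^2 (n + 1)^3] is nondecreasing,
    whereas the shift by 2 in [moment_upper] gives a nonincreasing sequence. *)
Lemma moment_lower n : moment 0 ^+ 2 <= moment n ^+ 2 * (n%:R + 1) ^+ 3.
Proof.
elim: n => [|n IH]; first by rewrite add0r expr1n mulr1.
apply: (le_trans IH); rewrite -natr1; have := n0 n; have := moment_rec n.
have := moment_gt0 n; have := moment_gt0 n.+1.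
move: (moment n.+1) (moment n) (n%:R) => y x k y0 x0 rec k0.
have k3 : 0 < (k + 3) ^+ 2 by rewrite exprn_gt0//; lra.
rewrite -(ler_pM2l k3).
have -> : (k + 3) ^+ 2 * (y ^+ 2 * (k + 1 + 1) ^+ 3) = (k + 3 / 2) ^+ 2 * x ^+ 2 * (k + 2) ^+ 3.
  by rewrite mulrA -exprMn rec exprMn; congr (_ * _ ^+ _); ring.
rewrite -subr_ge0.
have -> : (k + 3 / 2) ^+ 2 * x ^+ 2 * (k + 2) ^+ 3 - (k + 3) ^+ 2 * (x ^+ 2 * (k + 1) ^+ 3)
  = x ^+ 2 * ((k + 3 / 2) ^+ 2 * (k + 2) ^+ 3 - (k + 3) ^+ 2 * (k + 1) ^+ 3) by ring.
rewrite mulr_ge0 ?sqr_ge0//.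
have -> : (k + 3 / 2) ^+ 2 * (k + 2) ^+ 3 - (k + 3) ^+ 2 * (k + 1) ^+ 3 =
  9 / 4 * k ^+ 3 + 23 / 2 * k ^+ 2 + 18 * k + 9 by field.
by rewrite !addr_ge0 ?mulr_ge0 ?exprn_ge0//; lra.
Qed.

Lemma moment_upper n : moment n ^+ 2 * (n%:R + 2) ^+ 3 <= 8 * moment 0 ^+ 2.
Proof.
elim: n => [|n IH]; first by rewrite add0r mulrC; lra.
apply: le_trans IH; rewrite -natr1; have := n0 n; have := moment_rec n.
have := moment_gt0 n; have := moment_gt0 n.+1.
move: (moment n.+1) (moment n) (n%:R) => y x k y0 x0 rec k0.
have k3 : 0 < (k + 3) ^+ 2 by rewrite exprn_gt0//; lra.
rewrite -(ler_pM2l k3).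
have -> : (k + 3) ^+ 2 * (y ^+ 2 * (k + 1 + 2) ^+ 3) = (k + 3 / 2) ^+ 2 * x ^+ 2 * (k + 3) ^+ 3.
  by rewrite mulrA -exprMn rec exprMn; congr (_ * _ ^+ _); ring.
rewrite -subr_ge0.
have -> : (k + 3) ^+ 2 * (x ^+ 2 * (k + 2) ^+ 3) - (k + 3 / 2) ^+ 2 * x ^+ 2 * (k + 3) ^+ 3
  = x ^+ 2 * (k + 3) ^+ 2 * (3 / 4 * k + 5 / 4) by field.
by rewrite !mulr_ge0 ?sqr_ge0//; lra.
Qed.

Let diff n z : R := cos2half z ^+ n - cos2half z ^+ n.+1.

Let bdiff n : bounded_measurable (diff n).
Proof. exact: bounded_measurableB. Qed.

(** Through the recurrence the second difference of three consecutive moments is of order [n^(-2)]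
    times the last one. This gain offsets the coefficient of order [n^2] that [diff n] receives in
    the resolvent bound. *)
Let ip_diff n : ip (diff n) (diff n) =
  15 / 4 / ((2 * n%:R + 3 / 2) * (2 * n%:R + 5 / 2)) * moment (n.+1 + n.+1).
Proof.
rewrite ipBl// (ipC _ (diff n)) (ipC (fun z => cos2half z ^+ n.+1)) !ipBl// !ip_half.
rewrite !addSn !addnS; have := moment_rec (n + n).+1; have := moment_rec (n + n).
have e1 : (n + n).+1%:R = n%:R + n%:R + 1 :> R by rewrite -natr1 natrD.
rewrite e1 natrD; have := n0 n.
move: (moment _) (moment _.+1) (moment _.+2) (n%:R) => x y z k k0 xy yz.
have -> : y = (k + k + 1 + 3) * z / (k + k + 1 + 3 / 2).
  by rewrite yz; field; lra.
have -> : x = (k + k + 3) * y / (k + k + 3 / 2).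
  by rewrite xy; field; lra.
have -> : y = (k + k + 1 + 3) * z / (k + k + 1 + 3 / 2).
  by rewrite yz; field; lra.
by field; do ?[apply/andP; split]; lra.
Qed.

Let resolvent_constant (k : R) : 0 <= k ->
  2 * (3 * k + 4) ^+ 2 + 2 * (2 * (k + 1) * (k + 3 / 2)) ^+ 2 *
    (15 / 4 / ((2 * k + 3 / 2) * (2 * k + 5 / 2))) <= 48 * (k + 2) ^+ 2.
Proof.
move=> k0; have q0 : 0 < (2 * k + 3 / 2) * (2 * k + 5 / 2) by rewrite mulr_gt0//; lra.
have -> : 2 * (2 * (k + 1) * (k + 3 / 2)) ^+ 2 *
    (15 / 4 / ((2 * k + 3 / 2) * (2 * k + 5 / 2))) =
    30 * ((k + 1) * (k + 3 / 2)) ^+ 2 / ((2 * k + 3 / 2) * (2 * k + 5 / 2)).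
  by field; apply/andP; split; lra.
(* The share 18 pays for [2 (3 k + 4)^2], and 30 is [2 * 4 * 15 / 4] from the other term. *)
have -> : 48 * (k + 2) ^+ 2 = 18 * (k + 2) ^+ 2 + 30 * (k + 2) ^+ 2 by ring.
apply: lerD; first by nra.
rewrite ler_pdivrMr// -mulrA ler_pM2l// expr2.
have h1 : (k + 1) * (k + 3 / 2) <= (k + 2) ^+ 2 by nra.
have h2 : (k + 1) * (k + 3 / 2) <= (2 * k + 3 / 2) * (2 * k + 5 / 2) by nra.
by apply: ler_pM => //; rewrite mulr_ge0//; lra.
Qed.

(** Here [v] is [(1 - Delta) w^(n+1)], whose norm is thus at most of order [n] times that of
    [w^(n+1)]. *)
Lemma ip_resolvent_half n (v : S3 * S3 -> R) :
  v = (fun z => cos2half z ^+ n.+1 -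
    (lap_x (fun z => cos2half z ^+ n.+1) z + lap_y (fun z => cos2half z ^+ n.+1) z)) ->
  bounded_measurable v /\ ip v v <= 48 * (n%:R + 2) ^+ 2 * moment (n.+1 + n.+1).
Proof.
move=> vE.
(* Grouping [w^n] with [w^(n+1)] into [diff n] leaves [1 + 2 (n + 1) (3/2) = 3 n + 4] in front of
   [w^(n+1)]: the quadratic part multiplies only the small difference. *)
pose al : R := 3 * n%:R + 4; pose be : R := 2 * (n%:R + 1) * (n%:R + 3 / 2).
have {}vE : v = (fun z => al * cos2half z ^+ n.+1 - be * diff n z).
  rewrite vE -zonal_half; apply/funext => z.
  rewrite lap_x_zonal lap_y_zonal zonal_laplacian_half /diff /al /be.
  by move: (cos2half z ^+ n.+1) (cos2half z ^+ n) (n%:R) => x y k; field.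
have bv : bounded_measurable v.
  by rewrite vE; apply: bounded_measurableB; exact: bounded_measurableZ.
split=> //.
have hle : ip v v <= 2 * al ^+ 2 * moment (n.+1 + n.+1) + 2 * be ^+ 2 * ip (diff n) (diff n).
  rewrite -ip_half -(ipZl _ (bm _) (bm _)) -(ipZl _ (bdiff n) (bdiff n)).
  have b1 := bounded_measurableM (bounded_measurableZ (2 * al ^+ 2) (bm n.+1)) (bm n.+1).
  have b2 := bounded_measurableM (bounded_measurableZ (2 * be ^+ 2) (bdiff n)) (bdiff n).
  rewrite /ip -RintegralD//; try exact: bounded_measurable_integrable2.
  apply: le_Rintegral_bounded; [exact: bounded_measurableM|exact: bounded_measurableD|].
  move=> z; rewrite vE; move: (cos2half z ^+ n.+1) (diff n z) => x y.
  rewrite -subr_ge0.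
  have -> : 2 * al ^+ 2 * x * x + 2 * be ^+ 2 * y * y - (al * x - be * y) * (al * x - be * y)
    = (al * x + be * y) ^+ 2 by ring.
  exact: sqr_ge0.
apply: (le_trans hle); rewrite ip_diff [X in _ + X <= _]mulrA -mulrDl ler_pM2r ?moment_gt0//.
exact: resolvent_constant (n0 n).
Qed.

End moments.

Section chebyshev_zonal.
Context {R : realType}.
Notation S3 := (S3 R).

Definition cheb_zonal n : S3 * S3 -> R := zonal (cheb n).1.

(** Each of the two variables contributes [n (n + 2)]. *)
Definition cheb_eigenvalue n : R := 2 * (n%:R * (n%:R + 2)).

Lemma eigen_cheb_zonal n : eigen (cheb_eigenvalue n) (cheb_zonal n).
Proof.
split=> [|z]; first exact: smooth2_zonal.
rewrite lap_x_zonal lap_y_zonal /cheb_zonal /zonal /zonal_laplacian.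
rewrite (polyC_natr _ 3) cheb_ode hornerM hornerN -polyC_natr hornerC /cheb_eigenvalue natrM -!natr1.
by move: (_.[_]) (n%:R) => u k; ring.
Qed.

Lemma cheb_eigenvalue_neq m n : (m < n)%N -> cheb_eigenvalue m != cheb_eigenvalue n.
Proof.
move=> mn; rewrite lt_eqF// /cheb_eigenvalue ltr_pM2l//.
have : (m%:R : R) < n%:R by rewrite ltr_nat.
have : (0 : R) <= m%:R by [].
by move: (m%:R : R) (n%:R : R) => x y x0 xy; nra.
Qed.

(* Expanding the integral of [2 c U_n U_(n+1)], where [c] is the cosine, with
   [2 c U_n = U_(n+1) + U_(n-1)] or [2 c U_(n+1) = U_(n+2) + U_n] gives the
   squared norm of [U_(n+1)] or that of [U_n]. *)
Lemma ip_cheb_zonal n : ip (cheb_zonal n) (cheb_zonal n) = moment 0.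
Proof.
have sm m : smooth2 (cheb_zonal m) by exact: smooth2_zonal.
have bm m : bounded_measurable (cheb_zonal m) := smooth2_bounded_measurable (sm m).
have orth m k : (m < k)%N -> ip (cheb_zonal m) (cheb_zonal k) = 0.
  move=> mk; apply: (eigen_orthogonal (cheb_eigenvalue_neq mk));
    exact: eigen_cheb_zonal.
have orth2 m : ip (zonal (cheb m).2) (cheb_zonal m.+1) = 0.
  (* For [m = 0] the second member of the pair is [U_(-1) = 0], which is not a [cheb_zonal]. *)
  case: m => [|m] /=; last exact: orth.
  rewrite /ip (_ : zonal 0 = fun=> 0).
    by under eq_Rintegral do rewrite mul0r; rewrite /Rintegral integral0.
  by apply/funext => z; rewrite /zonal horner0.
elim: n => [|n <-].
  apply: eq_Rintegral => z _.
  by rewrite /cheb_zonal /zonal /= -polyC1 hornerC mulr1 expr0.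
pose v : S3 * S3 -> R := zonal (cheb n).2.
have bv : bounded_measurable v by exact: smooth2_bounded_measurable (smooth2_zonal _).
have vorth : ip v (cheb_zonal n.+1) = 0 := orth2 n.
have rec1 z : 2 * cosine z * cheb_zonal n z = cheb_zonal n.+1 z + v z.
  rewrite /cheb_zonal /v /zonal /= hornerD hornerN hornerM hornerMn hornerX subrK.
  by rewrite mulr_natl.
have rec2 z : 2 * cosine z * cheb_zonal n.+1 z = cheb_zonal n.+2 z + cheb_zonal n z.
  rewrite /cheb_zonal /zonal /= [in RHS]hornerD hornerN hornerM hornerMn hornerX subrK.
  by rewrite mulr_natl.
have h1 : ip (fun z => cheb_zonal n.+1 z + v z) (cheb_zonal n.+1) =
    ip (cheb_zonal n.+1) (cheb_zonal n.+1) by rewrite ipDl// vorth addr0.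
have h2 : ip (fun z => cheb_zonal n.+2 z + cheb_zonal n z) (cheb_zonal n) =
    ip (cheb_zonal n) (cheb_zonal n) by rewrite ipDl// ipC orth// add0r.
rewrite -h1 -h2; apply: eq_Rintegral => z _.
by rewrite -rec1 -rec2; ring.
Qed.

End chebyshev_zonal.

(** * Upper bounds for Sobolev norms *)

Section sobolev_bounds.
Context {R : realType}.
Notation S3 := (S3 R).
Implicit Types a v : S3 * S3 -> R.

(** Orthogonality removes every eigenvalue other than [L], and Bessel's inequality bounds what
    remains. *)
Lemma Hs_norm_eigen a L s : eigen L a -> 0 <= L ->
  (Hs_norm s (of_real a) <= (((1 + L) `^ s * ip a a) `^ 2^-1)%:E)%E.
Proof.
move=> ea L0; have ba := smooth2_bounded_measurable ea.1.
apply: Hs_norm_le => //; first by rewrite mulr_ge0 ?powR_ge0 ?ip_ge0.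
move=> X psi uX HX.
apply: (@le_trans _ _ ((1 + L) `^ s * \sum_(l <- X) ip a (psi l) ^+ 2)).
  rewrite mulr_sumr big_seq_cond [leRHS]big_seq_cond; apply: ler_sum => l /andP[lX _].
  have [->//|lL] := eqVneq l L.
  have [_ el _] := HX _ lX.
  by rewrite (eigen_orthogonal _ ea el) 1?eq_sym// expr0n !mulr0.
rewrite ler_wpM2l ?powR_ge0//; apply: bessel => // l lX.
by have [] := HX _ lX.
Qed.

(** [K] is a frequency threshold: up to [K] the first term dominates [x^t], beyond it the second one
    does, because [t - 2 <= 0]. *)
Lemma powR_interpolation (s t K x : R) : s <= t -> 0 <= t <= 2 -> 1 <= x -> 1 <= K ->
  x `^ s <= K `^ t + K `^ (t - 2) * x ^+ 2.
Proof.
move=> st /andP[t0 t2] x1 K1; have x0 : 0 < x by lra.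
have K0 : 0 < K by lra.
apply: (@le_trans _ _ (x `^ t)); first exact: ler_powR.
have [xK|Kx] := leP x K.
  have xt : x `^ t <= K `^ t by rewrite (ge0_ler_powR t0)// nnegrE ltW.
  by apply: (le_trans xt); rewrite lerDl mulr_ge0 ?powR_ge0 ?sqr_ge0.
suff xt : x `^ t <= K `^ (t - 2) * x ^+ 2.
  by apply: (le_trans xt); rewrite lerDr powR_ge0.
have -> : x `^ t = x `^ (t - 2) * x ^+ 2.
  rewrite -powR_mulrn ?ltW// -powRD; first by rewrite subrK.
  by rewrite (gt_eqF x0) implybT.
have inv (y : R) : y `^ (t - 2) = (y `^ (2 - t))^-1 by rewrite -powRN opprB.
rewrite ler_pM2r ?exprn_gt0// !inv lef_pV2 ?posrE ?powR_gt0//.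
have t20 : 0 <= 2 - t by rewrite subr_ge0.
by rewrite (ge0_ler_powR t20)// ?nnegrE ltW.
Qed.

(** By symmetry of the Laplacian the coefficient of [v] at [l] is [1 + l] times that of [a]. The
    scalar inequality at [x = 1 + l] then leaves one Bessel sum for [a] and one for [v]. *)
Lemma Hs_norm_interpolation a v (s t K : R) : smooth2 a ->
  v = (fun z => a z - (lap_x a z + lap_y a z)) -> bounded_measurable v ->
  s <= t -> 0 <= t <= 2 -> 1 <= K ->
  (Hs_norm s (of_real a) <=
    ((K `^ t * ip a a + K `^ (t - 2) * ip v v) `^ 2^-1)%:E)%E.
Proof.
move=> sa vE bv st t02 K1; have ba := smooth2_bounded_measurable sa.
have K0 : 0 <= K by lra.
apply: Hs_norm_le => //; first by rewrite addr_ge0 ?mulr_ge0 ?powR_ge0 ?ip_ge0.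
move=> X psi uX HX.
have vpsi l : l \in X -> ip v (psi l) = (1 + l) * ip a (psi l).
  move=> lX; have [_ el _] := HX _ lX.
  have bp := smooth2_bounded_measurable el.1.
  have bl := bounded_measurableD (lap_x_bounded_measurable sa) (lap_y_bounded_measurable sa).
  rewrite vE (ipBl ba bl bp) (ip_laplacian_eigen sa el).
  by move: (ip _ _) => c; ring.
have HX' l : l \in X -> eigen l (psi l) /\ ip (psi l) (psi l) <= 1.
  by move=> /HX[].
apply: (@le_trans _ _ (K `^ t * \sum_(l <- X) ip a (psi l) ^+ 2 +
    K `^ (t - 2) * \sum_(l <- X) ip v (psi l) ^+ 2)); last first.
  by apply: lerD; rewrite ler_wpM2l ?powR_ge0//; exact: bessel.
rewrite !mulr_sumr -big_split big_seq_cond [leRHS]big_seq_cond.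
apply: ler_sum => l /andP[lX _]; rewrite vpsi//.
have [l0 _ _] := HX _ lX.
have h : (1 + l) `^ s <= K `^ t + K `^ (t - 2) * (1 + l) ^+ 2.
  by apply: powR_interpolation => //; lra.
move: (ip a (psi l)) h => c h.
apply: (@le_trans _ _ ((K `^ t + K `^ (t - 2) * (1 + l) ^+ 2) * c ^+ 2)).
  by rewrite ler_wpM2r ?sqr_ge0.
by rewrite le_eqVlt; apply/orP; left; apply/eqP => /=; ring.
Qed.

End sobolev_bounds.

(** * Stationary solutions *)

Section stationary.
Context {R : realType}.
Notation S3 := (S3 R).
Notation mu := (@sphere2_measure R).
Notation normc := ComplexField.Normc.normc.
Implicit Types (u v w : S3 * S3 -> R[i]).

Lemma normc_ge0 (x : R[i]) : 0 <= normc x.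
Proof. by case: x => a b /=; rewrite sqrtr_ge0. Qed.

Lemma measurable_normc u : measurable_fun [set: S3 * S3] (fun z => complex.Re (u z)) ->
  measurable_fun [set: S3 * S3] (fun z => complex.Im (u z)) ->
  measurable_fun [set: S3 * S3] (fun z => normc (u z)).
Proof.
move=> mr mi.
rewrite (_ : (fun _ => _) = fun z => Num.sqrt (complex.Re (u z) ^+ 2 + complex.Im (u z) ^+ 2)).
  apply: (@measurableT_comp _ _ _ _ _ _ (@Num.sqrt R)).
    apply: continuous_measurable_fun; exact: sqrt_continuous.
  by apply: measurable_funD; apply: measurable_funX.
by apply/funext => z; case: (u z).
Qed.

Lemma L2_measurable_normc u : L2 u -> measurable_fun [set: S3 * S3] (fun z => normc (u z)).
Proof. by case=> mr mi _; exact: measurable_normc. Qed.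

Lemma measurable_normc_poweR u (q : R) :
  measurable_fun [set: S3 * S3] (fun z => normc (u z)) ->
  measurable_fun [set: S3 * S3] (fun z => `|(normc (u z))%:E| `^ q)%E.
Proof.
move=> mu_; apply: (@measurableT_comp _ _ _ _ _ _ (fun x : \bar R => (x `^ q)%E)).
  exact: measurable_poweR.
by apply: measurableT_comp => //; apply/measurable_EFinP.
Qed.

Lemma ae_eq_Lq_norm (q : R) u v : L2 u -> L2 v ->
  {ae mu, forall z, u z = v z} -> Lq_norm q%:E u = Lq_norm q%:E v.
Proof.
move=> Lu Lv uv; rewrite /Lq_norm unlock; congr (_ `^ _)%E.
apply: ae_eq_integral => //.
- exact: measurable_normc_poweR (L2_measurable_normc Lu).
- exact: measurable_normc_poweR (L2_measurable_normc Lv).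
- by apply: filterS uv => z -> _.
Qed.

Lemma Lq_norm_triangle u v w :
  measurable_fun [set: S3 * S3] (fun z => normc (u z)) ->
  measurable_fun [set: S3 * S3] (fun z => normc (v z)) ->
  measurable_fun [set: S3 * S3] (fun z => normc (w z)) ->
  (forall z, normc (w z) <= normc (u z) + normc (v z)) ->
  (Lq_norm 2%:E w <= Lq_norm 2%:E u + Lq_norm 2%:E v)%E.
Proof.
move=> mu_ mv_ mw_ h.
have n12 : (1 : R) <= 2 by lra.
apply: le_trans (minkowski_EFin mu mu_ mv_ n12).
have itv_ge0 (x : \bar R) : (0 <= x)%E -> x \in `[0, +oo]%E.
  by rewrite in_itv/= leey andbT.
rewrite /Lq_norm unlock; apply: gt0_ler_poweR.
- by rewrite invr_ge0.
- by apply: itv_ge0; apply: integral_ge0 => z _; exact: poweR_ge0.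
- by apply: itv_ge0; apply: integral_ge0 => z _; exact: poweR_ge0.
apply: ge0_le_integral => //.
- by move=> z _; exact: poweR_ge0.
- exact: measurable_normc_poweR.
- apply: (@measurableT_comp _ _ _ _ _ _ (fun x : \bar R => (x `^ 2)%E)).
    exact: measurable_poweR.
  by apply: measurableT_comp => //; apply/measurable_EFinP; exact: measurable_funD.
- move=> z _; rewrite !poweR_EFin lee_fin.
  rewrite !ger0_norm ?addr_ge0 ?normc_ge0//.
  by rewrite (@ge0_ler_powR _ 2)// nnegrE ?addr_ge0 ?normc_ge0.
Qed.

Lemma L2_smooth u : smooth u -> L2 u.
Proof.
case=> sr si.
have br := smooth2_bounded_measurable (a := fun z => complex.Re (u z)) sr.
have bi := smooth2_bounded_measurable (a := fun z => complex.Im (u z)) si.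
split; [exact: br.1|exact: bi.1|].
rewrite Lq_norm2E; under eq_integral do rewrite !expr2.
have bM := bounded_measurableD (bounded_measurableM br br) (bounded_measurableM bi bi).
by rewrite (integral_bounded_measurable bM) poweR_EFin ltry.
Qed.

Lemma normcB_le (x y : R[i]) : normc (x - y) <= normc x + normc y.
Proof. by rewrite -[normc y]normcN; exact: le_normcD. Qed.

Lemma L2B u v : L2 u -> L2 v -> L2 (fun z => u z - v z).
Proof.
move=> Lu Lv; have [mur mui uf] := Lu; have [mvr mvi vf] := Lv.
have mr : measurable_fun [set: S3 * S3] (fun z => complex.Re (u z - v z)).
  rewrite (_ : (fun _ => _) = fun z => complex.Re (u z) - complex.Re (v z)).
    exact: measurable_funB.
  by apply/funext => z; case: (u z) => ? ?; case: (v z).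
have mi : measurable_fun [set: S3 * S3] (fun z => complex.Im (u z - v z)).
  rewrite (_ : (fun _ => _) = fun z => complex.Im (u z) - complex.Im (v z)).
    exact: measurable_funB.
  by apply/funext => z; case: (u z) => ? ?; case: (v z).
split=> //; apply: (@le_lt_trans _ _ (Lq_norm 2%:E u + Lq_norm 2%:E v)%E).
  apply: Lq_norm_triangle; [exact: measurable_normc|exact: measurable_normc|
    exact: measurable_normc|].
  by move=> z; exact: normcB_le.
by rewrite lte_add_pinfty.
Qed.

Lemma Lq_norm2Z (c : R) u : measurable_fun [set: S3 * S3] (fun z => normc (u z)) ->
  Lq_norm 2%:E (fun z => real_complex R c * u z) = (`|c|%:E * Lq_norm 2%:E u)%E.
Proof.
move=> mu_; rewrite /Lq_norm unlock.
rewrite (eq_integral (fun z => ((c ^+ 2)%:E * (`|(normc (u z))%:E| `^ 2)%E)%E)); last first.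
  move=> z _; rewrite ComplexField.Normc.normcM.
  have -> : normc (real_complex R c) = `|c| by rewrite /= expr0n/= addr0 sqrtr_sqr.
  rewrite !poweR_EFin -EFinM; congr EFin.
  rewrite !powR_mulrn ?normr_ge0// normrM normr_id exprMn.
  by rewrite real_normK// num_real.
rewrite ge0_integralZl//; last 3 first.
- exact: measurable_normc_poweR.
- by move=> z _; exact: poweR_ge0.
- by rewrite lee_fin sqr_ge0.
rewrite poweRM; last 2 first.
- by rewrite lee_fin sqr_ge0.
- by apply: integral_ge0 => z _; exact: poweR_ge0.
congr (_ * _)%E; rewrite poweR_EFin; congr EFin.
by rewrite powR12_sqrt ?sqr_ge0// sqrtr_sqr.
Qed.

Section group.
Variables (A : (S3 * S3 -> R[i]) -> S3 * S3 -> R[i])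
  (U : R -> (S3 * S3 -> R[i]) -> S3 * S3 -> R[i]).
Hypothesis hU : unitary_group_of A U.
Variable phi : S3 * S3 -> R[i].
Hypotheses (sphi : smooth phi) (Aphi : forall z, A phi z = 0).

Let Lphi : L2 phi := L2_smooth sphi.
Let LU t u : L2 u -> L2 (U t u) := @unitary_group_L2 _ _ _ hU t u.

(* [drift] is subadditive, and [drift h = o(h)] because the generator kills
   [phi]; hence [drift t <= n * drift (t / n)], which tends to 0. *)
Let drift t := Lq_norm 2%:E (fun z => U t phi z - phi z).

Let Ldrift t : L2 (fun z => U t phi z - phi z).
Proof. exact: L2B (LU t Lphi) Lphi. Qed.

Let drift_ge0 t : (0 <= drift t)%E.
Proof. exact: Lnorm_ge0. Qed.

(** The displacement splits as [U_s (U_t phi - phi) + (U_s phi - phi)], and [U_s] is an isometry. *)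
Let drift_add s t : (drift (s + t) <= drift s + drift t)%E.
Proof.
pose g z := U t phi z - phi z.
have Lg : L2 g by exact: Ldrift.
pose b z := phi z - U s phi z.
have Lb : L2 b := L2B Lphi (LU s Lphi).
have Lw := L2B (LU s Lg) Lb.
have E : {ae mu, forall z, U (s + t) phi z - phi z = U s g z - b z}.
  have lin := unitary_group_linear hU s (-1) Lphi (LU t Lphi).
  have -> : g = (fun z => -1 * phi z + U t phi z).
    by apply/funext => z; rewrite mulN1r addrC.
  apply: filterS2 lin (unitary_group_D hU s t Lphi) => z -> ->.
  by rewrite /b; ring.
rewrite /drift (ae_eq_Lq_norm 2 (Ldrift _) Lw E) addeC.
rewrite -[X in (_ <= X + _)%E](unitary_group_isometry hU s Lg).
apply: (Lq_norm_triangle (L2_measurable_normc (LU s Lg))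
  (L2_measurable_normc (Ldrift s)) (L2_measurable_normc Lw)) => z.
by apply: le_trans (normcB_le _ _) _; rewrite /b -opprB normcN.
Qed.

Let drift_natmul n t : (drift (n.+1%:R * t) <= n.+1%:R%:E * drift t)%E.
Proof.
elim: n => [|n IH]; first by rewrite mul1r mul1e.
rewrite -natr1 mulrDl mul1r EFinD ge0_muleDl ?lee_fin// mul1e.
by apply: le_trans (drift_add _ _) _; exact: leeD.
Qed.

Let drift_derivative : (`|t^-1|%:E * drift t)%E @[t --> 0^'] --> 0%E.
Proof.
have := unitary_group_generator hU sphi.
apply: cvg_trans; apply: near_eq_cvg; near=> t.
rewrite -(Lq_norm2Z _ (L2_measurable_normc (Ldrift t))).
congr (Lq_norm _ _); apply/funext => z.
by rewrite Aphi mulr0 subr0 fmorphV.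
Unshelve. all: by end_near. Qed.

Lemma unitary_group_stationary t : {ae mu, forall z, U t phi z = phi z}.
Proof.
have d0 : drift t = 0%E.
  have [->|t0] := eqVneq t 0.
    have L0 : L2 (fun z => phi z - phi z) := L2B Lphi Lphi.
    rewrite /drift (ae_eq_Lq_norm 2 (Ldrift 0) L0).
      rewrite Lq_norm2E integral0_eq ?poweR0r ?invr_eq0//.
      by move=> z _; rewrite subrr /= expr0n/= addr0.
    by apply: filterS (unitary_group_0 hU Lphi) => z ->.
  apply/eqP; rewrite eq_le drift_ge0 andbT.
  apply/lee_addgt0Pr => e e0; rewrite add0e.
  (* Bounding [drift] by this slope at [t / n] gives [n * (e / |t|) * |t / n| = e]. *)
  have e0' : 0 < e / `|t| by rewrite divr_gt0// normr_gt0.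
  have N0 : nbhs (0%E : \bar R) [set y | (y < (e / `|t|)%:E)%E].
    rewrite /nbhs/=; near=> r; rewrite /= lte_fin.
    by near: r; exact: lt_nbhsl.
  have /nbhs_ballP[d /= d0 H] : nbhs (0 : R) (fun x : R => x != 0 ->
      (`|x^-1|%:E * drift x < (e / `|t|)%:E)%E) := drift_derivative N0.
  (* Enough steps to bring [t / n] within the radius [d]. *)
  have [n /andP[n0 nt]] : exists n : nat, (0 < n)%N && (`|t| / d < n%:R).
    exists (Num.truncn (`|t| / d)).+1.
    by rewrite /= truncnS_gt.
  case: n n0 nt => // n _ nt.
  have n0 : (n.+1%:R : R) != 0 by rewrite pnatr_eq0.
  have x0 : t / n.+1%:R != 0 by rewrite mulf_neq0// invr_eq0.
  have bx : ball 0 d (t / n.+1%:R).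
    rewrite /ball/= sub0r normrN normrM normfV [X in _ / X]ger0_norm// ltr_pdivrMr//.
    by rewrite mulrC -ltr_pdivrMr.
  have := H _ bx x0; rewrite /=.
  have := drift_natmul n (t / n.+1%:R); rewrite mulrCA divff// mulr1.
  move: (drift _) (drift_ge0 (t / n.+1%:R)) => D D0 dD lD.
  have {}D0 : (0 <= D)%E by [].
  apply: (le_trans dD); move: lD; rewrite -lte_pdivlMl ?normr_gt0 ?invr_eq0//.
  rewrite normfV invrK -EFinM normrM normfV.
  move=> /ltW lD.
  apply: le_trans (lee_wpmul2l _ lD) _; first by rewrite lee_fin.
  rewrite -EFinM lee_fin [`|n.+1%:R|]ger0_norm//.
  have t0' : `|t| != 0 by rewrite normr_eq0.
  move: (n.+1%:R : R) n0 => N n0.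
  by rewrite le_eqVlt; apply/orP; left; apply/eqP; field; rewrite t0' n0.
have m := L2_measurable_normc (Ldrift t).
have m' : measurable_fun [set: S3 * S3] (fun z => (normc (U t phi z - phi z))%:E).
  by apply/measurable_EFinP.
have p2 : (0 < 2%:E :> \bar R)%E by rewrite lte_fin.
have := Lnorm_eq0_eq0 m' p2 d0.
apply: filterS => z /(_ I) /= [] /(@ComplexField.Normc.eq0_normc R) /eqP.
by rewrite subr_eq0 => /eqP.
Unshelve. all: by end_near. Qed.

End group.
End stationary.

(** * Failure of the estimate *)

Section stationary_zonal.
Context {R : realType}.
Notation S3 := (S3 R).
Notation mu := (@sphere2_measure R).
Notation normc := ComplexField.Normc.normc.

Lemma zonal_stationary (p : {poly R}) z :
  laplace_x (of_real (zonal p)) z - laplace_y (of_real (zonal p)) z = 0.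
Proof.
rewrite -[laplace_x _ _]/(Complex (lap_x (zonal p) z) (lap_x (fun=> 0) z)).
rewrite -[laplace_y _ _]/(Complex (lap_y (zonal p) z) (lap_y (fun=> 0) z)).
by rewrite lap_x_cst0 lap_y_cst0 lap_x_zonal lap_y_zonal subrr.
Qed.

(** The time interval has length 1, so no power of its length appears, whether [p] is finite or
    not. *)
Lemma LpLq_norm_cst (p q : \bar R) (w : R -> S3 * S3 -> R[i]) (c : \bar R) :
  (2%:E <= p)%E -> (0 <= c)%E -> (forall t, Lq_norm q (w t) = c) ->
  LpLq_norm p q w = c.
Proof.
move=> hp c0 wc; rewrite /LpLq_norm.
rewrite (_ : (fun t => Lq_norm q (w t)) = cst c); last by apply/funext.
set nu := mrestr _ _.
have nu1 : nu [set: R] = 1%E.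
  rewrite /nu /mrestr setTI [LHS](lebesgue_measure_itv `[0, 1]%R) /= lte_fin ltr01.
  by rewrite oppr0 adde0.
case: p hp => [p| |] // hp; rewrite unlock.
  have p0 : p != 0 by move: hp; rewrite lee_fin => hp; rewrite gt_eqF//; lra.
  rewrite (eq_integral (cst (c `^ p)%E)); last by move=> t _; rewrite gee0_abs.
  by rewrite integral_cst// [X in (_ * X)%E]nu1 mule1 -poweRrM divff// poweRe1.
rewrite [X in (0 < X)%E]nu1 lte01; apply: ess_sup_ae_cst.
  by rewrite [ltRHS]nu1 lte01.
by apply: nearW => t; rewrite /= gee0_abs.
Qed.

(** As [cos2half] takes values in [[0, 1]] and [q <= 3], its power [n q] is at least its power
    [3 n]: the real exponent is traded for an integer one, with a loss in the constant only. *)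
Lemma Lq_norm_half_ge (q : R) n : 0 < q -> q <= 3 ->
  ((moment (3 * n) `^ q^-1)%:E <= Lq_norm q%:E (of_real (fun z => cos2half z ^+ n)%R))%E.
Proof.
move=> q0 q3; rewrite /Lq_norm unlock -poweR_EFin.
have b m : bounded_measurable (fun z : S3 * S3 => cos2half z ^+ m) :=
  smooth2_bounded_measurable (smooth2_half m).
have mn : measurable_fun [set: S3 * S3] (fun z => normc (of_real (fun z => cos2half z ^+ n) z)).
  by rewrite (funext (normc_of_real _)); apply: measurableT_comp => //; exact: (b n).1.
have h0 z : (0 : R) <= cos2half z by have /andP[] := half_bound z.
have m0 : (0%:E <= (moment (3 * n)%N)%:E :> \bar R)%E by rewrite lee_fin ltW// moment_gt0.
have itv_ge0 (x : \bar R) : (0 <= x)%E -> x \in `[0, +oo]%E.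
  by rewrite in_itv/= leey andbT.
apply: gt0_ler_poweR.
- by rewrite invr_ge0 ltW.
- exact: itv_ge0.
- by apply: itv_ge0; apply: integral_ge0 => z _; exact: poweR_ge0.
rewrite /moment -(integral_bounded_measurable (b _)).
apply: ge0_le_integral => //.
- by move=> z _; rewrite lee_fin exprn_ge0.
- by apply/measurable_EFinP; exact: (b _).1.
- exact: measurable_normc_poweR.
move=> z _; rewrite poweR_EFin lee_fin normc_of_real !normr_id (ger0_norm (exprn_ge0 _ (h0 z))).
rewrite mulnC exprM -powR_mulrn ?exprn_ge0//.
have /andP[a0 a1] := half_bound z.
(* Monotonicity in the exponent is applied to a positive base; at base 0 both powers vanish. *)
have [->|an0] := eqVneq (cos2half z ^+ n) 0.
  by rewrite !powR0 ?gt_eqF.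
by apply: ger_powR => //; rewrite lt_def an0 exprn_ge0//= exprn_ile1.
Qed.

End stationary_zonal.

Section evolution.
Context {R : realType}.
Notation S3 := (S3 R).
Variable U : R -> (S3 * S3 -> R[i]) -> S3 * S3 -> R[i].
Hypothesis hU : unitary_group_of (fun u z => laplace_x u z - laplace_y u z) U.

Lemma zonal_LpLq_norm (p : \bar R) (q : R) (a : {poly R}) : (2%:E <= p)%E ->
  LpLq_norm p q%:E (fun t => U t (of_real (zonal a))) = Lq_norm q%:E (of_real (zonal a)).
Proof.
move=> p2; apply: LpLq_norm_cst => //; first exact: Lnorm_ge0.
have sa := smooth_of_real (@smooth2_zonal R a); have La := L2_smooth sa.
move=> t; apply: ae_eq_Lq_norm => //; first exact: (unitary_group_L2 hU).
exact: (unitary_group_stationary hU sa (zonal_stationary a)).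
Qed.

End evolution.

(** * Comparison of growth rates *)

Section asymptotics.
Context {R : realType}.

Lemma ln_natr_unbounded (e c : R) : 0 < e -> exists n : nat, c < e * ln n.+2%:R.
Proof.
move=> e0; exists (Num.truncn (expR (c / e))).
have h : expR (c / e) < (Num.truncn (expR (c / e))).+2%:R.
  by apply: lt_trans (truncnS_gt _) _; rewrite ltr_nat.
by rewrite mulrC -ltr_pdivrMr// -[ltLHS]expRK ltr_ln// posrE ?expR_gt0.
Qed.

(* In logarithmic form all the hypotheses are linear in [ln n.+2]. *)
Lemma moment_asymptotics_contradiction (M0 C t rp rq : R) (x y : nat -> R) :
  0 < M0 -> 0 < C -> t < rp -> 0 <= rq -> rp = 3 / 2 - 3 * rq ->
  (forall n, 0 < x n) -> (forall n, 0 < y n) ->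
  (forall n, M0 ^+ 2 <= x n ^+ 2 * (27 * n.+2%:R ^+ 3)) ->
  (forall n, y n ^+ 2 * n.+2%:R ^+ 3 <= M0 ^+ 2) ->
  ~ (forall n, x n `^ rq <= C * (49 * (n.+2%:R `^ t * y n)) `^ 2^-1).
Proof.
move=> M00 C0 trp rq0 rpE x0 y0 xM yM H.
have e0 : 0 < (rp - t) / 2 by rewrite divr_gt0 ?subr_gt0.
(* In the logarithmic inequality [ln n.+2] has coefficient [(rp - t) / 2], and this constant
   collects all the terms independent of [n]. *)
have [n] := ln_natr_unbounded (ln C + ln 49 / 2 + ln M0 / 2 - rq * ln M0 + rq * ln 27 / 2) e0.
have K0 : (0 : R) < n.+2%:R by rewrite ltr0n.
have := x0 n; have := y0 n; have := xM n; have := yM n; have := H n.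
move: (n.+2%:R : R) (x n) (y n) K0 => K X Y K0 h hY hX Y0 X0.
have pK t' : 0 < K `^ t' by exact: powR_gt0.
have p27 : (0 : R) < 27 by lra.
have p49 : (0 : R) < 49 by lra.
have lnle (a b : R) : 0 < a -> a <= b -> ln a <= ln b.
  by move=> a0 ab; rewrite ler_ln// posrE// (lt_le_trans a0).
have ln2 (a b : R) : 0 < a -> 0 < b -> ln (a * b) = ln a + ln b.
  by move=> a0 b0; rewrite lnM// posrE.
have {h} := lnle _ _ (powR_gt0 rq X0) h.
have {hX} := lnle _ _ (exprn_gt0 2 M00) hX.
have {hY} := lnle _ _ (mulr_gt0 (exprn_gt0 2 Y0) (exprn_gt0 3 K0)) hY.
have p1 : 0 < K `^ t * Y by rewrite mulr_gt0.
have K3 := exprn_gt0 3 K0; have tY := mulr_gt0 (pK t) Y0.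
rewrite (ln2 (Y ^+ 2)) ?exprn_gt0// (ln2 (X ^+ 2)) ?exprn_gt0 ?mulr_gt0// (ln2 27)//.
rewrite (ln2 C) ?powR_gt0 ?mulr_gt0// !ln_powR (ln2 49)// (ln2 (K `^ t))// ln_powR !lnXn//.
move: (ln X) (ln Y) (ln K) (ln C) (ln M0) (ln 27) (ln 49) => lX lY lK lC lM l27 l49.
move=> hY hX h; rewrite rpE.
(* The lower bound on [ln (x n)] has to be multiplied by the variable [rq]; everything else is
   linear. *)
have : 0 <= rq * (2 * lX + l27 + 3 * lK - 2 * lM) by rewrite mulr_ge0//; lra.
lra.
Qed.

(** After taking logarithms [M0] cancels and [- s / 2 * ln (1 + L n) <= ln C] remains, with an
    unbounded left side. *)
Lemma negative_power_contradiction (M0 C s : R) (L : nat -> R) :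
  0 < M0 -> 0 < C -> s < 0 -> (forall n, n.+2%:R <= 1 + L n) ->
  ~ (forall n, M0 `^ 2^-1 <= C * ((1 + L n) `^ s * M0) `^ 2^-1).
Proof.
move=> M00 C0 s0 hL H.
have e0 : 0 < - s / 2 by rewrite divr_gt0 ?oppr_gt0.
have [n] := ln_natr_unbounded (ln C) e0.
have K0 : (0 : R) < n.+2%:R by rewrite ltr0n.
have := hL n; have := H n.
move: (n.+2%:R : R) (1 + L n) K0 => K X K0 h KX.
have X0 : 0 < X := lt_le_trans K0 KX.
have lKX : ln K <= ln X by rewrite ler_ln// posrE.
have ln2 (a b : R) : 0 < a -> 0 < b -> ln (a * b) = ln a + ln b.
  by move=> a0 b0; rewrite lnM// posrE.
have : ln (M0 `^ 2^-1) <= ln (C * (X `^ s * M0) `^ 2^-1).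
  by rewrite ler_ln// posrE ?mulr_gt0 ?powR_gt0// mulr_gt0 ?powR_gt0.
rewrite ln2 ?powR_gt0// ?mulr_gt0 ?powR_gt0// !ln_powR ln2 ?powR_gt0// ln_powR.
move: (ln K) (ln X) (ln M0) (ln C) lKX => a b m c ab; nra.
Qed.

End asymptotics.

Section contradiction.
Context {R : realType}.
Notation S3 := (S3 R).
Variables (p : \bar R) (q s C : R).
Variable U : R -> (S3 * S3 -> R[i]) -> S3 * S3 -> R[i].
Hypotheses (hU : unitary_group_of (fun u z => laplace_x u z - laplace_y u z) U)
  (hp : (2%:E <= p)%E) (C0 : 0 < C)
  (H : forall u0 : S3 * S3 -> R[i], smooth u0 ->
    (LpLq_norm p q%:E (fun t => U t u0) <= C%:E * Hs_norm s u0)%E).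

Let zonalH (a : {poly R}) :
  (Lq_norm q%:E (of_real (zonal a)) <= C%:E * Hs_norm s (of_real (zonal a)))%E.
Proof.
rewrite -(zonal_LpLq_norm hU _ _ hp); apply: (@H).
by apply: smooth_of_real; exact: smooth2_zonal.
Qed.

(** The quantity [3 / 2 - 3 * q^-1] is [1 / p], by the relation between the exponents. *)
Lemma finite_exponent_false : 0 < q -> q <= 3 -> 3 / 2 - 3 * q^-1 <= 2 ->
  0 < 3 / 2 - 3 * q^-1 -> s < 3 / 2 - 3 * q^-1 -> False.
Proof.
move=> q0 q3 ip2 ip0 sip.
(* Interpolation asks for a nonnegative order; since [1 / p > 0], raising a negative [s] to 0 keeps
   it below [1 / p]. *)
pose t := Num.max s 0.
have t0 : 0 <= t by rewrite le_max lexx orbT.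
have tip : t < 3 / 2 - 3 * q^-1 by rewrite gt_max sip ip0.
have t2 : t <= 2 by rewrite ltW// (lt_le_trans tip).
have iq0 : 0 <= q^-1 by rewrite invr_ge0 ltW.
have M0 := @moment0_gt0 R; have Mg := @moment_gt0 R.
have n1 (n : nat) : n.+1%:R = n%:R + 1 :> R by rewrite natr1.
have n2 (n : nat) : n.+2%:R = n%:R + 2 :> R by rewrite -addn2 natrD.
(* The test function is [w^(n+1)]: its [L^q] norm is bounded below by the moment of order
   [3 (n + 1)], and its squared [L^2] norm is the one of order [2 (n + 1)]. *)
apply: (moment_asymptotics_contradiction (x := fun n => moment (3 * n.+1)%N)
  (y := fun n => moment (n.+1 + n.+1)%N) M0 C0 tip iq0 (erefl _)) => n //.
- apply: (le_trans (@moment_lower R (3 * n.+1)%N)).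
  rewrite ler_pM2l ?exprn_gt0// natrM (n1 n) (n2 n).
  have : (0 : R) <= n%:R by [].
  move: (n%:R : R) => k k0.
  (* [27 = 3^3], from [3 (k + 1) + 1 <= 3 (k + 2)]. *)
  have -> : 27 * (k + 2) ^+ 3 = (3 * (k + 2)) ^+ 3 by ring.
  by apply: lerXn2r; rewrite ?nnegrE; lra.
- have := @moment_upper R (n.+1 + n.+1)%N; rewrite natrD (n1 n) (n2 n).
  move: (n%:R : R) (moment _) (moment _) => k y m h.
  rewrite -(ler_pM2l (_ : 0 < 8 :> R)); last by lra.
  by apply: le_trans h; rewrite le_eqVlt; apply/orP; left; apply/eqP; ring.
(* The threshold is the frequency scale of the test function: the resolvent bound has the factor
   [K^2], which balances the two terms of the interpolation. *)
- pose K : R := n.+2%:R.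
  have K1 : 1 <= K by rewrite ler1n.
  pose v : S3 * S3 -> R := fun z => cos2half z ^+ n.+1 -
    (lap_x (fun z => cos2half z ^+ n.+1) z + lap_y (fun z => cos2half z ^+ n.+1) z).
  have [bv vle] := ip_resolvent_half (n := n) (erefl v).
  have st : s <= t by rewrite le_max lexx.
  have t02 : 0 <= t <= 2 by rewrite t0 t2.
  have Hs := Hs_norm_interpolation (smooth2_half n.+1) (erefl v) bv st t02 K1.
  have := zonalH (half_poly ^+ n.+1); rewrite zonal_half => h.
  rewrite -lee_fin EFinM.
  apply: le_trans (Lq_norm_half_ge n.+1 q0 q3) _.
  apply: le_trans h _; apply: lee_wpmul2l; first by rewrite lee_fin ltW.
  apply: le_trans Hs _; rewrite lee_fin ip_half.
  have w0 := ip_ge0 v.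
  have P0 (e : R) : 0 <= K `^ e := powR_ge0 _ _.
  have h2 : (0 : R) <= 2^-1 by rewrite invr_ge0.
  have y0 : 0 <= moment (n.+1 + n.+1) := ltW (Mg _).
  rewrite (ge0_ler_powR h2) ?nnegrE ?addr_ge0 ?mulr_ge0//.
  (* [49 = 1 + 48], one part for each term of the interpolation. *)
  rewrite -/K; have -> : 49 * (K `^ t * moment (n.+1 + n.+1)) =
    K `^ t * moment (n.+1 + n.+1) + 48 * (K `^ t * moment (n.+1 + n.+1)).
    by move: (K `^ t * _) => a; ring.
  rewrite lerD2l.
  have KE : K = n%:R + 2 by rewrite /K (n2 n).
  have -> : K `^ t = K `^ (t - 2) * K ^+ 2.
    rewrite -powR_mulrn ?(le_trans ler01)// -powRD ?subrK//.
    by apply/implyP => _; rewrite gt_eqF// (lt_le_trans ltr01).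
  apply: (@le_trans _ _ (K `^ (t - 2) * (48 * (n%:R + 2) ^+ 2 * moment (n.+1 + n.+1)))).
    exact: ler_wpM2l.
  rewrite -KE; move: (K `^ _) (moment _) => a b.
  by rewrite le_eqVlt; apply/orP; left; apply/eqP; ring.
Qed.

Lemma infinite_exponent_false : q = 2 -> s < 0 -> False.
Proof.
move=> q2 s0; have M0 := @moment0_gt0 R.
apply: (negative_power_contradiction (L := fun n => cheb_eigenvalue n.+1) M0 C0 s0) => n.
  rewrite /cheb_eigenvalue -(natr1 n.+1) -(natr1 n).
  have : (0 : R) <= n%:R by [].
  by move: (n%:R : R) => k k0; nra.
have b := smooth2_bounded_measurable (@eigen_cheb_zonal R n.+1).1.
have L0 : 0 <= cheb_eigenvalue n.+1 :> R by rewrite /cheb_eigenvalue !mulr_ge0// addr_ge0.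
have := zonalH (cheb n.+1).1; rewrite -/(cheb_zonal n.+1) q2 (Lq_norm2_of_real b).
rewrite ip_cheb_zonal => h; rewrite -lee_fin EFinM; apply: le_trans h _.
apply: lee_wpmul2l; first by rewrite lee_fin ltW.
by have := Hs_norm_eigen s (eigen_cheb_zonal n.+1) L0; rewrite ip_cheb_zonal.
Qed.

End contradiction.

Theorem proposition4p1 (R : realType) (p q : \bar R) (s : R)
    (U : R -> (S3 R * S3 R -> R[i]) -> S3 R * S3 R -> R[i])
    (hU : unitary_group_of (fun u z => laplace_x u z - laplace_y u z) U)
    (hp : (2%:E <= p)%E) (hq : (2%:E <= q)%E)
    (hpq : (2%:E / p + 6%:E / q = 3%:E)%E)
    (hs : (s%:E < p^-1)%E) :
  ~ exists C : R, 0 < C /\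
      forall u0 : S3 R * S3 R -> R[i], smooth u0 ->
        (LpLq_norm p q (fun t => U t u0) <= C%:E * Hs_norm s u0)%E.
Proof.
have nz (r : R) : (2%:E <= r%:E)%E -> (r == 0) = false.
  by rewrite lee_fin => r2; rewrite gt_eqF//; lra.
case=> C [C0 H]; move: hp hq hpq hs H.
case: p => [p' | |] //; case: q => [q' | |] //.
- move=> p2 q2; rewrite !inver !nz// -!EFinM -EFinD => -[pq]; rewrite lte_fin => sp H.
  move: p2 q2; rewrite !lee_fin => p2 q2.
  have ip0 : 0 < p'^-1 by rewrite invr_gt0; lra.
  have ip12 : p'^-1 <= 2^-1 by rewrite lef_pV2 ?posrE//; lra.
  have q0 : 0 < q' by lra.
  have ipE : p'^-1 = 3 / 2 - 3 * q'^-1 by lra.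
  have p2' : (2%:E <= p'%:E)%E by rewrite lee_fin.
  apply: (finite_exponent_false hU p2' C0 H q0); rewrite -?ipE//; last lra.
  (* From [1 / p <= 1 / 2] and the exponent relation, [q <= 3]. *)
  have h : 3^-1 <= q'^-1 by lra.
  by rewrite -lef_pV2 ?posrE.
(* With [q = oo] the relation would give [1 / p = 3 / 2], against [p >= 2]. *)
- move=> p2 _; rewrite inver nz// invey mule0 adde0 -EFinM => -[pq].
  move: p2; rewrite lee_fin => p2 _ _.
  have : p'^-1 <= 2^-1 by rewrite lef_pV2 ?posrE//; lra.
  lra.
(* With [p = oo] the relation forces [q = 2], and the bound on [s] reads [s < 0]. *)
- move=> _ q2; rewrite inver nz// invey mule0 add0e -EFinM => -[q6]; rewrite lte_fin => s0 H.
  have q0 : 0 < q' by move: q2; rewrite lee_fin; lra.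
  have q'2 : q' = 2 by rewrite -[q']invrK (_ : q'^-1 = 2^-1) ?invrK//; lra.
  exact: (infinite_exponent_false hU (leey _) C0 H q'2 s0).
- by move=> _ _; rewrite invey !mule0 adde0 => /esym/eqP; rewrite eqe pnatr_eq0.
Qed.
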